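(* Under the setting in the context (null log-linear model true), for any admissible $\phi_1,\phi_2$, \[ \frac{T^{\phi_1}(\boldsymbol{Y},\widehat{\boldsymbol{\theta}}_{\phi_2})}{\widetilde{\vartheta}_{n,N,\phi_2}}\xrightarrow[N\to\infty]{\mathcal{L}}\chi^2_{M-M_0-1},\qquad T^{\phi_1}(\boldsymbol{Y},\widehat{\boldsymbol{\theta}}_{\phi_2})=\frac{2nN}{\phi_1''(1)}d_{\phi_1}\big(\widehat{\boldsymbol{p}},\boldsymbol{p}(\widehat{\boldsymbol{\theta}}_{\phi_2})\big). \]
   Context: Let $M\ge 3$ and $1\le M_0<M-1$. Let $\boldsymbol{W}$ be a real $M\times M_0$ matrix of full column rank whose columns, together with $\boldsymbol{1}_M=(1,\dots,1)^T$, are linearly independent. For $\boldsymbol{\theta}\in\mathbb{R}^{M_0}$ define $\boldsymbol{p}(\boldsymbol{\theta})=\exp\{\boldsymbol{W}\boldsymbol{\theta}\}/(\boldsymbol{1}_M^T\exp\{\boldsymbol{W}\boldsymbol{\theta}\})$. For a probability vector $\boldsymbol{p}$, $\boldsymbol{D}_{\boldsymbol{p}}=\mathrm{diag}(\boldsymbol{p})$ and $\boldsymbol{\Sigma}_{\boldsymbol{p}}=\boldsymbol{D}_{\boldsymbol{p}}-\boldsymbol{p}\boldsymbol{p}^T$. Data (equal cluster sizes): $N$ clusters of size $n\ge 2$; cluster frequency vectors $\boldsymbol{Y}^{(\ell)}$, $\ell=1,\dots,N$, i.i.d. with nonnegative integer entries summing to $n$, $\mathrm{E}[\boldsymbol{Y}^{(\ell)}]=n\boldsymbol{p}(\boldsymbol{\theta}_0)$,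 $\mathrm{Var}[\boldsymbol{Y}^{(\ell)}]=\vartheta_n n\boldsymbol{\Sigma}_{\boldsymbol{p}(\boldsymbol{\theta}_0)}$, $\vartheta_n=1+(n-1)\rho^2$, $\rho^2\ge0$, $\boldsymbol{\theta}_0$ the unknown true parameter. $\widehat{\boldsymbol{p}}^{(\ell)}=\boldsymbol{Y}^{(\ell)}/n$, $\widehat{\boldsymbol{p}}=\frac1{nN}\sum_\ell\boldsymbol{Y}^{(\ell)}$. Admissible $\phi:(0,\infty)\to\mathbb{R}$: convex, twice continuously differentiable, $\phi(1)=\phi'(1)=0$, $\phi''(1)>0$, conventions $0\phi(0/0)=0$, $0\phi(p/0)=p\lim_{u\to\infty}\phi(u)/u$; $d_\phi(\boldsymbol{p},\boldsymbol{q})=\sum_r q_r\phi(p_r/q_r)$; QM$\phi$E $\widehat{\boldsymbol{\theta}}_\phi=\arg\min_{\boldsymbol{\theta}}d_\phi(\widehat{\boldsymbol{p}},\boldsymbol{p}(\boldsymbol{\theta}))$. Semi-parametric design effect estimator: $\widetilde{\vartheta}_{n,N,\phi}=X^2(\widetilde{\boldsymbol{Y}},\widehat{\boldsymbol{\theta}}_\phi)/((N-1)(M-1))$ with $X^2(\widetilde{\boldsymbol{Y}},\widehat{\boldsymbol{\theta}}_\phi)=n\sum_{\ell=1}^N\sum_{r=1}^M(\widehat{p}^{(\ell)}_r-\widehat{p}_r)^2/p_r(\widehat{\boldsymbol{\theta}}_\phi)$. *)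

(* Defs.v *)
From HB Require Import structures.
From mathcomp Require Import all_boot all_order all_algebra.
From mathcomp Require Import all_classical all_reals all_analysis.
Set Implicit Arguments. Unset Strict Implicit. Unset Printing Implicit Defensive.
Import Order.TTheory GRing.Theory Num.Theory.
Import numFieldNormedType.Exports.
Local Open Scope classical_set_scope.
Local Open Scope ring_scope.

Section Defs.
Variable R : realType.

Definition pmodel (M M0 : nat) (W : 'M[R]_(M, M0)) (th : 'cV[R]_M0) : 'I_M -> R :=
  fun r => expR ((W *m th) r 0) / \sum_(s < M) expR ((W *m th) s 0).

Definition Sigma (M : nat) (p : 'I_M -> R) (r s : 'I_M) : R :=
  (r == s)%:R * p r - p r * p s.

Definition phi_at0 (phi : R -> R) : \bar R :=
  lim ((phi u)%:E @[u --> 0^'+]).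

Definition phi_slope_inf (phi : R -> R) : \bar R :=
  lim ((phi u / u)%:E @[u --> +oo]).

Definition phi2nd (phi : R -> R) : R -> R := derive1 (derive1 phi).

Definition admissible (phi : R -> R) : Prop :=
  [/\ (forall x y t : R, 0 < x -> 0 < y -> 0 <= t <= 1 ->
         phi (t * x + (1 - t) * y) <= t * phi x + (1 - t) * phi y),
      (forall x : R, 0 < x -> derivable phi x 1 /\ derivable (derive1 phi) x 1),
      (forall x : R, 0 < x -> {for x, continuous (phi2nd phi)}),
      phi 1 = 0 /\ derive1 phi 1 = 0 & 0 < phi2nd phi 1].

(* phi-divergence d_phi(p,q) = sum_r q_r phi(p_r/q_r), with the conventions
   0 phi(0/0) = 0, 0 phi(p/0) = p lim_{u->oo} phi(u)/u, and phi(0) = lim_{u->0+} phi(u) *)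
Definition dphi (M : nat) (phi : R -> R) (p q : 'I_M -> R) : \bar R :=
  (\sum_(r < M)
     (if q r == 0%R then (if p r == 0%R then 0%E else (p r)%:E * phi_slope_inf phi)
      else if p r == 0%R then (q r)%:E * phi_at0 phi
      else (q r * phi (p r / q r))%:E))%E.

Definition chi2_kernel (k : nat) (t : R) : R :=
  powR t (k%:R / 2 - 1) * expR (- (t / 2)).

Definition chi2_cdf (k : nat) (x : R) : R :=
  fine (\int[lebesgue_measure]_(t in `[0%R, x]) (chi2_kernel k t)%:E)%E /
  fine (\int[lebesgue_measure]_(t in `[0%R, +oo[) (chi2_kernel k t)%:E)%E.

Definition mutually_independent d (T : measurableType d) (P : probability T R)
  (U : Type) (X : nat -> T -> U) : Prop :=
  forall (s : seq nat) (A : nat -> set U), uniq s ->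
    P (\bigcap_(l in [set` s]) (X l @^-1` A l)) =
    (\prod_(l <- s) P (X l @^-1` A l))%E.

Definition identically_distributed d (T : measurableType d) (P : probability T R)
  (U : Type) (X : nat -> T -> U) : Prop :=
  forall (l : nat) (A : set U), P (X l @^-1` A) = P (X 0%N @^-1` A).

Definition phat_cl (M n : nat) (Y : 'I_M -> nat) : 'I_M -> R :=
  fun r => (Y r)%:R / n%:R.

Definition phat (M n : nat) T (Y : nat -> T -> 'I_M -> nat) (N : nat) (w : T) : 'I_M -> R :=
  fun r => (\sum_(l < N) (Y l w r)%:R) / (n * N)%:R.

Definition X2stat (M M0 n : nat) (W : 'M[R]_(M, M0)) T (Y : nat -> T -> 'I_M -> nat)
  (N : nat) (w : T) (th : 'cV[R]_M0) : R :=
  n%:R * \sum_(l < N) \sum_(r < M)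
    (phat_cl n (Y l w) r - phat n Y N w r) ^+ 2 / pmodel W th r.

Definition deff_est (M M0 n : nat) (W : 'M[R]_(M, M0)) T (Y : nat -> T -> 'I_M -> nat)
  (N : nat) (w : T) (th : 'cV[R]_M0) : R :=
  X2stat n W Y N w th / ((N - 1)%:R * (M - 1)%:R).

Definition Tphi (M M0 n : nat) (phi : R -> R) (W : 'M[R]_(M, M0)) T
  (Y : nat -> T -> 'I_M -> nat) (N : nat) (w : T) (th : 'cV[R]_M0) : \bar R :=
  ((2 * n%:R * N%:R / phi2nd phi 1)%:E * dphi phi (phat n Y N w) (pmodel W th))%E.

End Defs.

(* Main.v *)
(* The model consists of the exponential tilts p0 exp(z) of p0 = p(theta0), with
   z in the span of 1 and the columns of W.  Let y_r = (phat_r - p0_r)/sqrt(p0_r)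
   and let P be the orthogonal projection onto the complement of D^(1/2)[W 1];
   it has rank M - M0 - 1.  Comparing the value of d_phi2 at its minimiser with
   its value at one explicit tilt, without any expansion of the minimiser,
   gives (2/phi1''(1)) d_phi1(phat, p(thhat)) = |P y|^2 + o(|y|^2).

   Up to the factor vartheta_n, n N |P y|^2 is the squared norm of a normalised
   sum of bounded i.i.d. vectors with covariance P.  Its Laplace transform is
   found by telescoping against the explicit heat flow of exp(-t|v|^2), which
   replaces the multivariate central limit theorem and the normal law.  At
   integers t the transforms are the moments of exp(-Q), a variable with values
   in [0,1], so the Weierstrass theorem turns their convergence into convergence
   of distribution functions.  The chi-square law has the same transforms by
   scaling of Lebesgue measure.  Finally the Pearson estimator tends to
   vartheta_n by Chebyshev's inequality, and the ratio is sandwiched. *)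

(* Cluster vectors take finitely many values, so every expectation is a finite sum [iidE]; measure
   theory serves only to transfer events and to handle the limit density. The obstacle is the
   estimator: a minimiser need not exist for every sample (cells may be empty), and the estimator is
   constrained only when one exists. Hence the analysis of the divergence is deterministic, for p
   near p0, and includes existence there. A sample is bad when N|y|^2 exceeds a constant K, or when
   the sum of the centred squared norms exceeds a small multiple of N; Markov and Chebyshev make
   both improbable. On the remaining samples the ratio and the quadratic form Q agree about the
   threshold x up to a shift h, so continuity of the limit distribution function finishes the proof.
   The telescoping works because its third-order error is uniform in the current position v: powers
   of |v| are absorbed by the Gaussian factor. *)
Require Import Defs.
From HB Require Import structures.
From mathcomp Require Import all_boot all_order all_algebra ring lra.
From mathcomp Require Import all_classical all_reals all_analysis.
From mathcomp Require Import measurable_realfun.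
Import Order.TTheory GRing.Theory Num.Theory.
Import numFieldNormedType.Exports.
Local Open Scope classical_set_scope.
Local Open Scope ring_scope.
Set Implicit Arguments.
Unset Strict Implicit.
Unset Printing Implicit Defensive.

(** * Finite i.i.d. expectations and polynomial approximation *)

Section IidExpectation.
Variables (R : realType) (A : finType).
Implicit Types (mu : A -> R) (f g : seq A -> R).

(* Expectation under N independent draws; the recursion stands for a product
   measure. *)
Fixpoint iidE mu (N : nat) f : R :=
  if N is N'.+1 then \sum_a mu a * iidE mu N' (fun s => f (a :: s)) else f [::].

Lemma eq_iidE mu N f g : (forall s, size s = N -> f s = g s) ->
  iidE mu N f = iidE mu N g.
Proof.
elim: N f g => [|N IH] f g fg /=; first exact: fg.
by apply: eq_bigr => a _; congr (_ * _); apply: IH => s sN; apply: fg; rewrite /= sN.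
Qed.

Lemma iidED mu N f g : iidE mu N (fun s => f s + g s) = iidE mu N f + iidE mu N g.
Proof.
elim: N f g => [//|N IH] f g /=.
by rewrite -big_split/=; apply: eq_bigr => a _; rewrite IH mulrDr.
Qed.

Lemma iidEZ mu N c f : iidE mu N (fun s => c * f s) = c * iidE mu N f.
Proof.
elim: N f => [//|N IH] f /=.
by rewrite mulr_sumr; apply: eq_bigr => a _; rewrite IH mulrCA.
Qed.

Lemma iidEN mu N f : iidE mu N (fun s => - f s) = - iidE mu N f.
Proof. by rewrite -mulN1r -iidEZ; apply: eq_iidE => s _; rewrite mulN1r. Qed.

Lemma iidEB mu N f g : iidE mu N (fun s => f s - g s) = iidE mu N f - iidE mu N g.
Proof. by rewrite iidED iidEN. Qed.

Lemma iidE0 mu N : iidE mu N (fun=> 0) = 0.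
Proof. by rewrite -[RHS](mul0r (iidE mu N (fun=> 0))) -iidEZ; apply: eq_iidE => s _; rewrite mul0r. Qed.

Lemma iidE_sum mu N (I : Type) (r : seq I) (F : I -> seq A -> R) :
  iidE mu N (fun s => \sum_(i <- r) F i s) = \sum_(i <- r) iidE mu N (F i).
Proof.
elim: r => [|i r IH].
  by rewrite big_nil -[RHS](iidE0 mu N); apply: eq_iidE => s _; rewrite big_nil.
by rewrite big_cons -IH -iidED; apply: eq_iidE => s _; rewrite big_cons.
Qed.

Section Law.
Variable mu : A -> R.
Hypothesis mu_ge0 : forall a, 0 <= mu a.
Hypothesis mu_sum1 : \sum_a mu a = 1.

Lemma iidE_cst N c : iidE mu N (fun=> c) = c.
Proof. by elim: N => [//|N /= ->]; rewrite -mulr_suml mu_sum1 mul1r. Qed.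

Lemma ler_iidE N f g : (forall s, size s = N -> f s <= g s) ->
  iidE mu N f <= iidE mu N g.
Proof.
elim: N f g => [|N IH] f g fg /=; first exact: fg.
by apply: ler_sum => a _; apply: ler_wpM2l => //; apply: IH => s sN; apply: fg; rewrite /= sN.
Qed.

Lemma ler_norm_iidE N f : `|iidE mu N f| <= iidE mu N (fun s => `|f s|).
Proof.
by rewrite ler_norml -iidEN !ler_iidE// => s _; have := lexx `|f s|; rewrite ler_norml => /andP[].
Qed.

Lemma iidE_sum_mean0 (g : A -> R) N : \sum_a mu a * g a = 0 ->
  iidE mu N (fun s => \sum_(x <- s) g x) = 0.
Proof.
move=> g0; elim: N => [|N IH] /=; first by rewrite big_nil.
rewrite -[RHS]g0; apply: eq_bigr => a _; congr (_ * _)%R.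
transitivity (iidE mu N (fun s => g a + \sum_(x <- s) g x)); last by rewrite iidED iidE_cst IH addr0.
by apply: eq_iidE => s _; rewrite big_cons.
Qed.

Lemma iidE_sum_sqr (g : A -> R) N : \sum_a mu a * g a = 0 ->
  iidE mu N (fun s => (\sum_(x <- s) g x) ^+ 2) = N%:R * \sum_a mu a * g a ^+ 2.
Proof.
move=> g0; elim: N => [|N IH] /=; first by rewrite big_nil expr0n/= mul0r.
transitivity (\sum_a mu a * (g a ^+ 2 + N%:R * \sum_b mu b * g b ^+ 2)).
  apply: eq_bigr => a _; congr (_ * _).
  transitivity (iidE mu N (fun s => g a ^+ 2 + 2 * g a * (\sum_(x <- s) g x)
                                   + (\sum_(x <- s) g x) ^+ 2)).
    by apply: eq_iidE => s _; rewrite big_cons; ring.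
  by rewrite !iidED iidE_cst iidEZ iidE_sum_mean0// IH mulr0 addr0.
rewrite (eq_bigr _ (fun a _ => mulrDr _ _ _)).
by rewrite big_split/= -mulr_suml mu_sum1 mul1r -natr1 mulrDl mul1r addrC.
Qed.

Lemma iidE_chebyshev (g : A -> R) N (K : R) : 0 < K -> \sum_a mu a * g a = 0 ->
  iidE mu N (fun s => (K < `|\sum_(x <- s) g x|)%R%:R)
    <= N%:R * (\sum_a mu a * g a ^+ 2) / K ^+ 2.
Proof.
move=> K0 g0; rewrite -iidE_sum_sqr// mulrC -iidEZ; apply: ler_iidE => s _.
have K2 : 0 < K ^+ 2 by rewrite exprn_gt0.
case: ltP => [Klt|_]; last by rewrite mulr_ge0 ?invr_ge0 ?(ltW K2)// sqr_ge0.
rewrite /= ler_pdivlMl// mulr1 -[leRHS]real_normK ?num_real// ler_sqr ?nnegrE ?(ltW K0)//.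
exact: ltW.
Qed.

End Law.
End IidExpectation.

Section Bernstein.
Variable R : realType.

Let bern (u : R) (b : bool) : R := if b then u else 1 - u.

(** Each draw contributes a factor u or 1 - u, and [F] does not depend on u. No restriction on u is
    needed: this is an identity of polynomials. *)
Lemma iidE_bool_poly N (F : seq bool -> R) :
  exists p : {poly R}, forall u, iidE (bern u) N F = p.[u].
Proof.
elim: N F => [|N IH] F /=; first by exists (F [::])%:P => u; rewrite hornerC.
have [p pE] := IH (fun s => F (true :: s)).
have [q qE] := IH (fun s => F (false :: s)).
exists ('X * p + (1 - 'X) * q) => u.
by rewrite big_bool /= pE qE !hornerE.
Qed.

(* The polynomial is Bernstein's: the expectation of f at the empirical mean of
   Bernoulli(u) trials, whose variance is at most 1/N. *)
Lemma lipschitz_weierstrass (f : R -> R) (L e : R) : 0 < L -> 0 < e ->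
  (forall u v, `|f u - f v| <= L * `|u - v|) ->
  exists p : {poly R}, forall u, 0 <= u <= 1 -> `|f u - p.[u]| <= e.
Proof.
move=> L0 e0 fL.
(* Over a distance h the function varies by at most e; N >= h^-2 brings the standard deviation of
   the empirical mean below h. *)
pose h : R := e / L.
have h0 : 0 < h by rewrite divr_gt0.
have eE : e = L * h by rewrite /h; field; rewrite gt_eqF.
clearbody h.
pose N := (Num.truncn (h ^- 2)).+1.
have N0 : 0 < N%:R :> R by rewrite ltr0n.
have hN : h ^- 2 <= N%:R by rewrite ltW// truncnS_gt.
clearbody N.
pose F (s : seq bool) := f ((\sum_(b <- s) (b%:R : R)) / N%:R).
have [p pE] := iidE_bool_poly N F.
exists p => u /andP[u0 u1]; rewrite -pE.
have b0 b : 0 <= bern u b by case: b => //=; rewrite subr_ge0.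
have b1 : \sum_b bern u b = 1 by rewrite big_bool/=; ring.
have m0 : \sum_b bern u b * (b%:R - u) = 0 by rewrite big_bool/=; ring.
have v1 : \sum_b bern u b * (b%:R - u) ^+ 2 <= 1.
  by rewrite big_bool/=; nra.
rewrite -(iidE_cst b1 N (f u)) -iidEB.
apply: (le_trans (ler_norm_iidE b0 N _)).
(* For the deviation y of the empirical mean, |y| <= h/2 + y^2/(2h): the variance then controls the
   mean absolute error without a square root, and each term costs e/2. *)
apply: (@le_trans _ _ (iidE (bern u) N (fun s =>
   L * h / 2 + L / (2 * h * N%:R ^+ 2) * (\sum_(b <- s) (b%:R - u)) ^+ 2))).
  apply: ler_iidE => // s sN; apply: (le_trans (fL _ _)).
  have -> : L * h / 2 + L / (2 * h * N%:R ^+ 2) * (\sum_(b <- s) (b%:R - u)) ^+ 2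
      = L * (h / 2 + ((\sum_(b <- s) (b%:R - u)) / N%:R) ^+ 2 / (2 * h)).
    by field; rewrite !gt_eqF.
  rewrite ler_pM2l//.
  have -> : (\sum_(b <- s) (b%:R - u)) / N%:R = (\sum_(b <- s) b%:R) / N%:R - u.
    rewrite big_split/= big_const_seq count_predT sN iter_addr_0 -mulr_natr.
    by field; rewrite gt_eqF.
  rewrite distrC; set y := (_ - u); rewrite -(real_normK (num_real y)).
  rewrite -subr_ge0.
  have -> : h / 2 + `|y| ^+ 2 / (2 * h) - `|y| = (`|y| - h) ^+ 2 / (2 * h).
    by field; rewrite gt_eqF.
  by rewrite divr_ge0 ?sqr_ge0// mulr_ge0// ltW.
rewrite iidED iidE_cst// iidEZ iidE_sum_sqr//.
apply: (@le_trans _ _ (L * h / 2 + L / (2 * h * N%:R))).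
  rewrite lerD2l.
  have -> : L / (2 * h * N%:R) = L / (2 * h * N%:R ^+ 2) * (N%:R * 1).
    by field; rewrite !gt_eqF.
  apply: ler_wpM2l; first by apply/ltW; rewrite divr_gt0 ?mulr_gt0 ?exprn_gt0.
  by rewrite ler_pM2l.
suff : L / (2 * h * N%:R) <= L * h / 2 by rewrite eE; lra.
rewrite ler_pdivrMr ?mulr_gt0//.
have {1}-> : L = L * h / 2 * (2 * h * h ^- 2) by field; rewrite gt_eqF.
by rewrite !ler_pM2l ?divr_gt0 ?mulr_gt0.
Qed.

End Bernstein.

(** * Laplace transform of a normalised sum *)

Section Taylor.
Variable R : realType.
Implicit Types f g : R -> R.

Lemma is_derive_bound f g (C a b : R) : a <= b ->
  (forall x, a <= x <= b -> is_derive x 1 f (g x)) ->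
  (forall x, a <= x <= b -> `|g x| <= C) ->
  `|f b - f a| <= C * (b - a).
Proof.
move=> ab fg gC.
have fd x : x \in `]a, b[ -> is_derive x 1 f (g x).
  by rewrite in_itv/= => /andP[ax xb]; apply: fg; rewrite !ltW.
have fc : {within `[a, b], continuous f}.
  apply: continuous_in_subspaceT => x; rewrite inE/= in_itv/= => xab.
  have := fg x xab => fgx.
  by apply/differentiable_continuous/derivable1_diffP; exact: ex_derive.
have [c cab ->] := MVT_segment ab fd fc.
rewrite normrM (ger0_norm (_ : 0 <= b - a)) ?subr_ge0//.
by apply: ler_wpM2r; rewrite ?subr_ge0// gC//; move: cab; rewrite in_itv.
Qed.

(** The mean value bound is applied twice, first to f1 and then to f minus its linear part; this
    gives C instead of the sharp C/2, which is enough. *)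
Lemma taylor1_bound f f1 f2 (C b : R) : 0 <= b ->
  (forall x, 0 <= x <= b -> is_derive x 1 f (f1 x)) ->
  (forall x, 0 <= x <= b -> is_derive x 1 f1 (f2 x)) ->
  (forall x, 0 <= x <= b -> `|f2 x| <= C) ->
  `|f b - f 0 - f1 0 * b| <= C * b ^+ 2.
Proof.
move=> b0 ff1 f12 f2C.
have C0 : 0 <= C by apply: (le_trans (normr_ge0 (f2 0))); apply: f2C; rewrite lexx.
have f1B x : 0 <= x <= b -> `|f1 x - f1 0| <= C * b.
  move=> /andP[x0 xb]; apply: (@le_trans _ _ (C * (x - 0))); last first.
    by rewrite subr0 ler_wpM2l.
  apply: is_derive_bound x0 _ _ => y /andP[y0 yx]; [apply: f12|apply: f2C];
    by rewrite y0 (le_trans yx).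
have := @is_derive_bound (fun x => f x - f1 0 * x) (fun x => f1 x - f1 0) (C * b) 0 b b0.
rewrite mulr0 !subr0 expr2 mulrA => H.
rewrite -addrA -opprD (addrC (f 0)) opprD addrA; apply: H => // x xb.
have := ff1 x xb => ?.
by apply: is_derive_eq; rewrite /GRing.scale/= mulr1.
Qed.

Lemma taylor2_bound f f1 f2 f3 (C b : R) : 0 <= b ->
  (forall x, 0 <= x <= b -> is_derive x 1 f (f1 x)) ->
  (forall x, 0 <= x <= b -> is_derive x 1 f1 (f2 x)) ->
  (forall x, 0 <= x <= b -> is_derive x 1 f2 (f3 x)) ->
  (forall x, 0 <= x <= b -> `|f3 x| <= C) ->
  `|f b - f 0 - f1 0 * b - f2 0 * b ^+ 2 / 2| <= C * b ^+ 3.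
Proof.
move=> b0 ff1 f12 f23 f3C.
have C0 : 0 <= C by apply: (le_trans (normr_ge0 (f3 0))); apply: f3C; rewrite lexx.
have f2B x : 0 <= x <= b -> `|f2 x - f2 0| <= C * b.
  move=> /andP[x0 xb]; apply: (@le_trans _ _ (C * (x - 0))); last first.
    by rewrite subr0 ler_wpM2l.
  apply: is_derive_bound x0 _ _ => y /andP[y0 yx]; [apply: f23|apply: f3C];
    by rewrite y0 (le_trans yx).
have := @taylor1_bound (fun x => f x - f2 0 / 2 * x ^+ 2) (fun x => f1 x - f2 0 * x)
  (fun x => f2 x - f2 0) (C * b) b b0.
have -> : f b - f 0 - f1 0 * b - f2 0 * b ^+ 2 / 2 =
  f b - f2 0 / 2 * b ^+ 2 - (f 0 - f2 0 / 2 * 0 ^+ 2) - (f1 0 - f2 0 * 0) * b by ring.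
have -> : C * b ^+ 3 = C * b * b ^+ 2 by ring.
apply => // x xb.
- have := ff1 x xb => ?.
  by apply: is_derive_eq; rewrite /GRing.scale/= ; field.
- have := f12 x xb => ?.
  by apply: is_derive_eq; rewrite /GRing.scale/= mulr1.
Qed.

Lemma expR_sqr_bound (y : R) : 0 <= y -> y ^+ 2 * expR (- y) <= 4.
Proof.
move=> y0; rewrite expRN ler_pdivrMr ?expR_gt0//.
have -> : y = y / 2 + y / 2 by field.
rewrite expRD; have := expR_ge1Dx (y / 2) => H.
have : (y / 2) ^+ 2 <= expR (y / 2) ^+ 2.
  by rewrite ler_sqr ?nnegrE ?expR_ge0 ?divr_ge0//; apply: le_trans H; lra.
nra.
Qed.

Lemma expR_lin_bound (y : R) : 0 <= y -> y * expR (- y) <= 1.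
Proof.
move=> y0; rewrite expRN ler_pdivrMr ?expR_gt0// mul1r.
by apply: le_trans (expR_ge1Dx y); lra.
Qed.

(** The remainder is free of al and be. The discriminant condition makes the quadratic q nonnegative
    and gives q'^2 <= 4 ga q, so powers of q' become powers of q, which exp(-q) absorbs. With f =
    exp(-q), q'^2 f <= 4 ga and q'^4 f <= 64 ga^2, whence the constants 5 and 44. *)
Lemma taylor_gaussian_line (al be ga Ga b : R) : 0 <= b -> 0 <= al -> 0 <= ga <= Ga ->
  be ^+ 2 <= 4 * al * ga ->
  `|expR (- (al + be * b + ga * b ^+ 2))
    - expR (- al) * (1 - be * b + (be ^+ 2 / 2 - ga) * b ^+ 2)|
  <= (5 * Ga + 44 * Ga ^+ 2) * b ^+ 3.
Proof.
move=> b0 al0 /andP[ga0 gaGa] disc.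
pose q x := al + be * x + ga * x ^+ 2.
pose w x := be + 2 * ga * x.
have q0 x : 0 <= q x.
  have [ga_0|ga_n0] := eqVneq ga 0; last first.
    have gap : 0 < ga by rewrite lt_def ga_n0.
    rewrite -(pmulr_rge0 _ gap) /q.
    have -> : ga * (al + be * x + ga * x ^+ 2) =
      (ga * x + be / 2) ^+ 2 + (4 * al * ga - be ^+ 2) / 4 by field.
    by rewrite addr_ge0 ?sqr_ge0// divr_ge0// subr_ge0.
  have be0 : be = 0.
    by apply/eqP; rewrite -sqrf_eq0 eq_le sqr_ge0 andbT (le_trans disc)// ga_0 mulr0.
  by rewrite /q be0 ga_0 !mul0r !addr0.
have wq x : w x ^+ 2 <= 4 * ga * q x.
  rewrite -subr_ge0; have -> : 4 * ga * q x - w x ^+ 2 = 4 * al * ga - be ^+ 2.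
    by rewrite /w /q; ring.
  by rewrite subr_ge0.
pose f x := expR (- q x).
pose f1 x := - w x * f x.
pose f2 x := (w x ^+ 2 - 2 * ga) * f x.
pose f3 x := (- w x ^+ 3 + 6 * ga * w x) * f x.
have dq (x : R) : is_derive x 1 q (w x).
  by apply: is_derive_eq; rewrite /GRing.scale/= /w; ring.
have dw (x : R) : is_derive x 1 w (2 * ga).
  by apply: is_derive_eq; rewrite /GRing.scale/=; ring.
have df (x : R) : is_derive x 1 f (f1 x).
  apply: is_derive_eq; rewrite /GRing.scale/= /f1 /f; ring.
have df1 (x : R) : is_derive x 1 f1 (f2 x).
  apply: is_derive_eq; rewrite /GRing.scale/= /f2 /f1; ring.
have df2 (x : R) : is_derive x 1 f2 (f3 x).
  apply: is_derive_eq; rewrite /GRing.scale/= /f3 /f2 /f1; ring.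
have -> : expR (- (al + be * b + ga * b ^+ 2))
    - expR (- al) * (1 - be * b + (be ^+ 2 / 2 - ga) * b ^+ 2)
  = f b - f 0 - f1 0 * b - f2 0 * b ^+ 2 / 2.
  by rewrite /f2 /f1 /f /w {2 3 4}/q !mulr0 expr0n/= mulr0 !addr0; field.
apply: (@taylor2_bound f f1 f2 f3 _ b b0 (fun x _ => df x) (fun x _ => df1 x) (fun x _ => df2 x)) => x _.
rewrite /f3.
rewrite normrM (ger0_norm (expR_ge0 _)).
have H1 := expR_lin_bound (q0 x); have H2 := expR_sqr_bound (q0 x).
have H3 : f x <= 1 by rewrite /f -expR0 ler_expR oppr_le0.
have f0 : 0 <= f x by exact: expR_ge0.
(* Odd powers are traded for even ones: 2|w|^3 <= w^2 + w^4 and 2|w| <= 1 + w^2. *)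
have Hn : `|- w x ^+ 3 + 6 * ga * w x| <= (w x ^+ 2 + w x ^+ 4) / 2 + 3 * ga * (1 + w x ^+ 2).
  have P1 := mulr_ge0 (sqr_ge0 (w x)) (sqr_ge0 (1 + w x)).
  have P2 := mulr_ge0 (sqr_ge0 (w x)) (sqr_ge0 (1 - w x)).
  have P3 := mulr_ge0 ga0 (sqr_ge0 (1 + w x)).
  have P4 := mulr_ge0 ga0 (sqr_ge0 (1 - w x)).
  rewrite ler_norml; apply/andP; split; rewrite -subr_ge0.
  - have -> : - w x ^+ 3 + 6 * ga * w x - - ((w x ^+ 2 + w x ^+ 4) / 2 + 3 * ga * (1 + w x ^+ 2))
      = w x ^+ 2 * (1 - w x) ^+ 2 / 2 + 3 * (ga * (1 + w x) ^+ 2) by field.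
    lra.
  - have -> : (w x ^+ 2 + w x ^+ 4) / 2 + 3 * ga * (1 + w x ^+ 2) - (- w x ^+ 3 + 6 * ga * w x)
      = w x ^+ 2 * (1 + w x) ^+ 2 / 2 + 3 * (ga * (1 - w x) ^+ 2) by field.
    lra.
apply: (le_trans (ler_wpM2r f0 Hn)).
have W2 : w x ^+ 2 * f x <= 4 * ga.
  apply: (le_trans (ler_wpM2r f0 (wq x))).
  have : 4 * ga * (q x * f x) <= 4 * ga * 1 by apply: ler_wpM2l; [lra|exact: H1].
  by rewrite mulr1 mulrA.
have W4 : w x ^+ 4 * f x <= 64 * ga ^+ 2.
  have W : w x ^+ 4 <= (4 * ga * q x) ^+ 2.
    rewrite (_ : w x ^+ 4 = (w x ^+ 2) ^+ 2); last by rewrite -exprM.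
    by rewrite ler_sqr ?nnegrE ?sqr_ge0// !mulr_ge0.
  apply: (le_trans (ler_wpM2r f0 W)).
  have -> : (4 * ga * q x) ^+ 2 * f x = 16 * ga ^+ 2 * (q x ^+ 2 * f x) by ring.
  have -> : 64 * ga ^+ 2 = 16 * ga ^+ 2 * 4 by ring.
  by apply: ler_wpM2l => //; rewrite mulr_ge0 ?sqr_ge0.
apply: (@le_trans _ _ (5 * ga + 44 * ga ^+ 2)).
  have W2' : 3 * ga * (w x ^+ 2 * f x) <= 3 * ga * (4 * ga) by apply: ler_wpM2l => //; lra.
  have W0' : 3 * ga * f x <= 3 * ga * 1 by apply: ler_wpM2l => //; lra.
  nra.
nra.
Qed.

(** Again uniform in al: with y = 1/(1 + c x), al occurs in the second derivative only through al y
    and its square, multiplied by a factor at most exp(-al y). The 10 is 2 * 4 + 2 from the bounds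
    on z^2 exp(-z) and z exp(-z). *)
Lemma taylor_heat_time (al c ka h : R) : 0 <= al -> 0 <= c -> 0 <= ka -> 0 <= h ->
  `|expR (- ka * ln (1 + c * h) - al / (1 + c * h))
    - expR (- al) * (1 + (al * c - ka * c) * h)|
  <= (2 * ka ^+ 2 + ka + 10) * c ^+ 2 * h ^+ 2.
Proof.
move=> al0 c0 ka0 h0.
pose D x : R := 1 + c * x.
have D1 x : 0 <= x <= h -> 1 <= D x by move=> /andP[x0 _]; rewrite /D lerDl mulr_ge0.
pose f x := expR (- ka * ln (D x) - al * (D x)^-1).
pose g x := - ka * c * (D x)^-1 + al * c * (D x)^-1 ^+ 2.
pose f1 x := g x * f x.
pose f2 x := (g x ^+ 2 + ka * c ^+ 2 * (D x)^-1 ^+ 2 - 2 * al * c ^+ 2 * (D x)^-1 ^+ 3) * f x.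
have dD (x : R) : is_derive x 1 D c.
  by apply: is_derive_eq; rewrite /GRing.scale/=; ring.
have dV (x : R) : 0 <= x <= h -> is_derive x 1 (fun x => (D x)^-1) (- c * (D x)^-1 ^+ 2).
  move=> xh; have Dx : 0 < D x by apply: lt_le_trans (D1 _ xh).
  have -> : - c * (D x)^-1 ^+ 2 = - (D x)^-2 *: c by rewrite /GRing.scale/= exprVn; ring.
  apply: is_deriveV; exact: lt0r_neq0.
have dL (x : R) : 0 <= x <= h -> is_derive x 1 (fun x => ln (D x)) (c * (D x)^-1).
  move=> xh; have Dx : 0 < D x by apply: lt_le_trans (D1 _ xh).
  have dln := is_derive1_ln Dx.
  by apply: is_derive_eq; rewrite mulrC.
have df (x : R) : 0 <= x <= h -> is_derive x 1 f (f1 x).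
  move=> xh; have dVx := dV _ xh; have dLx := dL _ xh.
  apply: is_derive_eq; rewrite /GRing.scale/= /f1 /g /f; ring.
have df1 (x : R) : 0 <= x <= h -> is_derive x 1 f1 (f2 x).
  move=> xh; have dVx := dV _ xh; have dfx := df _ xh.
  apply: is_derive_eq; rewrite /GRing.scale/= /f2 /f1 /g; ring.
have -> : expR (- ka * ln (1 + c * h) - al / (1 + c * h))
    - expR (- al) * (1 + (al * c - ka * c) * h) = f h - f 0 - f1 0 * h.
  have D0 : D 0 = 1 by rewrite /D mulr0 addr0.
  have f0 : f 0 = expR (- al) by rewrite /f D0 ln1 invr1 mulr0 add0r mulr1.
  have g0 : g 0 = al * c - ka * c by rewrite /g D0 invr1; ring.
  by rewrite /f1 f0 g0 /f /D; ring.
apply: (@taylor1_bound f f1 f2 _ h h0 df df1) => x xh.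
have Dx1 := D1 _ xh.
have Dx : 0 < D x by apply: lt_le_trans Dx1.
rewrite /f2 /g /f; set y := (D x)^-1.
have y0 : 0 <= y by rewrite invr_ge0 ltW.
have y1 : y <= 1 by rewrite invf_le1.
have z0 : 0 <= al * y by rewrite mulr_ge0.
set F := expR _.
have F0 : 0 <= F by exact: expR_ge0.
have FE : F <= expR (- (al * y)).
  by rewrite ler_expR gerDr mulNr oppr_le0 mulr_ge0// ln_ge0.
have E1 : F <= 1 by apply: (le_trans FE); rewrite -expR0 ler_expR oppr_le0.
have E2 : al * y * F <= 1.
  by apply: le_trans (expR_lin_bound z0); apply: ler_wpM2l.
have E3 : (al * y) ^+ 2 * F <= 4.
  by apply: le_trans (expR_sqr_bound z0); apply: ler_wpM2l; rewrite ?sqr_ge0.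
have -> : ((- ka * c * y + al * c * y ^+ 2) ^+ 2 + ka * c ^+ 2 * y ^+ 2 - 2 * al * c ^+ 2 * y ^+ 3) * F
  = c ^+ 2 * (y ^+ 2 * ((al * y - ka) ^+ 2 * F + ka * F - 2 * (al * y * F))) by ring.
rewrite normrM (ger0_norm (sqr_ge0 c)) mulrC ler_wpM2r ?sqr_ge0//.
rewrite normrM (ger0_norm (sqr_ge0 y)).
have y2 : y ^+ 2 <= 1 by rewrite expr_le1.
apply: (@le_trans _ _ (1 * `|(al * y - ka) ^+ 2 * F + ka * F - 2 * (al * y * F)|)).
  exact: ler_wpM2r.
rewrite mul1r.
have B0 : 0 <= (al * y - ka) ^+ 2 * F by rewrite mulr_ge0 ?sqr_ge0.
have B1 : (al * y - ka) ^+ 2 * F <= 2 * ((al * y) ^+ 2 * F) + 2 * (ka ^+ 2 * F).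
  rewrite -subr_ge0.
  have -> : 2 * ((al * y) ^+ 2 * F) + 2 * (ka ^+ 2 * F) - (al * y - ka) ^+ 2 * F
    = (al * y + ka) ^+ 2 * F by ring.
  by rewrite mulr_ge0 ?sqr_ge0.
have B2 : ka ^+ 2 * F <= ka ^+ 2 by rewrite -[leRHS]mulr1 ler_wpM2l ?sqr_ge0.
have B3 : ka * F <= ka by rewrite -[leRHS]mulr1 ler_wpM2l.
have B4 : 0 <= ka * F by rewrite mulr_ge0.
have B5 : 0 <= al * y * F by rewrite mulr_ge0.
have B6 : 0 <= ka ^+ 2 by exact: sqr_ge0.
rewrite ler_norml; apply/andP; split; lra.
Qed.

End Taylor.

Definition dotv (R : realType) (m : nat) (u v : 'cV[R]_m) : R := \sum_i u i 0 * v i 0.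

Section Dotv.
Variables (R : realType) (m : nat).
Implicit Types u v w : 'cV[R]_m.

Lemma dotvC u v : dotv u v = dotv v u.
Proof. by apply: eq_bigr => i _; rewrite mulrC. Qed.

Lemma dotvDl u v w : dotv (u + v) w = dotv u w + dotv v w.
Proof. by rewrite -big_split/=; apply: eq_bigr => i _; rewrite mxE mulrDl. Qed.

Lemma dotvZl c u w : dotv (c *: u) w = c * dotv u w.
Proof. by rewrite mulr_sumr; apply: eq_bigr => i _; rewrite mxE mulrA. Qed.

Lemma dotvDr u v w : dotv w (u + v) = dotv w u + dotv w v.
Proof. by rewrite dotvC dotvDl !(dotvC w). Qed.

Lemma dotvZr c u w : dotv w (c *: u) = c * dotv w u.
Proof. by rewrite dotvC dotvZl dotvC. Qed.

Lemma dotv_ge0 u : 0 <= dotv u u.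
Proof. by apply: sumr_ge0 => i _; rewrite -expr2 sqr_ge0. Qed.

Lemma dotv_eq0 u : (dotv u u == 0) = (u == 0).
Proof.
apply/idP/eqP => [|->]; last by rewrite /dotv big1// => i _; rewrite mxE mul0r.
rewrite psumr_eq0 => [/allP u0|i _]; last by rewrite -expr2 sqr_ge0.
apply/matrixP => i j; rewrite ord1 mxE; apply/eqP.
by have := u0 i (mem_index_enum i); rewrite /= -expr2 sqrf_eq0.
Qed.

Lemma dotv_lineE u v b :
  dotv (u + b *: v) (u + b *: v) = dotv u u + 2 * dotv u v * b + dotv v v * b ^+ 2.
Proof. by rewrite dotvDl !dotvDr !dotvZl !dotvZr (dotvC v u); ring. Qed.

(** Lagrange's identity: the sum of the squared 2 by 2 minors is twice the gap. *)
Lemma dotv_cauchy_schwarz u v : dotv u v ^+ 2 <= dotv u u * dotv v v.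
Proof.
have : 0 <= \sum_i \sum_j (u i 0 * v j 0 - u j 0 * v i 0) ^+ 2.
  by apply: sumr_ge0 => i _; apply: sumr_ge0 => j _; exact: sqr_ge0.
have -> : \sum_i \sum_j (u i 0 * v j 0 - u j 0 * v i 0) ^+ 2 =
    \sum_i \sum_j ((u i 0 * u i 0) * (v j 0 * v j 0))
  + \sum_i \sum_j ((v i 0 * v i 0) * (u j 0 * u j 0))
  - 2 * \sum_i \sum_j ((u i 0 * v i 0) * (u j 0 * v j 0)).
  rewrite mulr_sumr -!(big_split, sumrB)/=; apply: eq_bigr => i _.
  by rewrite mulr_sumr -!(big_split, sumrB)/=; apply: eq_bigr => j _; ring.
have dotM (x y z t : 'cV[R]_m) : \sum_i \sum_j ((x i 0 * y i 0) * (z j 0 * t j 0)) = dotv x y * dotv z t.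
  by rewrite /dotv mulr_suml; apply: eq_bigr => i _; rewrite mulr_sumr.
by rewrite !dotM; lra.
Qed.

End Dotv.

Section HeatKernel.
Variables (R : realType) (A : finType) (mu : A -> R) (m k : nat).
Variables (xi : A -> 'cV[R]_m) (Pj : 'M[R]_m) (B : R).
Hypothesis mu_ge0 : forall a, 0 <= mu a.
Hypothesis mu_sum1 : \sum_a mu a = 1.
Hypothesis xi_mean : forall i, \sum_a mu a * xi a i 0 = 0.
Hypothesis xi_proj : forall a, Pj *m xi a = xi a.
Hypothesis xi_cov : forall v, Pj *m v = v -> \sum_a mu a * dotv v (xi a) ^+ 2 = dotv v v.
Hypothesis xi_trace : \sum_a mu a * dotv (xi a) (xi a) = k%:R.
Hypothesis xi_bound : forall a, dotv (xi a) (xi a) <= B.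

(* Solves the heat equation d/ds u = 1/2 Laplacian u on a k-dimensional space,
   with initial value exp(-t|v|^2). *)
Definition heatker (t s : R) (v : 'cV[R]_m) : R :=
  expR (- (k%:R / 2) * ln (1 + 2 * t * s) - t * dotv v v / (1 + 2 * t * s)).

(** The sum of two remainder constants: the space expansion with Ga = t B, and the time expansion
    with ka = k/2 and c <= 2 t. *)
Definition heat_const (t : R) : R :=
  5 * (t * B) + 44 * (t * B) ^+ 2 + (2 * (k%:R / 2) ^+ 2 + k%:R / 2 + 10) * (2 * t) ^+ 2.

Lemma xi_mean_dotv v : \sum_a mu a * dotv v (xi a) = 0.
Proof.
transitivity (\sum_i v i 0 * \sum_a mu a * xi a i 0).
  under eq_bigr do rewrite /dotv mulr_sumr.
  rewrite exchange_big/=; apply: eq_bigr => i _; rewrite mulr_sumr.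
  by apply: eq_bigr => a _; rewrite mulrCA.
by apply: big1 => i _; rewrite xi_mean mulr0.
Qed.

Lemma ler_norm_mean (e : A -> R) (C : R) : (forall a, `|e a| <= C) ->
  `|\sum_a mu a * e a| <= C.
Proof.
move=> eC; apply: (le_trans (ler_norm_sum _ _ _)).
apply: (@le_trans _ _ (\sum_a mu a * C)); last by rewrite -mulr_suml mu_sum1 mul1r.
by apply: ler_sum => a _; rewrite normrM (ger0_norm (mu_ge0 a)) ler_wpM2l.
Qed.

(** A discrete heat equation: averaging over one step b xi agrees with advancing time by b^2 up to
    order b^3. The mean of xi kills the linear term; its covariance and its trace produce the two
    terms of the time derivative. The covariance is the identity only on the range of [Pj], so v
    must lie there. *)
Lemma heat_step t s b v : 0 <= t -> 0 <= s -> 0 <= b <= 1 -> Pj *m v = v ->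
  `|\sum_a mu a * heatker t s (v + b *: xi a) - heatker t (s + b ^+ 2) v|
    <= heat_const t * b ^+ 3.
Proof.
move=> t0 s0 /andP[b0 b1] Pv.
have d1 : 1 <= 1 + 2 * t * s by rewrite lerDl !mulr_ge0.
have d0 : 0 < 1 + 2 * t * s by apply: lt_le_trans d1.
pose a0 := t / (1 + 2 * t * s).
have a00 : 0 <= a0 by rewrite divr_ge0// ltW.
have a0t : a0 <= t by rewrite ler_pdivrMr// ler_peMr.
pose E0 := expR (- (k%:R / 2) * ln (1 + 2 * t * s)).
have E00 : 0 <= E0 by exact: expR_ge0.
have E01 : E0 <= 1.
  by rewrite -expR0 ler_expR mulNr oppr_le0 mulr_ge0 ?divr_ge0 ?ln_ge0.
pose al := a0 * dotv v v.
pose be a := 2 * a0 * dotv v (xi a).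
pose ga a := a0 * dotv (xi a) (xi a).
have al0 : 0 <= al by rewrite mulr_ge0 ?dotv_ge0.
have ga0 a : 0 <= ga a by rewrite mulr_ge0 ?dotv_ge0.
have gaB a : ga a <= t * B by rewrite ler_pM ?dotv_ge0.
pose e1 a := expR (- (al + be a * b + ga a * b ^+ 2)).
pose e2 a := expR (- al) * (1 - be a * b + (be a ^+ 2 / 2 - ga a) * b ^+ 2).
have He a : `|e1 a - e2 a| <= (5 * (t * B) + 44 * (t * B) ^+ 2) * b ^+ 3.
  apply: taylor_gaussian_line; rewrite ?ga0 ?gaB//.
  have -> : be a ^+ 2 = 4 * a0 ^+ 2 * dotv v (xi a) ^+ 2 by rewrite /be; ring.
  have -> : 4 * al * ga a = 4 * a0 ^+ 2 * (dotv v v * dotv (xi a) (xi a)) by rewrite /al /ga; ring.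
  by rewrite ler_wpM2l ?dotv_cauchy_schwarz// mulr_ge0 ?sqr_ge0.
pose c := 2 * a0.
have c0 : 0 <= c by rewrite mulr_ge0.
have ct : c <= 2 * t by rewrite ler_pM2l.
pose e3 := expR (- (k%:R / 2) * ln (1 + c * b ^+ 2) - al / (1 + c * b ^+ 2)).
pose e4 := expR (- al) * (1 + (al * c - k%:R / 2 * c) * b ^+ 2).
have H34 : `|e3 - e4| <= (2 * (k%:R / 2) ^+ 2 + k%:R / 2 + 10) * c ^+ 2 * (b ^+ 2) ^+ 2.
  by apply: taylor_heat_time; rewrite ?divr_ge0 ?sqr_ge0.
have E24 : \sum_a mu a * e2 a = e4.
  transitivity (expR (- al) * (\sum_a mu a - 2 * a0 * b * (\sum_a mu a * dotv v (xi a))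
     + 2 * a0 ^+ 2 * b ^+ 2 * (\sum_a mu a * dotv v (xi a) ^+ 2)
     - a0 * b ^+ 2 * (\sum_a mu a * dotv (xi a) (xi a)))).
    rewrite !mulr_sumr -!(sumrB, big_split)/= mulr_sumr.
    by apply: eq_bigr => a _; rewrite /e2 /be /ga; field.
  by rewrite mu_sum1 xi_mean_dotv xi_cov// xi_trace /e4 /al /c; field.
have E1 a : heatker t s (v + b *: xi a) = E0 * e1 a.
  rewrite /heatker expRD; congr (_ * expR _).
  by rewrite dotv_lineE /al /be /ga /a0; field; rewrite gt_eqF.
have E3 : heatker t (s + b ^+ 2) v = E0 * e3.
  (* The semigroup property: the kernel at time s + b^2 is the kernel at time b^2 started from the
     Gaussian with parameter a0 instead of t. *)
  have dE : 1 + 2 * t * (s + b ^+ 2) = (1 + 2 * t * s) * (1 + c * b ^+ 2).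
    by rewrite /c /a0; field; rewrite gt_eqF.
  have d' : 0 < 1 + c * b ^+ 2 by rewrite ltr_wpDr// mulr_ge0// sqr_ge0.
  rewrite /heatker dE lnM ?posrE// /E0 /e3 -expRD; congr expR.
  by rewrite /al /a0; field; rewrite !gt_eqF.
rewrite E3 (eq_bigr _ (fun a _ => congr1 _ (E1 a))).
have -> : \sum_a mu a * (E0 * e1 a) - E0 * e3 =
   E0 * (\sum_a mu a * (e1 a - e2 a) - (e3 - e4)).
  have -> : \sum_a mu a * (E0 * e1 a) = E0 * \sum_a mu a * e1 a.
    by rewrite mulr_sumr; apply: eq_bigr => a _; rewrite mulrCA.
  have -> : \sum_a mu a * (e1 a - e2 a) = \sum_a mu a * e1 a - \sum_a mu a * e2 a.
    by rewrite -sumrB; apply: eq_bigr => a _; rewrite mulrBr.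
  by rewrite E24; ring.
rewrite normrM (ger0_norm E00).
apply: (le_trans (ler_wpM2r (normr_ge0 _) E01)); rewrite mul1r.
apply: (le_trans (ler_normB _ _)); rewrite /heat_const mulrDl; apply: lerD.
  exact: ler_norm_mean.
apply: (le_trans H34); rewrite -[leLHS]mulrA -[leRHS]mulrA ler_wpM2l//.
apply: ler_pM; rewrite ?sqr_ge0//; first by rewrite ler_sqr ?nnegrE// mulr_ge0.
by rewrite -exprM ler_wiXn2l.
Qed.

(** The free starting point v lets the induction absorb the first draw into v; it stays in the range
    of [Pj] because each xi lies there. *)
Lemma heat_telescope t N b v : 0 <= t -> 0 <= b <= 1 -> Pj *m v = v ->
  `|iidE mu N (fun s => expR (- t * dotv (v + b *: \sum_(x <- s) xi x) (v + b *: \sum_(x <- s) xi x)))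
    - heatker t (N%:R * b ^+ 2) v| <= N%:R * heat_const t * b ^+ 3.
Proof.
move=> t0 b01; elim: N v => [|N IH] v Pv /=.
  rewrite big_nil scaler0 addr0 /heatker !mul0r mulr0 addr0 ln1 mulr0 add0r divr1.
  by rewrite mulNr subrr normr0.
pose F v (s : seq A) := expR (- t * dotv (v + b *: \sum_(x <- s) xi x) (v + b *: \sum_(x <- s) xi x)).
have FE a : iidE mu N (fun s => F v (a :: s)) = iidE mu N (F (v + b *: xi a)).
  by apply: eq_iidE => s _; rewrite /F big_cons scalerDr addrA.
rewrite (eq_bigr _ (fun a _ => congr1 _ (FE a))).
have bE : N.+1%:R * b ^+ 2 = N%:R * b ^+ 2 + b ^+ 2 by rewrite -natr1 mulrDl mul1r.
set X := \sum_a _; pose Y := \sum_a mu a * heatker t (N%:R * b ^+ 2) (v + b *: xi a).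
have -> : X - heatker t (N.+1%:R * b ^+ 2) v = (X - Y) + (Y - heatker t (N.+1%:R * b ^+ 2) v).
  by rewrite addrA subrK.
have -> : N.+1%:R * heat_const t * b ^+ 3 = N%:R * heat_const t * b ^+ 3 + heat_const t * b ^+ 3.
  by rewrite -natr1; ring.
apply: (le_trans (ler_normD _ _)); apply: lerD; last first.
  by rewrite bE; apply: heat_step; rewrite // mulr_ge0 ?sqr_ge0.
have -> : X - Y = \sum_a mu a * (iidE mu N (F (v + b *: xi a)) - heatker t (N%:R * b ^+ 2) (v + b *: xi a)).
  by rewrite -sumrB; apply: eq_bigr => a _; rewrite mulrBr.
apply: ler_norm_mean => a; apply: IH.
by rewrite mulmxDr Pv -scalemxAr xi_proj.
Qed.

(** Start at v = 0 with b = N^(-1/2): the elapsed time is N b^2 = 1, and the accumulated error N b^3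
    is b up to a constant. *)
Lemma iid_laplace_cvg t : 0 <= t ->
  (fun N => iidE mu N (fun s => expR (- t * (dotv (\sum_(x <- s) xi x) (\sum_(x <- s) xi x) / N%:R))))
   @ \oo --> expR (- (k%:R / 2) * ln (1 + 2 * t)).
Proof.
move=> t0; rewrite -(cvg_shiftS _).
apply/cvgrPdist_le => e e0.
(* With b = 1, [heat_step] bounds an absolute value by [heat_const t]. *)
have c0 : 0 <= heat_const t.
  have b01 : 0 <= 1 :> R /\ 1 <= 1 :> R by [].
  have := heat_step t0 (lexx 0) (introT andP b01) (mulmx0 _ Pj).
  by rewrite !expr1n mulr1; apply: le_trans.
near=> N.
suff : `|expR (- (k%:R / 2) * ln (1 + 2 * t)) - iidE mu N.+1 (fun s =>
  expR (- t * (dotv (\sum_(x <- s) xi x) (\sum_(x <- s) xi x) / N.+1%:R)))| <= e by [].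
pose b : R := Num.sqrt (N.+1%:R^-1).
have b2 : b ^+ 2 = N.+1%:R^-1 by rewrite sqr_sqrtr// invr_ge0.
have b01 : 0 <= b <= 1.
  rewrite sqrtr_ge0/= -[leRHS]sqrtr1 ler_wsqrtr// invf_le1// ?ler1n//.
have := @heat_telescope t N.+1 b 0 t0 b01 (mulmx0 _ Pj).
rewrite distrC /heatker b2 divff ?pnatr_eq0// mulr1.
have -> : dotv (0 : 'cV[R]_m) 0 = 0 by apply/eqP; rewrite dotv_eq0.
rewrite mulr0 mul0r subr0 => H.
have -> : iidE mu N.+1 (fun s => expR (- t * (dotv (\sum_(x <- s) xi x) (\sum_(x <- s) xi x) / N.+1%:R)))
  = iidE mu N.+1 (fun s => expR (- t * dotv (0 + b *: \sum_(x <- s) xi x) (0 + b *: \sum_(x <- s) xi x))).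
  apply: eq_iidE => s _; congr (expR (_ * _)).
  by rewrite add0r dotvZl dotvZr mulrA -expr2 b2 mulrC.
apply: (le_trans H).
have -> : N.+1%:R * heat_const t * b ^+ 3 = heat_const t * b.
  have n0 : N.+1%:R != 0 :> R by rewrite pnatr_eq0.
  by rewrite exprS b2; move: n0; move: (N.+1%:R : R) => y y0; field.
have HN : ((heat_const t + 1) / e) ^+ 2 <= N%:R by near: N; exact: nbhs_infty_ger.
have HN1 : (heat_const t + 1) / e * b <= 1.
  have p0 : 0 <= (heat_const t + 1) / e by apply: divr_ge0; [exact: addr_ge0|exact: ltW].
  case/andP: b01 => b0 _; have pb0 := mulr_ge0 p0 b0.
  rewrite -ler_sqr ?nnegrE// exprMn b2 expr1n ler_pdivrMr// mul1r.
  by apply: (le_trans HN); rewrite ler_nat.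
move: HN1; rewrite mulrAC ler_pdivrMr// mul1r mulrDl mul1r; apply: le_trans.
by rewrite lerDl; case/andP: b01.
Unshelve. all: by end_near.
Qed.

End HeatKernel.

(** * The chi-square law *)

Section LebesgueScaling.
Variable R : realType.
Notation mu := (@lebesgue_measure R).

(** By uniqueness of Lebesgue measure: c times the image measure gives half-open intervals their
    length. *)
Lemma lebesgue_measure_preimage_scale (c : R) (A : set R) : 0 < c -> measurable A ->
  mu ((fun x => c * x) @^-1` A) = (c^-1%:E * mu A)%E.
Proof.
move=> c0 mA.
pose phi x : R := c * x.
have mphi : measurable_fun setT (phi : measurableTypeR R -> measurableTypeR R).
  exact: mulrl_measurable.
pose m : {measure set (measurableTypeR R) -> \bar R} := mscale (NngNum (ltW c0))
  (measure_function_pushforward__canonical__measure_function_Measure mu mphi).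
have -> : mu A = m A.
  apply: lebesgue_measure_unique mA => X [[a b] /= ab <-].
  rewrite lebesgue_measure_itv/= /m /mscale/= /pushforward.
  have -> : phi @^-1` `]a, b] = `](c^-1 * a), (c^-1 * b)]%classic.
    by apply/seteqP; split => x; rewrite /= !in_itv/= ler_pdivlMl// ltr_pdivrMl.
  rewrite lebesgue_measure_itv/= !lte_fin ltr_pM2l ?invr_gt0//.
  case: ifP => _; last by rewrite mule0.
  by rewrite -!EFinB -EFinM -mulrBr mulrA mulfV ?mul1r// gt_eqF.
by rewrite /m /mscale /pushforward/= muleA -EFinM mulVf ?mul1e// gt_eqF.
Qed.

Lemma ge0_integral_scale (c : R) (f : R -> R) : 0 < c -> measurable_fun setT f ->
  (forall x, 0 <= f x) ->
  (\int[mu]_(x in `[0%R, +oo[) (f (c * x))%:E = c^-1%:E * \int[mu]_(x in `[0%R, +oo[) (f x)%:E)%E.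
Proof.
move=> c0 mf f0.
have mc : measurable_fun setT ((fun x : R => c * x) : measurableTypeR R -> measurableTypeR R).
  exact: mulrl_measurable.
have ci : 0 <= c^-1 by rewrite invr_ge0 ltW.
pose nu : {measure set (measurableTypeR R) -> \bar R} :=
  measure_function_pushforward__canonical__measure_function_Measure mu mc.
have mE : measurable_fun (`[0%R, +oo[%classic : set R) (EFin \o f) by apply/measurable_EFinP; exact: measurable_funTS.
transitivity (\int[nu]_(y in `[0%R, +oo[) (f y)%:E)%E.
  rewrite (ge0_integral_pushforward mc)//=; last by move=> y _; rewrite lee_fin.
  congr (integral _ _ _); apply/seteqP; split => x; rewrite /= !in_itv/= !andbT.
    by move=> x0; rewrite mulr_ge0// ltW.
  by rewrite pmulr_rge0.
rewrite (eq_measure_integral (mscale (NngNum ci) mu)).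
  by rewrite ge0_integral_mscale//= => x _; rewrite lee_fin.
by move=> A mA _; rewrite /mscale/pushforward/=; exact: lebesgue_measure_preimage_scale.
Qed.

End LebesgueScaling.

Section Chi2.
Variables (R : realType) (k : nat).
Hypothesis k_gt0 : (0 < k)%N.
Notation mu := (@lebesgue_measure R).
Notation K := (@chi2_kernel R k).

Lemma chi2_kernel_ge0 t : 0 <= K t.
Proof. by rewrite mulr_ge0 ?powR_ge0 ?expR_ge0. Qed.

Lemma measurable_chi2_kernel : measurable_fun setT K.
Proof.
apply: measurable_funM; first exact: measurable_powR.
apply: measurableT_comp => //; apply: measurableT_comp => //.
exact: mulrr_measurable.
Qed.

(* Its derivative majorises the kernel up to a constant, including the
   singularity at 0 when k = 1. *)
Let dom (s : R) := 2 - 2 / (1 + Num.sqrt s).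

(** With s = sqrt t, the kernel times s (1 + s)^2 is at most (1 + s)^(k+1) exp(-s^2/2). Then 1 + s
    <= (k + 1) exp(s/(k+1)) and s - s^2/2 <= 1/2. *)
Lemma chi2_kernel_dominated (t : R) : 0 < t ->
  K t <= (k.+1%:R ^+ k.+1 * expR (1 / 2)) * (Num.sqrt t * (1 + Num.sqrt t) ^+ 2)^-1.
Proof.
move=> t0; set s := Num.sqrt t.
have s0 : 0 < s by rewrite sqrtr_gt0.
have ts : t = s ^+ 2 by rewrite sqr_sqrtr// ltW.
rewrite ler_pdivlMr ?mulr_gt0 ?exprn_gt0 ?addr_gt0//.
have Ks : powR t (k%:R / 2 - 1) * s = s ^+ k.-1.
  have sE : s = t `^ 2^-1 by rewrite powR12_sqrt// ltW.
  rewrite sE -powRD ?(gt_eqF t0) ?implybT// -powR_mulrn ?powR_ge0// -powRrM.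
  congr (_ `^ _).
  by rewrite -{1}(prednK k_gt0) -natr1; field.
have -> : K t * (s * (1 + s) ^+ 2) = s ^+ k.-1 * (1 + s) ^+ 2 * expR (- (t / 2)).
  by rewrite -Ks /chi2_kernel; ring.
have B1 : s ^+ k.-1 * (1 + s) ^+ 2 <= (1 + s) ^+ k.+1.
  have -> : (1 + s) ^+ k.+1 = (1 + s) ^+ k.-1 * (1 + s) ^+ 2.
    by rewrite -exprD addn2 prednK.
  rewrite ler_pM2r ?exprn_gt0 ?addr_gt0// lerXn2r ?nnegrE ?addr_ge0 ?(ltW s0)//.
  by rewrite lerDr.
have B2 : (1 + s) ^+ k.+1 <= k.+1%:R ^+ k.+1 * expR s.
  have -> : expR s = expR (s / k.+1%:R) ^+ k.+1.
    by rewrite -expRM_natl; congr expR; rewrite mulrC divfK// pnatr_eq0.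
  rewrite -exprMn lerXn2r ?nnegrE ?addr_ge0 ?mulr_ge0 ?expR_ge0 ?(ltW s0)//.
  apply: (@le_trans _ _ (k.+1%:R * (1 + s / k.+1%:R))); last by rewrite ler_pM2l ?ltr0n// expR_ge1Dx.
  by rewrite mulrDr mulr1 mulrCA divff ?pnatr_eq0// mulr1 lerD2r ler1n.
apply: (le_trans (ler_wpM2r (expR_ge0 _) (le_trans B1 B2))).
rewrite -mulrA -expRD ler_wpM2l ?exprn_ge0// ler_expR ts.
by have := sqr_ge0 (s - 1); nra.
Qed.

Let dom_derive (x : R) : 0 < x -> is_derive x 1 dom ((Num.sqrt x * (1 + Num.sqrt x) ^+ 2)^-1).
Proof.
move=> x0; have s0 : 0 < Num.sqrt x by rewrite sqrtr_gt0.
have d1 := is_derive1_sqrt x0.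
have n0 : 1 + Num.sqrt x != 0 by rewrite gt_eqF// addr_gt0.
have d2 : is_derive x 1 (fun y => (1 + Num.sqrt y)^-1) (- (1 + Num.sqrt x) ^- 2 *: (2 * Num.sqrt x)^-1).
  apply: is_deriveV => //; by apply: is_derive_eq; rewrite add0r /GRing.scale/= mul1r.
pose V (y : R) := (1 + Num.sqrt y)^-1.
have dV : is_derive x 1 V (- (1 + Num.sqrt x) ^- 2 *: (2 * Num.sqrt x)^-1) by exact: d2.
have dB := is_deriveB (is_derive_cst (2 : R) x 1) (is_deriveZ 2 dV).
rewrite (_ : dom = cst 2 - 2 *: V)//.
apply: is_derive_eq dB _; rewrite /GRing.scale/=; field.
by rewrite n0 gt_eqF.
Qed.

Lemma chi2_kernel_integral_lty : (\int[mu]_(t in `[0%R, +oo[) (K t)%:E < +oo)%E.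
Proof.
pose C : R := k.+1%:R ^+ k.+1 * expR (1 / 2).
have C0 : 0 <= C by rewrite mulr_ge0 ?expR_ge0// exprn_ge0.
pose g (x : R) := (Num.sqrt x * (1 + Num.sqrt x) ^+ 2)^-1.
have mK : measurable_fun setT (EFin \o K) by apply/measurable_EFinP; exact: measurable_chi2_kernel.
rewrite -integral_itv_obnd_cbnd//; last exact: measurable_funTS.
(* Rays [1/(n+1), +oo[ exhaust the open half-line and avoid the singularity at 0, so that the
   fundamental theorem of calculus applies on each of them. *)
rewrite itvoyEbigcup.
have H := @ge0_nondecreasing_set_cvg_integral _ _ R
   (fun k : nat => `[0 + k.+1%:R^-1, +oo[%classic : set (measurableTypeR R)) (fun t => (K t)%:E) mu.
have nd : nondecreasing_seq (fun k : nat => `[0 + k.+1%:R^-1, +oo[%classic : set (measurableTypeR R)).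
  move=> m n mn; rewrite subsetEset => x /=; rewrite !in_itv/= !andbT !add0r; apply: le_trans.
  by rewrite lef_pV2 ?posrE// ler_nat.
have {}H := H nd _ (fun n => measurable_funTS mK) (fun n x _ => chi2_kernel_ge0 x).
apply: (@le_lt_trans _ _ (C * 2)%:E); last exact: ltry.
have {}H := H (fun n => measurable_itv _).
rewrite -(cvg_lim _ H)//.
apply: lime_le; first by apply/cvg_ex; eexists; exact: H.
apply: nearW => n; set a := 0 + n.+1%:R^-1.
have a0 : 0 < a by rewrite /a add0r.
have gc (x : R) : 0 < x -> {for x, continuous g}.
  move=> x0; have s0 : 0 < Num.sqrt x by rewrite sqrtr_gt0.
  have cs : Num.sqrt y @[y --> x] --> Num.sqrt x by exact: sqrt_continuous.
  have c1 : 1 + Num.sqrt y @[y --> x] --> 1 + Num.sqrt x by apply: cvgD => //; exact: cvg_cst.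
  apply: cvgV; first by rewrite mulf_neq0 ?expf_neq0// gt_eqF// addr_gt0.
  by apply: cvgM => //; apply: cvgM.
have cg : {within `[a, +oo[, continuous g}.
  apply: continuous_in_subspaceT => x; rewrite inE/= in_itv/= andbT => ax; apply: gc.
  exact: lt_le_trans ax.
(* The primitive [dom] tends to 2 at infinity and is nonnegative, so these integrals are at most 2,
   uniformly in a. *)
have gE : (\int[mu]_(x in `[a, +oo[) (g x)%:E = 2%:E - (dom a)%:E)%E.
  apply: ge0_continuous_FTC2y.
  - by move=> x ax; rewrite invr_ge0 mulr_ge0 ?sqrtr_ge0 ?sqr_ge0.
  - exact: cg.
  - apply/cvgrPdist_le => e e0; near=> x.
    have x0 : 0 < x by near: x; exact: nbhs_pinfty_gt.
    have xe : (2 / e) ^+ 2 <= x by near: x; apply: nbhs_pinfty_ge; exact: num_real.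
    have s0 : 0 < Num.sqrt x by rewrite sqrtr_gt0.
    have se : 2 / e <= Num.sqrt x.
      by rewrite -(ler_sqr (x := 2 / e)) ?nnegrE ?divr_ge0 ?(ltW e0) ?(ltW s0)// sqr_sqrtr// ltW.
    have d0 : 0 < 1 + Num.sqrt x by rewrite addr_gt0.
    rewrite /dom opprB addrCA subrr addr0 ger0_norm ?divr_ge0 ?(ltW d0)//.
    rewrite ler_pdivrMr//; move: se; rewrite ler_pdivrMr// mulrC => /le_trans; apply.
    by rewrite ler_pM2l// lerDr.
  - by move=> x ax; have := dom_derive (lt_trans a0 ax) => ?; exact: ex_derive.
  - apply: cvg_at_right_filter; have := dom_derive a0 => ?.
    by apply/differentiable_continuous/derivable1_diffP; exact: ex_derive.
  - move=> x; rewrite in_itv/= andbT => ax; rewrite derive1E.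
    by have := dom_derive (lt_trans a0 ax) => ?; rewrite derive_val.
have mg : measurable_fun `[a, +oo[ g.
  by apply: subspace_continuous_measurable_fun.
have mgE : measurable_fun `[a, +oo[ (fun x => (g x)%:E) by exact/measurable_EFinP.
have g0 x : 0 <= g x by rewrite invr_ge0 mulr_ge0 ?sqrtr_ge0 ?sqr_ge0.
apply: (@le_trans _ _ (\int[mu]_(x in `[a, +oo[) (C%:E * (g x)%:E))%E).
  apply: ge0_le_integral => //.
  - by move=> x _; rewrite lee_fin chi2_kernel_ge0.
  - exact: measurable_funTS.
  - by apply/measurable_EFinP; apply: measurable_funM.
  - move=> x; rewrite /= in_itv/= andbT => ax; rewrite -EFinM lee_fin.
    by apply: chi2_kernel_dominated; apply: lt_le_trans ax.
rewrite ge0_integralZl_EFin//; last by move=> x _; rewrite lee_fin.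
rewrite gE -EFinB -EFinM lee_fin ler_wpM2l// lerBlDr lerDl /dom subr_ge0.
rewrite ler_pdivrMr ?addr_gt0 ?sqrtr_gt0//.
by rewrite mulrDr mulr1 lerDl mulr_ge0 ?sqrtr_ge0.
Unshelve. all: by end_near.
Qed.

End Chi2.

Section Chi2Laplace.
Variables (R : realType) (k : nat).
Hypothesis k_gt0 : (0 < k)%N.
Notation mu := (@lebesgue_measure R).
Notation K := (@chi2_kernel R k).
Let D : set (measurableTypeR R) := `[0%R, +oo[%classic.
Let Z : R := \int[mu]_(t in D) K t.

Let mD : measurable D. Proof. exact: measurable_itv. Qed.

Let D_ge0 t : D t -> 0 <= t. Proof. by rewrite /D/= in_itv/= andbT. Qed.

Let intK : mu.-integrable D (EFin \o K).
Proof.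
apply/integrableP; split.
  by apply/measurable_EFinP; apply: measurable_funTS; exact: measurable_chi2_kernel.
apply: le_lt_trans (chi2_kernel_integral_lty R k_gt0).
rewrite le_eqVlt; apply/orP; left; apply/eqP.
by apply: eq_integral => t _ /=; rewrite ger0_norm// chi2_kernel_ge0.
Qed.

Lemma chi2_integrable_bounded (g : R -> R) (b : R) : measurable_fun D g ->
  (forall t, D t -> `|g t| <= b) -> mu.-integrable D (EFin \o (fun t => g t * K t)).
Proof.
move=> mg gb; apply: (@le_integrable _ _ _ mu D mD _ (fun t => b%:E * (K t)%:E)%E).
- apply/measurable_EFinP; apply: measurable_funM => //.
  by apply: measurable_funTS; exact: measurable_chi2_kernel.
- move=> t Dt; rewrite /= !normrM lee_fin ler_wpM2r//.
  by apply: (le_trans (gb _ Dt)); exact: ler_norm.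
- exact: integrableZl.
Qed.

(** On [1, 2] the exponent k/2 - 1 is at least -1, so the power is at least 1/t >= 1/2, and the
    exponential is at least exp(-1). *)
Lemma chi2_mass_gt0 : 0 < Z.
Proof.
pose c : R := expR (-1) / 2.
have c0 : 0 < c by rewrite divr_gt0// expR_gt0.
suff : c <= Z by apply: lt_le_trans.
pose E : set (measurableTypeR R) := `[1%R, 2%R]%classic.
have mE : measurable E by exact: measurable_itv.
have ED : E `<=` D by move=> t; rewrite /E /D/= !in_itv/= andbT => /andP[+ _]; exact: le_trans.
have KE t : E t -> c <= K t.
  rewrite /E/= in_itv/= => /andP[t1 t2]; have t0 : 0 < t by exact: lt_le_trans t1.
  rewrite /c mulrC; apply: ler_pM; rewrite ?expR_ge0 ?invr_ge0//; last by rewrite ler_expR; lra.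
  apply: (@le_trans _ _ (t `^ (-1))).
    by rewrite powR_inv1 ?(ltW t0)// lef_pV2 ?posrE.
  by apply: ler_powR => //; rewrite lerDr divr_ge0.
have intE : mu.-integrable E (EFin \o K) by exact: integrableS intK.
have -> : c = \int[mu]_(t in E) (cst c t).
  rewrite Rintegral_cst// /E [X in fine X]lebesgue_measure_itv/= lte_fin ltr1n/=.
  by ring.
apply: (@le_trans _ _ (\int[mu]_(t in E) K t)).
  apply: le_Rintegral => //.
  apply: (@le_integrable _ _ _ mu E mE _ (EFin \o K)) => //.
    by apply/measurable_EFinP; exact: measurable_cst.
  by move=> t Et; rewrite /= !ger0_norm ?lee_fin ?KE ?chi2_kernel_ge0 ?(ltW c0).
rewrite /Z /Rintegral.
apply: fine_le; [exact: integrable_fin_num intE|exact: integrable_fin_num intK|].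
apply: ge0_subset_integral => //; first by case/integrableP: intK.
by move=> t _; rewrite lee_fin chi2_kernel_ge0.
Qed.

Let chi2_integrable_expX j : mu.-integrable D (EFin \o (fun t => expR (- t) ^+ j * K t)).
Proof.
apply: (@chi2_integrable_bounded _ 1).
  by apply: measurable_funTS; apply: measurable_funX; apply: measurableT_comp.
move=> t /D_ge0 t0; rewrite ger0_norm ?exprn_ge0 ?expR_ge0// exprn_ile1 ?expR_ge0//.
by rewrite -expR0 ler_expR oppr_le0.
Qed.

(* The scaling t -> (1 + 2 j) t maps one integrand to the other, so no value of
   the Gamma function is needed. *)
Lemma chi2_laplace (j : nat) :
  \int[mu]_(t in D) (expR (- t) ^+ j * K t) = expR (- (k%:R / 2) * ln (1 + 2 * j%:R)) * Z.
Proof.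
pose c : R := 1 + 2 * j%:R.
have c0 : 0 < c by rewrite /c ltr_wpDr ?mulr_ge0.
have H := ge0_integral_scale c0 (measurable_chi2_kernel k) (@chi2_kernel_ge0 R k).
pose a := c `^ (k%:R / 2 - 1).
have a0 : 0 < a by rewrite powR_gt0.
have {}H : \int[mu]_(t in D) K (c * t) = c^-1 * Z.
  by rewrite /Z /Rintegral H fineM// (integrable_fin_num mD intK).
have : \int[mu]_(t in D) K (c * t) = a * \int[mu]_(t in D) (expR (- t) ^+ j * K t).
  rewrite -RintegralZl//; apply: eq_Rintegral => t; rewrite inE => Dt; have t0 := D_ge0 Dt.
  have E : expR (- (c * t / 2)) = expR (- t) ^+ j * expR (- (t / 2)).
    by rewrite -expRM_natl -expRD; congr expR; rewrite /c; field.
  by rewrite /chi2_kernel powRM ?(ltW c0)// E /a; ring.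
rewrite H => /(congr1 (fun y => a^-1 * y)); rewrite mulKf ?gt_eqF// => <-.
rewrite mulrA; congr (_ * _).
rewrite /a -powRN -(powR_inv1 (ltW c0)) -powRD ?(gt_eqF c0) ?implybT// /powR (gt_eqF c0).
by congr expR; ring.
Qed.

(** The chi-square expectation of p(exp(-X)), written with the transforms at integers so that it is
    visibly the limit of the sample expectations; [chi2_meanE] links it to the integral. *)
Definition chi2_mean (p : {poly R}) : R :=
  \sum_(i < size p) p`_i * expR (- (k%:R / 2) * ln (1 + 2 * i%:R)).

Lemma chi2_integrable_poly (p : {poly R}) :
  mu.-integrable D (EFin \o (fun t => p.[expR (- t)] * K t)).
Proof.
under eq_fun do rewrite horner_coef mulr_suml.
rewrite (_ : _ \o _ = fun t => (\sum_(i < size p) (p`_i * expR (- t) ^+ i * K t)%:E)%E); last first.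
  by apply/funext => t /=; rewrite sumEFin.
apply: integrable_sum => // i _.
under eq_fun do rewrite -mulrA EFinM.
exact: (integrableZl mD _ (chi2_integrable_expX i)).
Qed.

Lemma chi2_meanE (p : {poly R}) :
  \int[mu]_(t in D) (p.[expR (- t)] * K t) = chi2_mean p * Z.
Proof.
rewrite /chi2_mean mulr_suml.
transitivity (\int[mu]_(t in D) \sum_(i < size p) (p`_i * (expR (- t) ^+ i * K t))).
  by apply: eq_Rintegral => t _; rewrite horner_coef mulr_suml; apply: eq_bigr => i _; rewrite -mulrA.
pose h i t := p`_i * (expR (- t) ^+ i * K t).
have int_h i : mu.-integrable D (EFin \o h i).
  by apply: (integrableZl mD p`_i (chi2_integrable_expX i)).
suff /(_ (size p))[] : forall n, mu.-integrable D (EFin \o (fun t => \sum_(i < n) h i t)) /\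
  \int[mu]_(t in D) (\sum_(i < n) h i t) =
  \sum_(i < n) p`_i * expR (- (k%:R / 2) * ln (1 + 2 * i%:R)) * Z by [].
elim => [|n [int_n IHn]].
  under eq_fun do rewrite big_ord0.
  rewrite big_ord0 Rintegral_cst// mul0r; split=> //; exact: integrable0.
under eq_fun do rewrite big_ord_recr/=.
rewrite big_ord_recr/= RintegralD// IHn; split; last first.
  by congr (_ + _); rewrite /h RintegralZl// chi2_laplace mulrA.
exact: (integrableD mD int_n (int_h n)).
Qed.

(** On the half-line p(exp(-t)) dominates the indicator of B. The set is general because the
    converse bound uses the complement of [0, x]. *)
Lemma chi2_mean_ge (p : {poly R}) (B : set (measurableTypeR R)) : measurable B -> B `<=` D ->
  (forall t, 0 <= t -> 0 <= p.[expR (- t)]) -> (forall t, B t -> 1 <= p.[expR (- t)]) ->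
  (\int[mu]_(t in B) K t) / Z <= chi2_mean p.
Proof.
move=> mB BD p0 p1; rewrite ler_pdivrMr ?chi2_mass_gt0// -chi2_meanE.
have intB : mu.-integrable B (EFin \o K) by exact: integrableS intK.
have intp := chi2_integrable_poly p.
have intpB : mu.-integrable B (EFin \o (fun t => p.[expR (- t)] * K t)) by exact: integrableS intp.
apply: (@le_trans _ _ (\int[mu]_(t in B) (p.[expR (- t)] * K t))).
  by apply: le_Rintegral => // t Bt; rewrite ler_peMl ?chi2_kernel_ge0// p1.
rewrite /Rintegral; apply: fine_le; [exact: integrable_fin_num intpB|exact: integrable_fin_num intp|].
apply: ge0_subset_integral => //; first by case/integrableP: intp.
by move=> t /D_ge0 t0; rewrite lee_fin mulr_ge0 ?chi2_kernel_ge0 ?p0.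
Qed.

Lemma chi2_mean_ge_cdf (p : {poly R}) (x : R) :
  (forall t, 0 <= t -> (t <= x)%R%:R <= p.[expR (- t)]) ->
  chi2_cdf k x <= chi2_mean p.
Proof.
move=> px; apply: (@chi2_mean_ge p `[0%R, x]%classic) => //.
- by move=> t; rewrite /D/= !in_itv/= andbT => /andP[].
- by move=> t t0; apply: le_trans (px _ t0); rewrite ler0n.
- by move=> t; rewrite /= in_itv/= => /andP[t0 tx]; have := px _ t0; rewrite tx.
Qed.

Lemma chi2_mean_cst c : chi2_mean c%:P = c.
Proof.
apply: (@mulIf _ Z); first by rewrite gt_eqF// chi2_mass_gt0.
by rewrite -chi2_meanE -RintegralZl//; apply: eq_Rintegral => t _; rewrite hornerC.
Qed.

Lemma chi2_meanB p q : chi2_mean (p - q) = chi2_mean p - chi2_mean q.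
Proof.
apply: (@mulIf _ Z); first by rewrite gt_eqF// chi2_mass_gt0.
rewrite mulrBl -!chi2_meanE -RintegralB//; try exact: chi2_integrable_poly.
by apply: eq_Rintegral => t _; rewrite hornerD hornerN mulrBl.
Qed.

(** Apply the lower bound to 1 + e - p on the complement of [0, x]. *)
Lemma chi2_mean_le_cdf (p : {poly R}) (x e : R) :
  (forall t, 0 <= t -> p.[expR (- t)] <= (t <= x)%R%:R + e) ->
  chi2_mean p <= chi2_cdf k x + e.
Proof.
move=> px; pose B : set (measurableTypeR R) := D `\` `[0%R, x]%classic.
have mB : measurable B by apply: measurableD.
have BD : B `<=` D by move=> t [].
have := @chi2_mean_ge ((1 + e)%:P - p) B mB BD.
rewrite chi2_meanB chi2_mean_cst.
have IB : \int[mu]_(t in B) K t = Z - \int[mu]_(t in `[0%R, x]) K t.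
  have E : D = `[0%R, x] `|` B.
    rewrite /B setDUK// => t; rewrite /D/= !in_itv/= andbT => /andP[]//.
  rewrite /Z [in RHS]E Rintegral_setU -?E//; first by rewrite addrC addKr.
  by apply/disj_set2P; rewrite /B setDIK.
rewrite IB mulrBl divff ?gt_eqF ?chi2_mass_gt0// => H.
have : 1 - chi2_cdf k x <= 1 + e - chi2_mean p.
  apply: H => t.
  - move=> t0; have := px _ t0; rewrite !hornerE; case: (t <= x)%R => /=; lra.
  - case=> /D_ge0 t0 /negP; rewrite in_itv/= t0/= => /negbTE tx.
    by have := px _ t0; rewrite !hornerE tx/=; lra.
lra.
Qed.

Lemma chi2_cdf_lt0 (x : R) : x < 0 -> chi2_cdf k x = 0.
Proof.
move=> x0; rewrite /chi2_cdf set_itv_ge ?integral_set0 ?mul0r//.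
by rewrite bnd_simp -ltNge.
Qed.

(** The integral of the kernel is continuous on [0, x + 1], which settles x > 0. At x = 0 it gives
    the right side only; on the left the distribution function vanishes. *)
Lemma chi2_cdf_continuous (x e : R) : 0 < e -> exists2 h : R, 0 < h &
  chi2_cdf k (x + h) <= chi2_cdf k x + e /\ chi2_cdf k x - e <= chi2_cdf k (x - h).
Proof.
move=> e0; have [x0|x0] := ltP x 0.
  exists (- x / 2); first by rewrite divr_gt0// oppr_gt0.
  by rewrite !chi2_cdf_lt0; lra.
have Z0 := chi2_mass_gt0.
pose G y := \int[mu]_(t in `[0, y]) K t.
have FE y : chi2_cdf k y = G y / Z by [].
have eZ : 0 < e * Z by rewrite mulr_gt0.
have : {within `[0, x + 1], continuous G}.
  apply: parameterized_integral_continuous; first by rewrite addr_ge0.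
  apply: (integrableS _ _ _ intK) => // t; rewrite /D/= !in_itv/= andbT => /andP[]//.
have x1 : 0 < x + 1 by rewrite ltr_wpDl.
move=> /(continuous_within_itvP _ x1)[Gc G0 _].
have F_le u v : `|G u - G v| <= e * Z -> chi2_cdf k v <= chi2_cdf k u + e /\ chi2_cdf k u - e <= chi2_cdf k v.
  rewrite ler_norml !FE => /andP[H1 H2].
  have -> : G u / Z + e = (G u + e * Z) / Z by field; rewrite gt_eqF.
  have -> : G u / Z - e = (G u - e * Z) / Z by field; rewrite gt_eqF.
  by rewrite !ler_pM2r ?invr_gt0//; lra.
case: (ltgtP x 0) x0 => // [x0 _|-> _].
  have /cvgrPdist_le/(_ _ eZ)/nbhs_ballP[d /= d0 Hd] : {for x, continuous G}.
    by apply: Gc; rewrite in_itv/= x0 ltrDl ltr01.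
  exists (d / 2); first by rewrite divr_gt0.
  have d2 : 0 < d / 2 by rewrite divr_gt0.
  have H1 : `|G x - G (x + d / 2)| <= e * Z.
    by apply: Hd; rewrite /ball/= opprD addNKr normrN gtr0_norm//; lra.
  have H2 : `|G x - G (x - d / 2)| <= e * Z.
    by apply: Hd; rewrite /ball/= opprB addrC subrK gtr0_norm//; lra.
  by split; [case: (F_le _ _ H1)|case: (F_le _ _ H2)].
have G00 : chi2_cdf k (0 : R) = 0 by rewrite FE /G set_itv1 Rintegral_set1 mul0r.
move/cvgrPdist_le : G0 => /(_ _ eZ)[d /= d0 Hd].
exists (d / 2); first by rewrite divr_gt0.
have d2 : 0 < d / 2 by rewrite divr_gt0.
have H1 : `|G 0 - G (0 + d / 2)| <= e * Z.
  apply: Hd; last by rewrite add0r.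
  by rewrite /ball/= !add0r normrN gtr0_norm//; lra.
split; first by case: (F_le _ _ H1).
by rewrite (chi2_cdf_lt0 (x := 0 - d / 2)) ?G00; lra.
Qed.

End Chi2Laplace.

(** * From Laplace transforms to distribution functions *)

Section LaplaceToCdf.
Variables (R : realType) (k : nat).
Hypothesis k_gt0 : (0 < k)%N.

(** In the variable u = exp(-t) the half-line becomes a bounded interval. A Lipschitz ramp in u,
    equal to 1 for t <= x and to 0 for t > x + h, is approximated within e/2 and then raised by e/2
    to stay above the indicator. *)
Lemma indicator_poly_approx (x h e : R) : 0 < h -> 0 < e ->
  exists p : {poly R}, forall t, 0 <= t ->
    (t <= x)%R%:R <= p.[expR (- t)] <= (t <= x + h)%R%:R + e.
Proof.
move=> h0 e0.
pose u0 := expR (- x); pose u1 := expR (- (x + h)).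
have u10 : u1 < u0 by rewrite ltr_expR ltrN2 ltrDl.
have d0 : 0 < u0 - u1 by rewrite subr_gt0.
pose f u := Num.max 0 (Num.min 1 ((u - u1) / (u0 - u1))).
have fL u v : `|f u - f v| <= (u0 - u1)^-1 * `|u - v|.
  have clampL (a b : R) : `|Num.max 0 (Num.min 1 a) - Num.max 0 (Num.min 1 b)| <= `|a - b|.
    have H1 := ler_norm (a - b); have := ler_norm (b - a); rewrite distrC => H2.
    rewrite ler_norml /Order.max /Order.min.
    case: (ltP 1 a) => ?; case: (ltP 1 b) => ?; rewrite ?ltr01;
      case: (ltP 0 a) => ?; case: (ltP 0 b) => ?; apply/andP; split; lra.
  apply: (le_trans (clampL _ _)).
  by rewrite -mulrBl opprB addrA subrK normrM mulrC ger0_norm// invr_ge0 ltW.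
have e2 : 0 < e / 2 by rewrite divr_gt0.
have [|p pf] := lipschitz_weierstrass _ e2 fL; first by rewrite invr_gt0.
exists (p + (e / 2)%:P) => t t0; rewrite hornerD hornerC.
have E1 : expR (- t) <= 1 by rewrite -expR0 ler_expR oppr_le0.
have := pf (expR (- t)); rewrite expR_ge0 E1 => /(_ isT).
rewrite ler_norml => /andP[H1 H2].
have f0 : 0 <= f (expR (- t)) by rewrite le_max lexx.
have f1 : f (expR (- t)) <= 1 by rewrite ge_max ler01 ge_min lexx.
have fx : t <= x -> f (expR (- t)) = 1.
  move=> tx; rewrite /f min_l ?max_r// ler_pdivlMr// mul1r lerD2r.
  by rewrite ler_expR lerN2.
have fxh : x + h < t -> f (expR (- t)) = 0.
  move=> tx; rewrite /f max_l// ge_min ler_pdivrMr// mul0r subr_le0 ler_expR lerN2 (ltW tx) orbT//.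
have [tx|tx] := leP t x.
  have -> : t <= x + h by rewrite (le_trans tx)// lerDl ltW.
  by move: H1 H2; rewrite fx//= => H1 H2; apply/andP; split; lra.
have [txh|txh] := leP t (x + h); first by apply/andP; split=> /=; lra.
by move: H1 H2; rewrite fxh//= => H1 H2; apply/andP; split; lra.
Qed.

Variables (A : finType) (mu : A -> R) (Q : nat -> seq A -> R).
Hypothesis mu_ge0 : forall a, 0 <= mu a.
Hypothesis mu_sum1 : \sum_a mu a = 1.
Hypothesis Q_ge0 : forall N s, 0 <= Q N s.
Hypothesis Q_laplace : forall t : R, 0 <= t ->
  (fun N => iidE mu N (fun s => expR (- t * Q N s))) @ \oo -->
    expR (- (k%:R / 2) * ln (1 + 2 * t)).

Lemma iidE_poly_cvg (p : {poly R}) :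
  (fun N => iidE mu N (fun s => p.[expR (- Q N s)])) @ \oo --> chi2_mean k p.
Proof.
have -> : (fun N => iidE mu N (fun s => p.[expR (- Q N s)])) =
  (fun N => \sum_(i < size p) p`_i * iidE mu N (fun s => expR (- i%:R * Q N s))).
  apply/funext => N; under eq_bigr do rewrite -iidEZ.
  rewrite -iidE_sum; apply: eq_iidE => s _; rewrite horner_coef.
  by apply: eq_bigr => i _; rewrite mulNr -mulrN expRM_natl.
rewrite /chi2_mean; apply: cvg_big => //; first exact: add_continuous.
move=> i _; apply: cvgM; first exact: cvg_cst.
exact: Q_laplace.
Qed.

(** The thresholds x + h and x - h leave room for replacing Q by the test ratio. Half of the
    continuity modulus goes to this room, half to the ramp; the error is split between continuity,
    approximation and convergence. *)
Lemma iidE_cdf_sandwich (x e : R) : 0 < e -> exists2 h : R, 0 < h &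
  \forall N \near \oo,
    iidE mu N (fun s => (Q N s <= x + h)%R%:R) <= chi2_cdf k x + e /\
    chi2_cdf k x - e <= iidE mu N (fun s => (Q N s <= x - h)%R%:R).
Proof.
move=> e0; have e3 : 0 < e / 3 by rewrite divr_gt0.
have [h h0 [Fh1 Fh2]] := @chi2_cdf_continuous R k k_gt0 x _ e3.
have h2 : 0 < h / 2 by rewrite divr_gt0.
exists (h / 2) => //.
have [p Hp] := indicator_poly_approx (x + h / 2) h2 e3.
have [q Hq] := indicator_poly_approx (x - h) h2 e3.
have pF : chi2_mean k p <= chi2_cdf k (x + h) + e / 3.
  apply: chi2_mean_le_cdf => // t t0; have /andP[_] := Hp t t0.
  by rewrite -addrA -splitr.
have qF : chi2_cdf k (x - h) <= chi2_mean k q.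
  by apply: chi2_mean_ge_cdf => // t t0; have /andP[] := Hq t t0.
move/cvgrPdist_le : (@iidE_poly_cvg p) => /(_ _ e3) Cp.
move/cvgrPdist_le : (@iidE_poly_cvg q) => /(_ _ e3) Cq.
near=> N; split.
  apply: (@le_trans _ _ (iidE mu N (fun s => p.[expR (- Q N s)]))).
    by apply: ler_iidE => // s _; have /andP[] := Hp _ (Q_ge0 N s).
  have : `|chi2_mean k p - iidE mu N (fun s => p.[expR (- Q N s)])| <= e / 3 by near: N.
  by rewrite ler_norml => /andP[H1 H2]; lra.
have : `|chi2_mean k q - iidE mu N (fun s => q.[expR (- Q N s)])| <= e / 3 by near: N.
rewrite ler_norml => /andP[H1 H2].
have : iidE mu N (fun s => q.[expR (- Q N s)]) <= iidE mu N (fun s => (Q N s <= x - h / 2)%R%:R) + e / 3.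
  rewrite -[X in _ + X](iidE_cst mu_sum1 N) -iidED; apply: ler_iidE => // s _.
  have /andP[_] := Hq _ (Q_ge0 N s).
  by rewrite (_ : x - h + h / 2 = x - h / 2)//; field.
lra.
Unshelve. all: by end_near.
Qed.

End LaplaceToCdf.

(** * Local behaviour of phi-divergences *)

Section PhiLocal.
Variables (R : realType) (phi : R -> R).
Hypothesis adm : admissible phi.

Let c := phi2nd phi 1.

Let phi_derive (x : R) : 0 < x -> is_derive x 1 phi (derive1 phi x).
Proof.
move=> x0; case: adm => _ /(_ x x0)[d1 _] _ _ _.
by rewrite derive1E; exact/derivableP.
Qed.

Let phi1_derive (x : R) : 0 < x -> is_derive x 1 (derive1 phi) (phi2nd phi x).
Proof.
move=> x0; case: adm => _ /(_ x x0)[_ d1] _ _ _.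
by rewrite /phi2nd derive1E; exact/derivableP.
Qed.

Lemma phi_continuous (x : R) : 0 < x -> {for x, continuous phi}.
Proof.
move=> x0; have := phi_derive x0 => ?.
by apply/differentiable_continuous/derivable1_diffP; exact: ex_derive.
Qed.

(** The Taylor bound is one-sided, so the two sides of 1 are reached by the directions sg = 1 and sg
    = -1. *)
Let phi_line (sg b e : R) : (sg = 1 \/ sg = -1) -> 0 <= b -> b < 1 ->
  (forall x, `|x - 1| <= b -> `|phi2nd phi x - c| <= e) ->
  `|phi (1 + sg * b) - c / 2 * b ^+ 2| <= e * b ^+ 2.
Proof.
move=> sg1 b0 b1 He.
have sg2 : sg * sg = 1 by case: sg1 => ->; rewrite ?mulr1// mulrNN mulr1.
have nsg : `|sg| = 1 by case: sg1 => ->; rewrite ?normrN normr1.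
have pos x : 0 <= x <= b -> 0 < 1 + sg * x.
  by move=> /andP[x0 xb]; case: sg1 => ->; lra.
case: (adm) => _ _ _ [phi1 dphi1] _.
pose f x := phi (1 + sg * x) - c / 2 * x ^+ 2.
pose f1 x := sg * derive1 phi (1 + sg * x) - c * x.
pose f2 x := phi2nd phi (1 + sg * x) - c.
have := @taylor1_bound R f f1 f2 e b b0.
have f0 : f 0 = 0 by rewrite /f mulr0 addr0 phi1 expr0n mulr0 subr0.
have f10 : f1 0 = 0 by rewrite /f1 !mulr0 addr0 dphi1 mulr0 subr0.
rewrite f0 f10 mul0r !subr0; apply => x xb.
- have dp := phi_derive (pos x xb).
  have dl : is_derive x 1 (fun x => 1 + sg * x) sg.
    by apply: is_derive_eq; rewrite /GRing.scale/=; ring.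
  have dc : is_derive x 1 (phi \o (fun x => 1 + sg * x)) (sg * derive1 phi (1 + sg * x)).
    by rewrite mulrC; exact: is_derive1_comp.
  have dq : is_derive x 1 (fun x => c / 2 * x ^+ 2) (c * x).
    by apply: is_derive_eq; rewrite /GRing.scale/=; field.
  exact: (is_deriveB dc dq).
- have dp := phi1_derive (pos x xb).
  have dl : is_derive x 1 (fun x => 1 + sg * x) sg.
    by apply: is_derive_eq; rewrite /GRing.scale/=; ring.
  have dc : is_derive x 1 (derive1 phi \o (fun x => 1 + sg * x)) (sg * phi2nd phi (1 + sg * x)).
    by rewrite mulrC; exact: is_derive1_comp.
  have dq : is_derive x 1 (fun x => c * x) c.
    by apply: is_derive_eq; rewrite /GRing.scale/= mulr1.
  have := is_deriveB (is_deriveZ sg dc) dq.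
  by rewrite /GRing.scale/= mulrA sg2 mul1r.
- apply: He; rewrite addrC addKr normrM nsg mul1r.
  by case/andP: xb => x0 xb; rewrite ger0_norm.
Qed.

(** The second derivative is merely continuous, hence an error that is a small multiple of the
    square and not a cubic one. *)
Lemma phi_local_quadratic (e : R) : 0 < e -> exists2 d : R, 0 < d < 1 &
  forall u, `|u - 1| <= d -> `|phi u - c / 2 * (u - 1) ^+ 2| <= e * (u - 1) ^+ 2.
Proof.
move=> e0; case: (adm) => _ _ /(_ 1 ltr01) + _ _.
move=> /cvgrPdist_le/(_ e e0)/nbhs_ballP[d' /= d'0 Hd'].
pose d := Num.min (d' / 2) (1 / 2).
have d0 : 0 < d by rewrite lt_min !divr_gt0.
have d12 : d <= 1 / 2 by rewrite ge_min lexx orbT.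
have dd' : d < d' by apply: (@le_lt_trans _ _ (d' / 2)); [rewrite ge_min lexx|lra].
have H b : b <= d -> forall x, `|x - 1| <= b -> `|phi2nd phi x - c| <= e.
  move=> bd x xb; rewrite distrC; apply: Hd'; rewrite /ball/= distrC.
  exact: le_lt_trans xb (le_lt_trans bd dd').
exists d; first by rewrite d0/=; lra.
move=> u ud; have [u1|u1] := leP 1 u.
  have b0 : 0 <= u - 1 by rewrite subr_ge0.
  rewrite ger0_norm// in ud.
  have := @phi_line 1 (u - 1) e (or_introl erefl) b0 _ (H _ ud).
  by rewrite (_ : 1 + 1 * (u - 1) = u); [apply; lra|ring].
have b0 : 0 <= 1 - u by rewrite subr_ge0 ltW.
rewrite distrC ger0_norm// in ud.
have := @phi_line (-1) (1 - u) e (or_intror erefl) b0 _ (H _ ud).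
rewrite (_ : 1 + -1 * (1 - u) = u); last by ring.
by rewrite (_ : (1 - u) ^+ 2 = (u - 1) ^+ 2); [apply; lra|ring].
Qed.

(** The segment from 1 to u meets 1 + d or 1 - d at proportion d/|u - 1|, and phi vanishes at 1:
    convexity gives linear growth. *)
Lemma phi_convex_growth (d u : R) : 0 < d < 1 -> 0 < u -> d <= `|u - 1| ->
  Num.min (phi (1 + d)) (phi (1 - d)) * `|u - 1| / d <= phi u.
Proof.
move=> /andP[d0 d1] u0 du.
case: (adm) => cvx _ _ [phi1 _] _.
have n0 : 0 < `|u - 1| by apply: lt_le_trans du.
pose t := d / `|u - 1|.
have t01 : 0 <= t <= 1.
  by rewrite divr_ge0 ?(ltW d0) ?(ltW n0)//= ler_pdivrMr// mul1r.
have := cvx u 1 t u0 ltr01 t01; rewrite phi1 mulr0 addr0.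
rewrite -ler_pdivrMl ?divr_gt0// /t => H.
suff E : Num.min (phi (1 + d)) (phi (1 - d)) <= phi (t * u + (1 - t) * 1).
  apply: le_trans H; rewrite invf_div -mulrA mulrC ler_pM2l// divr_gt0//.
have [u1|u1] := leP 1 u.
  rewrite (_ : t * u + (1 - t) * 1 = 1 + d) ?ge_min ?lexx//.
  have -> : t * u + (1 - t) * 1 = 1 + t * (u - 1) by ring.
  by rewrite /t ger0_norm ?subr_ge0// divfK// gt_eqF// -(ger0_norm (_ : 0 <= u - 1)) ?subr_ge0.
rewrite (_ : t * u + (1 - t) * 1 = 1 - d) ?ge_min ?lexx ?orbT//.
have -> : t * u + (1 - t) * 1 = 1 - t * (1 - u) by ring.
by rewrite /t distrC ger0_norm ?subr_ge0 ?(ltW u1)// divfK// gt_eqF// subr_gt0.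
Qed.

(** Subtracting d0 makes the bound trivial near 1, where phi is only quadratic; elsewhere convex
    growth applies. Being global, it can localise a minimiser about which nothing is known yet. *)
Lemma phi_ge_dist (d0 : R) : 0 < d0 -> exists2 ka : R, 0 < ka &
  forall u, 0 < u -> 0 <= phi u /\ ka * (`|u - 1| - d0) <= phi u.
Proof.
move=> d00; have c0 : 0 < c by case: adm.
have c4 : 0 < c / 4 by rewrite divr_gt0.
have [d /andP[dp d1] Hd] := phi_local_quadratic c4.
pose h := Num.min d d0.
have h0 : 0 < h by rewrite lt_min dp.
have hd : h <= d by rewrite ge_min lexx.
have hd0 : h <= d0 by rewrite ge_min lexx orbT.
have near u : `|u - 1| <= d -> c / 4 * (u - 1) ^+ 2 <= phi u.
  by move=> /Hd; rewrite ler_norml => /andP[H _]; have := sqr_ge0 (u - 1); nra.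
have ph : 0 < Num.min (phi (1 + h)) (phi (1 - h)).
  rewrite lt_min; apply/andP; split.
    apply: (lt_le_trans _ (near _ _)); rewrite addrC addKr ?gtr0_norm//.
    by rewrite mulr_gt0// exprn_gt0.
  apply: (lt_le_trans _ (near _ _)); rewrite addrC addKr ?normrN ?gtr0_norm//.
  by rewrite sqrrN mulr_gt0// exprn_gt0.
have near0 u : `|u - 1| <= d -> 0 <= phi u.
  by move=> /near; apply: le_trans; rewrite mulr_ge0 ?sqr_ge0// ltW.
exists (Num.min (phi (1 + h)) (phi (1 - h)) / h); first by rewrite divr_gt0.
move=> u u0; set k := Num.min _ _ in ph *.
have kh : 0 < k / h by rewrite divr_gt0.
have [uh|uh] := leP h `|u - 1|.
  have H : k * `|u - 1| / h <= phi u.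
    by apply: phi_convex_growth => //; rewrite h0/= (le_lt_trans hd).
  split.
    by apply: le_trans H; rewrite divr_ge0 ?mulr_ge0 ?(ltW ph) ?(ltW h0).
  by apply: le_trans H; rewrite (mulrAC k `|u - 1|) ler_pM2l// gerDl oppr_le0 ltW.
have p0 : 0 <= phi u by apply: near0; rewrite (le_trans (ltW uh)).
split=> //; apply: le_trans p0.
rewrite pmulr_rle0// subr_le0 (le_trans (ltW uh))//.
Qed.

End PhiLocal.

Section Divergence.
Variables (R : realType) (M : nat).
Implicit Types (p q : 'I_M -> R) (phi : R -> R).

Definition phidiv phi p q : R := \sum_r q r * phi (p r / q r).

Lemma dphiE phi p q : (forall r, 0 < p r) -> (forall r, 0 < q r) ->
  dphi phi p q = (phidiv phi p q)%:E.
Proof.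
move=> p0 q0; rewrite /dphi /phidiv -sumEFin; apply: eq_bigr => r _.
by rewrite !gt_eqF.
Qed.

Variable p0 : 'I_M -> R.
Hypothesis p0_gt0 : forall r, 0 < p0 r.

(** The weights stay at p0 whatever p and q are, so this is a squared Euclidean distance after
    standardisation. *)
Definition chidist p q : R := \sum_r (p r - q r) ^+ 2 / p0 r.

Lemma chidist_ge0 p q : 0 <= chidist p q.
Proof. by apply: sumr_ge0 => r _; rewrite divr_ge0 ?sqr_ge0// ltW. Qed.

Lemma chidist_triangle p q z : chidist q z <= 2 * chidist p q + 2 * chidist p z.
Proof.
rewrite /chidist !mulr_sumr -big_split/=; apply: ler_sum => r _.
rewrite !mulrA -mulrDl ler_pM2r ?invr_gt0//.
by have := sqr_ge0 (p r - q r + (p r - z r)); nra.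
Qed.

Lemma ex_pos_lbound : exists2 m, 0 < m <= 1 & forall r, m <= p0 r.
Proof.
exists (\big[Num.min/1]_r p0 r); last by move=> r; apply: bigmin_le_cond.
rewrite bigmin_le_id andbT; apply: lt_bigmin => //.
Qed.

(** Averaging [phi_ge_dist] with weights q turns q|p/q - 1| into |p - q|: a small divergence forces
    a small l1 distance. *)
Lemma phidiv_dist phi : admissible phi -> forall d, 0 < d -> exists2 ka, 0 < ka &
  forall p q, (forall r, 0 < p r) -> (forall r, 0 < q r) -> \sum_r q r = 1 ->
  ka * (\sum_r `|p r - q r| - d) <= phidiv phi p q.
Proof.
move=> adm d dp; have [ka ka0 Hka] := phi_ge_dist adm dp.
exists ka => // p q pp qp q1.
have -> : ka * (\sum_r `|p r - q r| - d) = \sum_r q r * (ka * (`|p r / q r - 1| - d)).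
  rewrite mulrBr -[X in _ - _ * X]mul1r -{1}q1 mulr_suml !mulr_sumr -sumrB.
  apply: eq_bigr => r _.
  have -> : p r / q r - 1 = (p r - q r) / q r by field; rewrite gt_eqF.
  by rewrite normrM normfV (gtr0_norm (qp r)); field; rewrite gt_eqF.
by apply: ler_sum => r _; rewrite ler_pM2l//; have [] := Hka (p r / q r) (divr_gt0 (pp r) (qp r)).
Qed.

Lemma phidiv_local phi : admissible phi -> forall e, 0 < e -> exists2 h, 0 < h &
  forall p q, (forall r, `|p r - p0 r| <= h) -> (forall r, `|q r - p0 r| <= h) ->
  `|2 / phi2nd phi 1 * phidiv phi p q - chidist p q| <= e * chidist p q.
Proof.
move=> adm e e0; have c0 : 0 < phi2nd phi 1 by case: adm.
set c := phi2nd phi 1 in c0 *.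
have [m /andP[m0 m1] mp0] := ex_pos_lbound.
pose e2 := Num.min 1 (e / 2).
have e20 : 0 < e2 by rewrite lt_min ltr01 divr_gt0.
have e21 : e2 <= 1 by rewrite ge_min lexx.
have e2e : e2 <= e / 2 by rewrite ge_min lexx orbT.
have e1p : 0 < e * c / 8 by rewrite divr_gt0// mulr_gt0.
have [d /andP[d0 d1] Hd] := phi_local_quadratic adm e1p.
(* The first entry gives |p0/q - 1| <= e2, the second |p/q - 1| <= d. Half of e pays for the Taylor
   error, half for the change of weight from q to p0. *)
pose h := Num.min (m * e2 / 2) (m * d / 4).
have h0 : 0 < h by rewrite lt_min !divr_gt0// mulr_gt0.
have h1 : h <= m * e2 / 2 by rewrite ge_min lexx.
have h2 : h <= m * d / 4 by rewrite ge_min lexx orbT.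
exists h => // p q ph qh.
rewrite /phidiv /chidist !mulr_sumr -sumrB.
apply: (le_trans (ler_norm_sum _ _ _)); apply: ler_sum => r _.
have {}ph := ph r; have {}qh := qh r; have {}mp0 := mp0 r; have pr0 := p0_gt0 r.
move: (p r) (q r) (p0 r) ph qh mp0 pr0 => x y z xh yh mz z0.
have hm : h <= m / 2 by apply: (le_trans h1); nra.
have yz : z / 2 <= y by move: yh; rewrite ler_norml => /andP[]; lra.
have y0 : 0 < y by lra.
have xy : `|x - y| <= d * y.
  have -> : x - y = (x - z) - (y - z) by ring.
  apply: (le_trans (ler_normB _ _)); nra.
have u1 : x / y - 1 = (x - y) / y by field; rewrite gt_eqF.
have : `|x / y - 1| <= d.
  by rewrite u1 normrM normfV (gtr0_norm y0) ler_pdivrMr.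
move=> /Hd; rewrite u1 => H.
pose s := (x - y) ^+ 2 / z.
have s0 : 0 <= s by rewrite divr_ge0 ?sqr_ge0// ltW.
have yz2 : `|z / y - 1| <= e2.
  have -> : z / y - 1 = - ((y - z) / y) by field; rewrite gt_eqF.
  rewrite normrN normrM normfV (gtr0_norm y0) ler_pdivrMr//.
  apply: (le_trans yh); nra.
have E : 2 / c * (y * phi (x / y)) - s =
   2 / c * y * (phi (x / y) - c / 2 * ((x - y) / y) ^+ 2) + s * (z / y - 1).
  by rewrite /s; field; rewrite !gt_eqF.
rewrite E; apply: (le_trans (ler_normD _ _)).
have B1 : `|2 / c * y * (phi (x / y) - c / 2 * ((x - y) / y) ^+ 2)| <= e / 2 * s.
  rewrite normrM ger0_norm ?mulr_ge0 ?invr_ge0 ?(ltW c0) ?(ltW y0)//.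
  apply: (le_trans (ler_wpM2l _ H)); first by rewrite !mulr_ge0 ?invr_ge0 ?(ltW c0) ?(ltW y0).
  have -> : 2 / c * y * (e * c / 8 * ((x - y) / y) ^+ 2) = e / 4 * (s * (z / y)).
    by rewrite /s; field; rewrite !gt_eqF.
  have -> : e / 2 * s = e / 4 * (s * 2) by field.
  rewrite ler_wpM2l ?divr_ge0 ?(ltW e0)// ler_wpM2l//.
  by rewrite ler_pdivrMr//; lra.
have B2 : `|s * (z / y - 1)| <= e / 2 * s.
  by rewrite normrM ger0_norm// mulrC ler_wpM2r// (le_trans yz2).
by apply: (le_trans (lerD B1 B2)); rewrite -mulrDl -splitr.
Qed.

End Divergence.

(** * Minimum divergence in the log-linear model *)

Section OrthogonalProjection.
Variable R : realType.

Lemma dotvE m (u v : 'cV[R]_m) : dotv u v = (u^T *m v) 0 0.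
Proof. by rewrite mxE; apply: eq_bigr => i _; rewrite mxE. Qed.

Lemma dotv_mulmxl m n (A : 'M[R]_(n, m)) (u : 'cV[R]_m) (v : 'cV[R]_n) :
  dotv (A *m u) v = dotv u (A^T *m v).
Proof. by rewrite !dotvE trmx_mul mulmxA. Qed.

(** [G] is the least-squares matrix: G y are the fitted coefficients and P y the residual. The Gram
    matrix is invertible because v B^T B = 0 forces |v B^T|^2 = 0. *)
Lemma ex_orthogonal_projection (M m : nat) (B : 'M[R]_(M, m)) : \rank B = m ->
  exists P : 'M[R]_M, exists G : 'M[R]_(m, M),
  [/\ P^T = P, P *m P = P, P *m B = 0, P + B *m G = 1%:M & \tr P = M%:R - m%:R].
Proof.
move=> rB.
have fB : row_free B^T by rewrite /row_free mxrank_tr rB.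
have uBB : B^T *m B \in unitmx.
  rewrite -row_free_unit; apply: inj_row_free => v vBB.
  apply/eqP; rewrite -(mulmx_free_eq0 _ fB) -trmx_eq0 -(@dotv_eq0 R M (v *m B^T)^T).
  by rewrite dotvE trmxK trmx_mul trmxK mulmxA -(mulmxA v) vBB mul0mx mxE.
pose G := invmx (B^T *m B) *m B^T.
exists (1%:M - B *m G), G.
have GB : G *m B = 1%:M by rewrite -mulmxA mulVmx.
have PB : (1%:M - B *m G) *m B = 0 by rewrite mulmxBl mul1mx -mulmxA GB mulmx1 subrr.
split => //.
- rewrite linearB/= trmx1 /G !trmx_mul trmxK trmx_inv trmx_mul trmxK mulmxA//.
- by rewrite [in LHS]mulmxBr mulmx1 [X in _ - X]mulmxA PB mul0mx subr0.
- by rewrite subrK.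
- by rewrite linearB/= mxtrace1 mxtrace_mulC GB mxtrace1.
Qed.

Variables (m : nat) (P : 'M[R]_m).
Hypotheses (P_sym : P^T = P) (P_idem : P *m P = P).

Lemma dotv_proj u : dotv (P *m u) (P *m u) = dotv u (P *m u).
Proof. by rewrite dotv_mulmxl P_sym mulmxA P_idem. Qed.

Lemma dotv_proj_le u : dotv (P *m u) (P *m u) <= dotv u u.
Proof.
have := dotv_ge0 (u + (-1) *: (P *m u)).
by rewrite dotv_lineE dotv_proj; lra.
Qed.

(** Young's inequality for the cross term. In its uses v is of higher order and can bear the factor
    1/e. *)
Lemma dotvD_le (e : R) (u v : 'cV[R]_m) : 0 < e ->
  dotv (u + v) (u + v) <= (1 + e) * dotv u u + (1 + e^-1) * dotv v v.
Proof.
move=> e0; have := dotv_ge0 (v + (- e) *: u); rewrite dotv_lineE => H.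
have := dotv_lineE u v 1; rewrite scale1r expr1n !mulr1 => ->.
rewrite -subr_ge0.
have -> : (1 + e) * dotv u u + (1 + e^-1) * dotv v v - (dotv u u + 2 * dotv u v + dotv v v)
  = e^-1 * (dotv v v + 2 * dotv v u * - e + dotv u u * (- e) ^+ 2).
  by rewrite (dotvC u v); field; rewrite gt_eqF.
by rewrite mulr_ge0// invr_ge0 ltW.
Qed.

End OrthogonalProjection.

Section ExpLnBounds.
Variable R : realType.

Lemma expR_quadratic_bound (x : R) : x <= 1 / 2 -> 0 <= expR x - 1 - x <= 2 * x ^+ 2.
Proof.
move=> x1; apply/andP; split; first by have := expR_ge1Dx x; lra.
have := expR_ge1Dx (- x); rewrite expRN => H.
have e0 := expR_gt0 x.
have : (1 - x) * expR x <= 1.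
  by rewrite -[leRHS](mulVf (lt0r_neq0 e0)) ler_pM2r.
(* This says (1 + x + 2 x^2)(1 - x) >= 1, to be compared with (1 - x) exp(x) <= 1. *)
have : 0 <= x ^+ 2 * (1 - 2 * x) by rewrite mulr_ge0 ?sqr_ge0//; lra.
nra.
Qed.

Lemma ln_lipschitz_near1 (v : R) : `|v - 1| <= 1 / 2 -> `|ln v| <= 2 * `|v - 1|.
Proof.
move=> v1; have v0 : 1 / 2 <= v by move: v1; rewrite ler_norml => /andP[]; lra.
have vp : 0 < v by lra.
have H1 := expR_ge1Dx (ln v); rewrite lnK ?posrE// in H1.
have H2 := expR_ge1Dx (- ln v); rewrite expRN lnK ?posrE// in H2.
have H3 : 1 - v^-1 = (v - 1) * v^-1 by field; rewrite gt_eqF.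
have vi : v^-1 <= 2 by rewrite -[leRHS]invrK lef_pV2 ?posrE//; lra.
have vi0 : 0 < v^-1 by rewrite invr_gt0.
have N1 := ler_norm (v - 1); have := ler_norm (- (v - 1)); rewrite normrN => N2.
rewrite ler_norml; apply/andP; split; last by lra.
have : - (2 * `|v - 1|) <= (v - 1) * v^-1; last by lra.
have := normr_ge0 (v - 1); nra.
Qed.

Lemma sum_sqr_le_sqr_sum (I : finType) (f : I -> R) : (forall i, 0 <= f i) ->
  \sum_i f i ^+ 2 <= (\sum_i f i) ^+ 2.
Proof.
move=> f0; rewrite expr2 mulr_suml; apply: ler_sum => i _.
rewrite expr2 ler_wpM2l// (bigD1 i)//= lerDl sumr_ge0//.
Qed.

End ExpLnBounds.

Section LogLinear.
Variables (R : realType) (M M0 : nat) (W : 'M[R]_(M, M0)) (th0 : 'cV[R]_M0).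
Hypothesis M_gt0 : (0 < M)%N.

Let A := row_mx W (const_mx 1 : 'M[R]_(M, 1)).
Notation p0 := (pmodel W th0).

Let Sexp (th : 'cV[R]_M0) := \sum_(s < M) expR ((W *m th) s 0) : R.

Let Sexp_gt0 th : 0 < Sexp th.
Proof.
rewrite /Sexp; have i0 : 'I_M := Ordinal M_gt0.
rewrite (bigD1 i0)//= ltr_pwDl ?expR_gt0// sumr_ge0// => i _; exact: expR_ge0.
Qed.

Lemma pmodel_gt0 th r : 0 < pmodel W th r.
Proof. by rewrite divr_gt0 ?expR_gt0 ?Sexp_gt0. Qed.

Lemma pmodel_sum1 th : \sum_r pmodel W th r = 1.
Proof. by rewrite -mulr_suml divff// gt_eqF// Sexp_gt0. Qed.

Lemma row_mx1E (c : 'cV[R]_(M0 + 1)) r :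
  (A *m c) r 0 = (W *m usubmx c) r 0 + (dsubmx c) 0 0.
Proof.
rewrite -[c in LHS]vsubmxK mul_row_col mxE; congr (_ + _).
by rewrite mxE big_ord1 mxE mul1r.
Qed.

(** The coordinate along the constants absorbs the normaliser, so the log-ratio to p0 is exactly
    linear. The upper block is recorded because it lets th be bounded through the tilt. *)
Lemma pmodel_tilt th : exists2 c : 'cV[R]_(M0 + 1), usubmx c = th - th0 &
  forall r, pmodel W th r = p0 r * expR ((A *m c) r 0).
Proof.
exists (col_mx (th - th0) (const_mx (ln (Sexp th0) - ln (Sexp th)))) => [|r].
  by rewrite col_mxKu.
rewrite row_mx1E col_mxKu col_mxKd.
have -> : (W *m (th - th0)) r 0 = (W *m th) r 0 - (W *m th0) r 0 by rewrite mulmxBr !mxE.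
rewrite [X in _ + X]mxE.
rewrite !expRD !expRN !lnK ?posrE//.
rewrite /pmodel -!/(Sexp _); field.
by rewrite !gt_eqF ?expR_gt0.
Qed.

Lemma pmodel_shift (c : 'cV[R]_(M0 + 1)) r :
  pmodel W (th0 + usubmx c) r =
  p0 r * expR ((A *m c) r 0) / \sum_s p0 s * expR ((A *m c) s 0).
Proof.
have E s : p0 s * expR ((A *m c) s 0) = expR ((W *m (th0 + usubmx c)) s 0) * (expR (dsubmx c 0 0) / Sexp th0).
  have -> : (W *m (th0 + usubmx c)) s 0 = (W *m th0) s 0 + (W *m usubmx c) s 0.
    by rewrite mulmxDr [LHS]mxE.
  by rewrite row_mx1E !expRD /pmodel -/(Sexp _); ring.
under eq_bigr do rewrite E.
rewrite -mulr_suml E /pmodel -!/(Sexp _); field.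
by rewrite !gt_eqF ?expR_gt0.
Qed.

End LogLinear.

Section Expansion.
Variables (R : realType) (M M0 : nat) (W : 'M[R]_(M, M0)) (th0 : 'cV[R]_M0).
Hypothesis M_gt0 : (0 < M)%N.
Notation p0 := (pmodel W th0).
Notation A := (row_mx W (const_mx 1 : 'M[R]_(M, 1))).

Definition stdvec (x : 'I_M -> R) : 'cV[R]_M := \col_r (x r / Num.sqrt (p0 r)).

Definition wdesign : 'M[R]_(M, M0 + 1) := \matrix_(i, j) (Num.sqrt (p0 i) * A i j).

Let B := wdesign.

Let p0_gt0 r : 0 < p0 r. Proof. exact: pmodel_gt0. Qed.

Let sq r := Num.sqrt (p0 r).

Let sq_gt0 r : 0 < sq r. Proof. by rewrite sqrtr_gt0. Qed.

Let sq2 r : sq r ^+ 2 = p0 r. Proof. by rewrite sqr_sqrtr// ltW. Qed.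

Lemma wdesignE (c : 'cV[R]_(M0 + 1)) r : (B *m c) r 0 = sq r * (A *m c) r 0.
Proof. by rewrite !mxE mulr_sumr; apply: eq_bigr => j _; rewrite [B _ _]mxE mulrA. Qed.

(** The vector sqrt(p0) thus lies in the column space of [B] and is killed by P. *)
Lemma wdesign_last r : (B *m col_mx (0 : 'cV[R]_M0) (1%:M : 'M[R]_1)) r 0 = sq r.
Proof. by rewrite wdesignE row_mx1E col_mxKu col_mxKd mulmx0 !mxE add0r mulr1. Qed.

Lemma chidistE p q : chidist p0 p q =
  dotv (stdvec (fun r => p r - q r)) (stdvec (fun r => p r - q r)).
Proof.
apply: eq_bigr => r _; rewrite !mxE -/(sq r) -(sq2 r).
by field; rewrite gt_eqF.
Qed.

Variables (P : 'M[R]_M) (G : 'M[R]_(M0 + 1, M)).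
Hypotheses (P_sym : P^T = P) (P_idem : P *m P = P).
Hypotheses (PB : P *m B = 0) (PBG : P + B *m G = 1%:M).

Variable m : R.
Hypothesis m01 : 0 < m <= 1.
Hypothesis mp0 : forall r, m <= p0 r.

(** P removes the linear part B c of the tilt and leaves exp(z) - 1 - z <= 2 z^2 <= 8 (q -
    p0)^2/p0^2; squaring gives 64, and 1/p0 <= 1/m. *)
Lemma tilt_residual (c : 'cV[R]_(M0 + 1)) (q : 'I_M -> R) :
  (forall r, q r = p0 r * expR ((A *m c) r 0)) -> (forall r, `|q r - p0 r| <= p0 r / 4) ->
  dotv (P *m stdvec (fun r => q r - p0 r)) (P *m stdvec (fun r => q r - p0 r))
    <= 64 / m * chidist p0 q p0 ^+ 2.
Proof.
move=> qE q4; set z := fun r => (A *m c) r 0.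
have {}qE r : q r = p0 r * expR (z r) by exact: qE.
pose rho : 'cV[R]_M := \col_r (sq r * (expR (z r) - 1 - z r)).
have -> : stdvec (fun r => q r - p0 r) = B *m c + rho.
  apply/colP => r; rewrite [LHS]mxE [RHS]mxE wdesignE -/(z r) [rho _ _]mxE -/(sq r) qE -(sq2 r).
  by field; rewrite gt_eqF.
rewrite mulmxDr mulmxA PB mul0mx add0r.
apply: (le_trans (dotv_proj_le P_sym P_idem _)).
pose t r := (q r - p0 r) ^+ 2 / p0 r.
have t0 r : 0 <= t r by rewrite divr_ge0 ?sqr_ge0// ltW.
have m0 : 0 < m by case/andP: m01.
apply: (@le_trans _ _ (64 / m * \sum_r t r ^+ 2)); last first.
  by rewrite ler_wpM2l ?sum_sqr_le_sqr_sum// divr_ge0// ltW.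
rewrite /dotv mulr_sumr; apply: ler_sum => r _; rewrite [rho _ _]mxE.
have qp : q r / p0 r - 1 = (q r - p0 r) / p0 r by field; rewrite gt_eqF.
have v4 : `|q r / p0 r - 1| <= 1 / 4.
  rewrite qp normrM normfV (gtr0_norm (p0_gt0 r)) ler_pdivrMr//.
  by apply: le_trans (q4 r) _; lra.
have zE : z r = ln (q r / p0 r) by rewrite qE mulrAC divff ?mul1r ?expRK// gt_eqF.
have zv : `|z r| <= 2 * `|q r / p0 r - 1|.
  by rewrite zE; apply: ln_lipschitz_near1; lra.
have z1 : z r <= 1 / 2 by have := ler_norm (z r); lra.
have /andP[w0 w1] := expR_quadratic_bound z1.
set w := expR (z r) - 1 - z r in w0 w1 *.
have z2 : z r ^+ 2 <= 4 * ((q r - p0 r) ^+ 2 / p0 r ^+ 2).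
  have -> : 4 * ((q r - p0 r) ^+ 2 / p0 r ^+ 2) = (2 * `|q r / p0 r - 1|) ^+ 2.
    by rewrite [RHS]exprMn real_normK ?num_real// qp; field; rewrite gt_eqF.
  rewrite -[leLHS](real_normK (num_real _)) ler_sqr ?nnegrE ?mulr_ge0//.
have w2 : w <= 8 * (t r / p0 r).
  have -> : 8 * (t r / p0 r) = 2 * (4 * ((q r - p0 r) ^+ 2 / p0 r ^+ 2)).
    by rewrite /t; field; rewrite gt_eqF.
  by apply: (le_trans w1); rewrite ler_pM2l.
have -> : sq r * w * (sq r * w) = p0 r * w ^+ 2 by rewrite -sq2; ring.
apply: (@le_trans _ _ (p0 r * (8 * (t r / p0 r)) ^+ 2)).
  by rewrite ler_pM2l// ler_sqr ?nnegrE ?w0 ?(le_trans w0 w2).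
have -> : p0 r * (8 * (t r / p0 r)) ^+ 2 = 64 * t r ^+ 2 / p0 r by field; rewrite gt_eqF.
rewrite mulrAC ler_wpM2r ?sqr_ge0// ler_pM2l// lef_pV2 ?posrE//.
Qed.

(** Tilt by the least-squares coefficients c = G y: the standardised first-order fit is y - P y.
    What remains is P y, plus an error 5 S/m in each cell from the exponential and from the
    normaliser. *)
Lemma tilt_fit (p : 'I_M -> R) : \sum_r p r = 1 -> chidist p0 p p0 <= m / 16 ->
  exists th, (forall e, 0 < e ->
     chidist p0 p (pmodel W th) <=
       (1 + e) * dotv (P *m stdvec (fun r => p r - p0 r)) (P *m stdvec (fun r => p r - p0 r))
       + (1 + e^-1) * (25 / m ^+ 2 * chidist p0 p p0 ^+ 2)) /\
   forall r, (pmodel W th r - p0 r) ^+ 2 <= 9 / m * chidist p0 p p0.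
Proof.
move=> p1 S16; set S := chidist p0 p p0 in S16 *.
have m0 : 0 < m by case/andP: m01.
pose y := stdvec (fun r => p r - p0 r).
pose c := G *m y.
have Bc : B *m c = y - P *m y.
  by apply/eqP; rewrite eq_sym subr_eq addrC mulmxA -mulmxDl PBG mul1mx.
pose z r := (A *m c) r 0.
have sqz r : sq r * z r = (y - P *m y) r 0 by rewrite -wdesignE Bc.
have Sy : S = dotv y y by exact: chidistE.
have nyP : dotv (y - P *m y) (y - P *m y) <= S.
  rewrite -scaleN1r dotv_lineE (dotv_proj P_sym P_idem) Sy.
  by have := dotv_ge0 (P *m y); rewrite (dotv_proj P_sym P_idem); lra.
have z2 r : z r ^+ 2 <= S / m.
  have H1 : p0 r * z r ^+ 2 <= S.
    apply: le_trans nyP; rewrite -sq2 -exprMn sqz /dotv (bigD1 r)//= -expr2 lerDl.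
    by apply: sumr_ge0 => i _; rewrite -expr2 sqr_ge0.
  rewrite ler_pdivlMr//; apply: le_trans H1; rewrite mulrC ler_wpM2r ?sqr_ge0//.
pose ze := S / m.
have ze0 : 0 <= ze by rewrite divr_ge0 ?chidist_ge0// ltW.
have ze5 : 0 <= 5 * ze by rewrite mulr_ge0.
have ze16 : ze <= 1 / 16 by rewrite ler_pdivrMr//; lra.
have z4 r : `|z r| <= 1 / 4.
  by rewrite -ler_sqr ?nnegrE ?divr_ge0// real_normK ?num_real//; have := z2 r; rewrite -/ze; lra.
pose w r := expR (z r) - 1 - z r.
have w02 r : 0 <= w r <= 2 * ze.
  have z1 : z r <= 1 / 2 by have := ler_norm (z r); have := z4 r; lra.
  have /andP[-> H] := expR_quadratic_bound z1.
  by apply: (le_trans H); rewrite ler_pM2l.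
(* Both y, since p and p0 have equal totals, and P y are orthogonal to sqrt(p0). Hence the
   normaliser is 1 + O(S), without a term of order sqrt S. *)
have pz0 : \sum_r p0 r * z r = 0.
  transitivity (dotv (B *m col_mx (0 : 'cV[R]_M0) (1%:M : 'M[R]_1)) (y - P *m y)).
    by apply: eq_bigr => r _; rewrite wdesign_last -sqz mulrA -expr2 sq2.
  have -> : y - P *m y = y + (-1) *: (P *m y) by rewrite scaleN1r.
  rewrite dotvDr dotvZr -{1}P_sym -dotv_mulmxl mulmxA PB mul0mx.
  rewrite {2}/dotv big1 ?mulr0 ?addr0; last by move=> i _; rewrite mxE mul0r.
  transitivity (\sum_r (p r - p0 r)).
    apply: eq_bigr => r _; rewrite wdesign_last mxE -/(sq r).
    by field; rewrite gt_eqF.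
  by rewrite sumrB p1 pmodel_sum1// subrr.
pose Zs := \sum_r p0 r * expR (z r).
have ZsE : Zs = 1 + \sum_r p0 r * w r.
  transitivity (\sum_r p0 r + \sum_r p0 r * z r + \sum_r p0 r * w r); last first.
    by rewrite pmodel_sum1// pz0 addr0.
  rewrite -!big_split/=.
  by apply: eq_bigr => r _; rewrite /w; ring.
have Zs1 : 1 <= Zs.
  by rewrite ZsE lerDl sumr_ge0// => r _; have /andP[? _] := w02 r; rewrite mulr_ge0// ltW.
have Zs2 : Zs <= 1 + 2 * ze.
  rewrite ZsE lerD2l.
  apply: (@le_trans _ _ (\sum_r p0 r * (2 * ze))); last by rewrite -mulr_suml pmodel_sum1// mul1r.
  by apply: ler_sum => r _; rewrite ler_pM2l//; have /andP[] := w02 r.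
have Zs0 : 0 < Zs by apply: lt_le_trans Zs1.
pose th := th0 + usubmx c.
pose q := pmodel W th.
have qE r : q r = p0 r * expR (z r) / Zs by exact: pmodel_shift.
pose v r := q r / p0 r - 1 - z r.
have v5 r : `|v r| <= 5 * ze.
  have -> : v r = (w r - (Zs - 1) * (1 + z r)) / Zs.
    by rewrite /v qE /w; field; rewrite !gt_eqF.
  rewrite normrM normfV (gtr0_norm Zs0) ler_pdivrMr//.
  have /andP[w0 w1] := w02 r; have := z4 r; rewrite ler_norml => /andP[z41 z42].
  have H0 : 0 <= (Zs - 1) * (1 + z r) by rewrite mulr_ge0//; lra.
  have H1 : (Zs - 1) * (1 + z r) <= 2 * ze * (5 / 4) by apply: ler_pM; lra.
  have H2 : 5 * ze <= 5 * ze * Zs by rewrite ler_peMr// mulr_ge0.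
  by rewrite ler_norml; apply/andP; split; lra.
exists th; split=> [e e0|r].
  pose rho : 'cV[R]_M := \col_r (- (sq r * v r)).
  rewrite chidistE (_ : stdvec _ = P *m y + rho); last first.
    have -> : P *m y = y - B *m c by rewrite Bc subKr.
    apply/colP => r; rewrite [LHS]mxE [RHS]mxE [rho _ _]mxE [X in _ = X + _]mxE [y _ _]mxE.
    rewrite [X in _ + X + _]mxE wdesignE -/(z r) -/(sq r) /v -/(q r) -(sq2 r).
    by field; rewrite gt_eqF.
  apply: (le_trans (dotvD_le _ _ e0)); rewrite lerD2l ler_wpM2l//.
    by rewrite addr_ge0// invr_ge0 ltW.
  have -> : 25 / m ^+ 2 * S ^+ 2 = (5 * ze) ^+ 2 by rewrite /ze; field; rewrite gt_eqF.
  rewrite -[leRHS]mul1r -[X in X * _](pmodel_sum1 W M_gt0 th0) mulr_suml.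
  apply: ler_sum => r _; rewrite !mxE.
  have -> : - (sq r * v r) * - (sq r * v r) = p0 r * v r ^+ 2 by rewrite -sq2; ring.
  by rewrite ler_pM2l// -[leLHS](real_normK (num_real _)) ler_sqr ?nnegrE ?ze5 ?normr_ge0 ?v5.
have -> : pmodel W th r - p0 r = p0 r * (z r + v r).
  by rewrite /v -/(q r); field; rewrite gt_eqF.
have pr1 : p0 r <= 1.
  rewrite -[leRHS](pmodel_sum1 W M_gt0 th0) (bigD1 r)//= lerDl sumr_ge0// => i _; exact: ltW.
have -> : 9 / m * S = 9 * ze by rewrite /ze; field; rewrite gt_eqF.
rewrite exprMn; apply: (@le_trans _ _ (1 * (z r + v r) ^+ 2)).
  by rewrite ler_wpM2r ?sqr_ge0// expr_le1// ltW.
rewrite mul1r.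
have H1 := z2 r; rewrite -/ze in H1.
have H2 : v r ^+ 2 <= (5 * ze) ^+ 2.
  by rewrite -[leLHS](real_normK (num_real _)) ler_sqr ?nnegrE ?ze5 ?normr_ge0 ?v5.
have := sqr_ge0 (z r - v r); nra.
Qed.

End Expansion.

(** Arithmetic with S = |y|^2, Q = |P y|^2, D the distance from p to the minimising model point and
    X the normalised phi1-divergence. The first two inequalities give |D - Q| <= 20 d S; the 30
    leaves room for |X - D| <= 2 d S. *)
Lemma squeeze_quadratic (R : realType) (d e S D Q X : R) :
  0 < d -> d <= 1 / 10 -> d <= e / 30 -> 0 <= S -> 0 <= D -> D <= 2 * S ->
  0 <= Q -> Q <= S -> (1 - d) * D <= (1 + d) * ((1 + d) * Q + d * S) ->
  Q <= (1 + d) * D + d * S -> `|X - D| <= d * D -> `|X - Q| <= e * S.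
Proof.
move=> d0 d10 de S0 D0 DS Q0 QS Du Ql HX.
have QD : `|D - Q| <= 20 * d * S by rewrite ler_norml; apply/andP; split; nra.
rewrite (_ : X - Q = (X - D) + (D - Q)); last by ring.
apply: (le_trans (ler_normD _ _)).
have H1 : d * D <= 2 * d * S by nra.
have H2 : 30 * d * S <= e * S by rewrite ler_wpM2r//; lra.
have H3 : 0 <= d * S by rewrite mulr_ge0// ltW.
lra.
Qed.

Section MinimumDivergence.
Variables (R : realType) (M M0 : nat) (W : 'M[R]_(M, M0)) (th0 : 'cV[R]_M0).
Hypothesis M_gt0 : (0 < M)%N.
Hypothesis W_rank : \rank (row_mx W (const_mx 1 : 'M[R]_(M, 1))) = M0.+1.
Notation p0 := (pmodel W th0).
Notation A := (row_mx W (const_mx 1 : 'M[R]_(M, 1))).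
Notation B := (wdesign W th0).

Let p0_gt0 r : 0 < p0 r. Proof. exact: pmodel_gt0. Qed.

Variables (P : 'M[R]_M) (G : 'M[R]_(M0 + 1, M)).
Hypotheses (P_sym : P^T = P) (P_idem : P *m P = P).
Hypotheses (PB : P *m B = 0) (PBG : P + B *m G = 1%:M).

Definition minimizes (phi : R -> R) (p : 'I_M -> R) (th : 'cV[R]_M0) : Prop :=
  forall th', phidiv phi p (pmodel W th) <= phidiv phi p (pmodel W th').

Lemma pmodel_lt1 th r : pmodel W th r <= 1.
Proof.
rewrite -(pmodel_sum1 W M_gt0 th) (bigD1 r)//= lerDl sumr_ge0// => i _.
by rewrite ltW// pmodel_gt0.
Qed.

Lemma sqr_le_chidist p q r : (p r - q r) ^+ 2 <= chidist p0 p q.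
Proof.
have H : (p r - q r) ^+ 2 / p0 r <= chidist p0 p q.
  rewrite /chidist (bigD1 r)//= lerDl sumr_ge0// => i _.
  by rewrite divr_ge0 ?sqr_ge0// ltW.
apply: le_trans H; rewrite ler_peMr ?sqr_ge0// -[leLHS]invr1 lef_pV2 ?posrE//.
exact: pmodel_lt1.
Qed.

(** Parameters are transposed to rows to fit [rV_compact] and [EVT_min_rV]. *)
Lemma pmodel_continuous r : continuous (fun v : 'rV[R]_M0 => pmodel W v^T r).
Proof.
have c1 s : continuous (fun v : 'rV[R]_M0 => expR ((W *m v^T) s 0)).
  move=> v; apply: continuous_comp; last exact: continuous_expR.
  have -> : (fun v : 'rV[R]_M0 => (W *m v^T) s 0) = (fun v => \sum_j W s j * v 0 j).
    by apply/funext => u; rewrite mxE; apply: eq_bigr => j _; rewrite mxE.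
  apply: cvg_big => //; [exact: add_continuous|exact: nbhs_filter|].
  move=> j _; apply: (@cvgM _ _ (nbhs v) _ (fun=> W s j) (fun u : 'rV[R]_M0 => u 0 j)).
    exact: cvg_cst.
  exact: coord_continuous.
move=> v; apply: (@cvgM _ _ (nbhs v) _); first exact: c1.
apply: (@cvgV _ _ (nbhs v) _); last first.
  apply: cvg_big => //; [exact: add_continuous|move=> s _; exact: c1].
have := pmodel_gt0 W M_gt0 v^T r; rewrite /pmodel.
by case: eqP => // ->; rewrite invr0 mulr0 ltxx.
Qed.

Lemma phidiv_continuous phi p : admissible phi -> (forall r, 0 < p r) ->
  continuous (fun v : 'rV[R]_M0 => phidiv phi p (pmodel W v^T)).
Proof.
move=> adm p_gt0 v; apply: cvg_big => //; [exact: add_continuous|exact: nbhs_filter|].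
move=> r _; apply: (@cvgM _ _ (nbhs v) _); first exact: pmodel_continuous.
have q0 := pmodel_gt0 W M_gt0 v^T r.
have c : p r / pmodel W u^T r @[u --> nbhs v] --> p r / pmodel W v^T r.
  apply: (@cvgM _ _ (nbhs v) _); first exact: cvg_cst.
  by apply: (@cvgV _ _ (nbhs v) _); [rewrite gt_eqF|exact: pmodel_continuous].
apply: (continuous_cvg _ _ c); exact: (phi_continuous adm (divr_gt0 (p_gt0 r) q0)).
Qed.

(* On the sublevel set of th0, z = ln(p(th)/p0) is bounded, and th - th0 is a
   linear function of z: the sublevel set lies in a compact box. *)
Lemma exists_minimizer phi p : admissible phi -> (forall r, 0 < p r) ->
  (forall th, phidiv phi p (pmodel W th) <= phidiv phi p p0 ->
     forall r, `|pmodel W th r - p0 r| <= p0 r / 4) ->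
  exists th, minimizes phi p th.
Proof.
move=> adm p_gt0 Hsub.
have /row_freeP[X AX] : row_free A^T by rewrite /row_free mxrank_tr W_rank addn1.
have XA : X^T *m A = 1%:M by rewrite -trmx1 -AX trmx_mul trmxK.
(* |ln v| <= 1/2 whenever |v - 1| <= 1/4, and c = X^T (A c). Summing over all rows gives one radius
   for all coordinates. *)
pose L := \sum_(i < M0 + 1) \sum_(j < M) `|X^T i j| * (1 / 2).
have bound th : phidiv phi p (pmodel W th) <= phidiv phi p p0 ->
    forall j, `|th j 0 - th0 j 0| <= L.
  move=> /Hsub Hq j; have [c cE qE] := pmodel_tilt W th0 M_gt0 th.
  have -> : th j 0 - th0 j 0 = c (lshift 1 j) 0.
    by have := congr1 (fun u : 'cV[R]_M0 => u j 0) cE; rewrite !mxE.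
  have -> : c = X^T *m (A *m c) by rewrite mulmxA XA mul1mx.
  rewrite mxE; apply: (le_trans (ler_norm_sum _ _ _)).
  rewrite /L (bigD1 (lshift 1 j))//= -[leLHS]addr0 lerD//; last first.
    by apply: sumr_ge0 => i _; apply: sumr_ge0 => k _; rewrite mulr_ge0.
  apply: ler_sum => i _; rewrite normrM ler_wpM2l//.
  have qi : pmodel W th i / p0 i = expR ((A *m c) i 0) by rewrite qE mulrAC divff ?mul1r// gt_eqF.
  have v4 : `|pmodel W th i / p0 i - 1| <= 1 / 4.
    have -> : pmodel W th i / p0 i - 1 = (pmodel W th i - p0 i) / p0 i by field; rewrite gt_eqF.
    rewrite normrM normfV (gtr0_norm (p0_gt0 i)) ler_pdivrMr//.
    by apply: le_trans (Hq i) _; rewrite mulrC mul1r.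
  rewrite -[X in `|X|]expRK -qi; apply: (le_trans (ln_lipschitz_near1 _)); lra.
have L0 : 0 <= L by apply: sumr_ge0 => i _; apply: sumr_ge0 => j _; rewrite mulr_ge0.
pose K := [set v : 'rV[R]_M0 | forall j, `[th0 j 0 - L, th0 j 0 + L]%classic (v ord0 j)].
have cK : compact K.
  by apply: (@rV_compact _ _ (fun j => `[th0 j 0 - L, th0 j 0 + L]%classic)) => j; exact: segment_compact.
have K0 : K th0^T by move=> j; rewrite mxE /= in_itv/=; apply/andP; split; lra.
have [v Kv Hv] : exists2 v, v \in K & forall u, u \in K ->
    phidiv phi p (pmodel W v^T) <= phidiv phi p (pmodel W u^T).
  apply: EVT_min_rV => //; first by exists th0^T.
  by apply: continuous_subspaceT; exact: phidiv_continuous.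
exists v^T => th'.
have vth0 : phidiv phi p (pmodel W v^T) <= phidiv phi p p0.
  by rewrite -[th0]trmxK; apply: Hv; rewrite inE.
have [H|/ltW H] := leP (phidiv phi p (pmodel W th')) (phidiv phi p p0); last exact: le_trans H.
rewrite -[th']trmxK; apply: Hv; rewrite inE => j; rewrite mxE /= in_itv/=.
by have := bound _ H j; rewrite ler_norml => /andP[]; lra.
Qed.

(* Lower bound: P kills the tangent part of p(th) - p0.  Upper bound: compare
   with the tilt fitted to the complementary part of p - p0. *)
Lemma minimum_divergence_expansion phi1 phi2 : admissible phi1 -> admissible phi2 ->
  forall e, 0 < e -> exists2 h, 0 < h &
  forall p, \sum_r p r = 1 -> chidist p0 p p0 <= h ->
  [/\ forall r, 0 < p r, exists th, minimizes phi2 p th &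
    forall th, minimizes phi2 p th ->
     `|2 / phi2nd phi1 1 * phidiv phi1 p (pmodel W th)
        - dotv (P *m stdvec W th0 (fun r => p r - p0 r)) (P *m stdvec W th0 (fun r => p r - p0 r))|
       <= e * chidist p0 p p0 /\ forall r, `|pmodel W th r - p0 r| <= e * p0 r].
Proof.
move=> adm1 adm2 e e0.
have [m m01 mp0] := ex_pos_lbound p0_gt0; have /andP[m0 m1] := m01.
pose d := Num.min (1 / 10) (e / 30).
have d0 : 0 < d by rewrite lt_min !divr_gt0.
have d10 : d <= 1 / 10 by rewrite ge_min lexx.
have de : d <= e / 30 by rewrite ge_min lexx orbT.
clearbody d.
have [h1 h10 H1] := phidiv_local p0_gt0 adm1 d0.
have [h2 h20 H2] := phidiv_local p0_gt0 adm2 d0.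
pose t := Num.min (Num.min h1 h2) (Num.min (m / 4) (e * m)).
have t0 : 0 < t by rewrite !lt_min h10 h20 divr_gt0// mulr_gt0.
have [th1 th2] : t <= h1 /\ t <= h2 by split; rewrite !ge_min lexx ?orbT.
have [tm te] : t <= m / 4 /\ t <= e * m by split; rewrite !ge_min lexx ?orbT.
clearbody t.
have t4 : 0 < t / 4 by rewrite divr_gt0.
have [ka ka0 Hka] := phidiv_dist M adm2 t4.
have c20 : 0 < phi2nd phi2 1 by case: adm2.
set c2 := phi2nd phi2 1 in c20 H2.
(* The coefficients of S^2 from [tilt_fit] and from [tilt_residual]; 36 is the square of 6 in
   chidist p0 q p0 <= 2 D + 2 S <= 6 S. *)
pose C := (1 + d^-1) * (25 / m ^+ 2) + (1 + d^-1) * (64 / m * 36).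
have dV : 0 < 1 + d^-1 by rewrite addr_gt0 ?invr_gt0.
have C1 : 0 < 25 / m ^+ 2 by rewrite divr_gt0// exprn_gt0.
have C2 : 0 < 64 / m by rewrite divr_gt0.
have C0 : 0 < C by apply: addr_gt0; apply: mulr_gt0 => //; exact: mulr_gt0.
(* In order: p is within t/4 of p0; the fitted tilt is within t of p0; [tilt_fit] applies; C S^2 <=
   d S; the divergence at th0 is small enough to localise the minimiser. *)
pose h := Num.min (Num.min (t ^+ 2 / 16) (m * t ^+ 2 / 9)) (Num.min (m / 16) (Num.min (d / C) (ka * t / (4 * c2)))).
have h0 : 0 < h by rewrite !lt_min !divr_gt0 ?mulr_gt0 ?exprn_gt0.
exists h => // p p1 Sh; set S := chidist p0 p p0 in Sh *.
have S0 : 0 <= S by apply: chidist_ge0.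
have Sa : S <= t ^+ 2 / 16 by apply: (le_trans Sh); rewrite !ge_min lexx.
have Sb : S <= m * t ^+ 2 / 9 by apply: (le_trans Sh); rewrite !ge_min lexx ?orbT.
have Sc : S <= m / 16 by apply: (le_trans Sh); rewrite !ge_min lexx ?orbT.
have Sd : S <= d / C by apply: (le_trans Sh); rewrite !ge_min lexx ?orbT.
have Se : S <= ka * t / (4 * c2) by apply: (le_trans Sh); rewrite !ge_min lexx ?orbT.
clear Sh; clearbody h.
have pt4 r : `|p r - p0 r| <= t / 4.
  rewrite -ler_sqr ?nnegrE ?(ltW t4)// real_normK ?num_real//.
  apply: (le_trans (sqr_le_chidist p p0 r)); apply: (le_trans Sa).
  by rewrite le_eqVlt; apply/orP; left; apply/eqP; field.
have pt r : `|p r - p0 r| <= t by apply: (le_trans (pt4 r)); lra.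
have pp r : 0 < p r.
  have := pt r; rewrite ler_norml => /andP[H _].
  by have := mp0 r; lra.
have p0t r : `|p0 r - p0 r| <= t by rewrite subrr normr0 ltW.
have loc2 q : (forall r, `|q r - p0 r| <= t) ->
    (1 - d) * chidist p0 p q <= 2 / c2 * phidiv phi2 p q <= (1 + d) * chidist p0 p q.
  move=> qt; have := H2 p q (fun r => le_trans (pt r) th2) (fun r => le_trans (qt r) th2).
  by rewrite ler_norml => /andP[? ?]; apply/andP; split; lra.
(* A parameter no worse than th0 has divergence at most c2 S <= ka t/4, so [phidiv_dist] puts its
   model point within t/2 of p in l1. No prior consistency of the minimiser is needed. *)
have near_model th : phidiv phi2 p (pmodel W th) <= phidiv phi2 p p0 ->
    forall r, `|pmodel W th r - p0 r| <= t.
  move=> Hth r; have Hk := Hka p (pmodel W th) pp (pmodel_gt0 W M_gt0 th) (pmodel_sum1 W M_gt0 th).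
  have /andP[_ Hp0] := loc2 p0 p0t; rewrite -/S in Hp0.
  have Hp : phidiv phi2 p p0 <= c2 * S.
    have -> : phidiv phi2 p p0 = c2 / 2 * (2 / c2 * phidiv phi2 p p0) by field; rewrite gt_eqF.
    apply: (@le_trans _ _ (c2 / 2 * (2 * S))); last by rewrite le_eqVlt; apply/orP; left; apply/eqP; field.
    rewrite ler_pM2l ?divr_gt0//; apply: (le_trans Hp0); rewrite ler_wpM2r//; lra.
  have Hs : c2 * S <= ka * (t / 4).
    have -> : ka * (t / 4) = c2 * (ka * t / (4 * c2)) by field; rewrite gt_eqF.
    by rewrite ler_pM2l.
  have := le_trans Hk (le_trans Hth (le_trans Hp Hs)); rewrite ler_pM2l// => Hsum.
  have Hr : `|p r - pmodel W th r| <= \sum_r `|p r - pmodel W th r|.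
    by rewrite (bigD1 r)//= lerDl sumr_ge0.
  have -> : pmodel W th r - p0 r = (p r - p0 r) - (p r - pmodel W th r) by ring.
  by apply: (le_trans (ler_normB _ _)); have := pt4 r; lra.
split=> //.
  apply: exists_minimizer => // th Hth r.
  by apply: (le_trans (near_model th Hth r)); apply: (le_trans tm); rewrite ler_pM2r.
move=> th Hmin.
have qt := near_model th (Hmin th0).
split; last first.
  by move=> r; apply: (le_trans (qt r)); apply: (le_trans te); rewrite ler_pM2l.
set y := stdvec _ _ _; set Q := dotv _ _; set q := pmodel W th in qt *.
set D := chidist p0 p q.
have D0 : 0 <= D by apply: chidist_ge0.
have /andP[Lq _] := loc2 q qt.
(* Comparison with th0 itself; this crude bound makes the later remainders O(S^2). *)
have DS : D <= 2 * S.
  have /andP[_ Hp0] := loc2 p0 p0t; rewrite -/S in Hp0.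
  have H : (1 - d) * D <= (1 + d) * S.
    apply: (le_trans Lq); apply: le_trans Hp0.
    by rewrite ler_pM2l ?divr_gt0//; exact: Hmin.
  nra.
have [ths [Hfit1 Hfit2]] := tilt_fit M_gt0 P_sym P_idem PB PBG m01 mp0 p1 Sc.
have {}Hfit1 := Hfit1 d d0.
have qst r : `|pmodel W ths r - p0 r| <= t.
  rewrite -ler_sqr ?nnegrE ?(ltW t0)// real_normK ?num_real//.
  apply: (le_trans (Hfit2 r)).
  have -> : t ^+ 2 = 9 / m * (m * t ^+ 2 / 9) by field; rewrite gt_eqF.
  by rewrite ler_wpM2l// divr_ge0// ltW.
have CS : C * S <= d by rewrite mulrC -ler_pdivlMr.
have QS : Q <= S by rewrite /S (chidistE W th0 M_gt0); exact: dotv_proj_le.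
have Q0 : 0 <= Q by exact: dotv_ge0.
have Du : (1 - d) * D <= (1 + d) * ((1 + d) * Q + d * S).
  have /andP[_ Hs] := loc2 _ qst.
  apply: (le_trans Lq); apply: (@le_trans _ _ (2 / c2 * phidiv phi2 p (pmodel W ths))).
    by rewrite ler_pM2l ?divr_gt0//; exact: Hmin.
  apply: (le_trans Hs); rewrite ler_pM2l ?addr_gt0//; apply: (le_trans Hfit1).
  rewrite lerD2l -/S.
  apply: (@le_trans _ _ (C * S * S)); last by rewrite ler_wpM2r.
  rewrite /C; have -> : (1 + d^-1) * (25 / m ^+ 2 * S ^+ 2) = (1 + d^-1) * (25 / m ^+ 2) * S * S by ring.
  by rewrite ler_wpM2r// ler_wpM2r// lerDl ltW// !mulr_gt0 ?invr_gt0.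
have Sq : chidist p0 q p0 <= 6 * S.
  by have := chidist_triangle p0_gt0 p q p0; rewrite -/D -/S; lra.
have Ql : Q <= (1 + d) * D + d * S.
  have yE : y = stdvec W th0 (fun r => p r - q r) + stdvec W th0 (fun r => q r - p0 r).
    by apply/colP => r; rewrite !mxE -mulrDl; congr (_ / _); ring.
  rewrite /Q yE mulmxDr; apply: (le_trans (dotvD_le _ _ d0)); apply: lerD.
    by rewrite ler_pM2l ?addr_gt0// /D (chidistE W th0 M_gt0); exact: dotv_proj_le.
  have [c _ qE] := pmodel_tilt W th0 M_gt0 th.
  have Hres := tilt_residual M_gt0 P_sym P_idem PB m01 mp0 qE
    (fun r => le_trans (qt r) (le_trans tm (_ : m / 4 <= p0 r / 4))).
  apply: (le_trans (ler_wpM2l (ltW dV) (Hres _))).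
    by move=> r; rewrite ler_pM2r.
  apply: (@le_trans _ _ ((1 + d^-1) * (64 / m * (6 * S) ^+ 2))).
    rewrite ler_pM2l// ler_pM2l// ler_sqr ?nnegrE ?mulr_ge0//.
    by apply: chidist_ge0.
  have -> : (1 + d^-1) * (64 / m * (6 * S) ^+ 2) = (1 + d^-1) * (64 / m * 36) * S * S by ring.
  apply: (@le_trans _ _ (C * S * S)); last by rewrite ler_wpM2r.
  by rewrite ler_wpM2r// ler_wpM2r// lerDr ltW// mulr_gt0.
have := H1 p q (fun r => le_trans (pt r) th1) (fun r => le_trans (qt r) th1).
rewrite -/D => HX; exact: (squeeze_quadratic d0 d10 de S0 D0 DS Q0 QS Du Ql HX).
Qed.

End MinimumDivergence.

(** * Sampling clusters *)

Section FiniteLaw.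
Variables (R : realType) (d : measure_display) (T : measurableType d) (P : probability T R).
Variables (A : finType) (Z : nat -> T -> A).
Hypothesis mZ : forall l a, measurable (Z l @^-1` [set a]).

Lemma probability_partition (l : nat) (X : set T) : measurable X ->
  P X = (\sum_a P (X `&` Z l @^-1` [set a]))%E.
Proof.
move=> mX.
have XE : X = \bigcup_(a in [set: A]) (X `&` Z l @^-1` [set a]).
  by apply/seteqP; split => [w Xw|w [a _ []//]]; exists (Z l w).
rewrite {1}XE measure_fin_bigcup.
- have -> : [set: A] = [set` index_enum A] by apply/seteqP; split => a //= _; rewrite mem_index_enum.
  by rewrite -fsbig_seq ?index_enum_uniq.
- exact: finite_finset.
- by move=> a b _ _ [w [[_ <-] [_ <-]]].
- by move=> a _; exact: measurableI.
Qed.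

Definition lawpmf (a : A) : R := fine (P (Z 0%N @^-1` [set a])).

Lemma lawpmfE a : P (Z 0%N @^-1` [set a]) = (lawpmf a)%:E.
Proof. by rewrite fineK// fin_num_measure. Qed.

Lemma lawpmf_ge0 a : 0 <= lawpmf a.
Proof. exact: fine_ge0. Qed.

Lemma lawpmf_sum1 : \sum_a lawpmf a = 1.
Proof.
apply: EFin_inj; rewrite -(@probability_setT _ _ _ P) (probability_partition 0 measurableT) -sumEFin.
by apply: eq_bigr => a _; rewrite -lawpmfE setTI.
Qed.

Lemma law_integral (g : A -> R) :
  (\int[P]_w (g (Z 0%N w))%:E = (\sum_a lawpmf a * g a)%:E)%E.
Proof.
have E w : (g (Z 0%N w))%:E = (\sum_a (g a)%:E * (\1_(Z 0%N @^-1` [set a]) w)%:E)%E.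
  rewrite (bigD1 (Z 0%N w))//= big1 ?adde0; last first.
    by move=> a /eqP aZ; rewrite indicE memNset ?mule0//= => Za; apply: aZ; rewrite Za.
  by rewrite indicE mem_set// mule1.
under eq_integral do rewrite E.
have int_a a : P.-integrable setT (fun w => (\1_(Z 0%N @^-1` [set a]) w)%:E).
  exact: integrable_indic.
rewrite integral_sum//; last by move=> a; exact: integrableZl.
rewrite -sumEFin; apply: eq_bigr => a _.
by rewrite integralZl// integral_indic// setIT [X in (_ * X)%E]lawpmfE -EFinM mulrC.
Qed.

Definition window (m N : nat) (w : T) : seq A := [seq Z l w | l <- iota m N].

Lemma measurable_window (m N : nat) (Q : pred (seq A)) : measurable [set w | Q (window m N w)].
Proof.
elim: N m Q => [|N IH] m Q.
  rewrite /window /=; case: (Q [::]); first by rewrite (_ : [set _ | _] = setT)//; apply/seteqP.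
  by rewrite (_ : [set _ | _] = set0)//; apply/seteqP; split.
rewrite (_ : [set _ | _] = \bigcup_(a in [set: A]) (Z m @^-1` [set a] `&` [set w | Q (a :: window m.+1 N w)])).
  apply: fin_bigcup_measurable; first exact: finite_finset.
  by move=> a _; apply: measurableI => //; exact: (IH _ (fun s => Q (a :: s))).
by apply/seteqP; split => [w Qw|w [a _ [/= <-]]//]; exists (Z m w).
Qed.

Hypothesis Z_indep : forall (s : seq nat) (F : nat -> set A), uniq s ->
  P (\bigcap_(l in [set` s]) (Z l @^-1` F l)) = (\prod_(l <- s) P (Z l @^-1` F l))%E.
Hypothesis Z_idd : forall (l : nat) (F : set A), P (Z l @^-1` F) = P (Z 0%N @^-1` F).

Lemma probability_prefix (s : seq A) :
  P [set w | window 0 (size s) w == s] = (\prod_(a <- s) lawpmf a)%:E.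
Proof.
(* A nonempty s supplies the default value for [nth]. *)
have [->|[a0 _]] : s = [::] \/ exists a, a \in s.
  by case: s => [|a s]; [left|right; exists a; rewrite inE eqxx].
  rewrite big_nil (_ : [set _ | _] = setT) ?probability_setT//; exact/seteqP.
rewrite (_ : [set _ | _] = \bigcap_(l in [set` iota 0 (size s)]) (Z l @^-1` [set nth a0 s l])).
  rewrite (Z_indep (fun l => [set nth a0 s l]) (iota_uniq _ _)).
  rewrite (big_nth a0) -prodEFin /index_iota subn0; apply: eq_bigr => l _.
  by rewrite (Z_idd _ [set nth a0 s l]) lawpmfE.
apply/seteqP; split => w /=.
  move=> /eqP ws l /=; rewrite mem_iota/= add0n => ls.
  by rewrite -[in RHS]ws (nth_map 0%N) ?size_iota// nth_iota.
move=> H; apply/eqP; apply: (@eq_from_nth _ a0); rewrite ?size_map ?size_iota// => l ls.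
by rewrite (nth_map 0%N) ?size_iota// nth_iota// add0n; apply: H; rewrite /= mem_iota.
Qed.

(* Carrying the observed prefix s lets the induction on N release one draw at a
   time. *)
Lemma probability_prefix_window (N : nat) (s : seq A) (Q : pred (seq A)) :
  P ([set w | window 0 (size s) w == s] `&` [set w | Q (window (size s) N w)])
  = ((\prod_(a <- s) lawpmf a) * iidE lawpmf N (fun s' => (Q s')%:R))%:E.
Proof.
elim: N s Q => [|N IH] s Q.
  rewrite /window /=; case: (Q [::]) => /=; last by rewrite (_ : _ `&` _ = set0) ?measure0 ?mulr0//; apply/seteqP; split => w [].
  by rewrite (_ : [set w | true] = setT) ?setIT ?probability_prefix ?mulr1//; apply/seteqP.
rewrite (probability_partition (size s)); last first.
  apply: measurableI; first exact: (measurable_window 0 (size s) (fun u => u == s)).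
  exact: (measurable_window _ N.+1).
rewrite [iidE _ N.+1 _]/= mulr_sumr -sumEFin; apply: eq_bigr => a _.
have := IH (rcons s a) (fun u => Q (a :: u)).
rewrite big_rcons/= mulrA => <-; congr (P _).
have wE w : window 0 (size (rcons s a)) w = rcons (window 0 (size s) w) (Z (size s) w).
  by rewrite size_rcons /window -[(size s).+1]addn1 iotaD map_cat cats1.
apply/seteqP; split => w /=; rewrite wE size_rcons.
  by move=> [[/eqP -> Qw] wa]; rewrite wa eqxx; split => //; rewrite -wa.
by move=> [/eqP/rcons_inj[-> wa] Qw]; rewrite eqxx; split => //; split => //; move: Qw; rewrite -wa.
Qed.

Lemma probability_window (N : nat) (Q : pred (seq A)) :
  P [set w | Q (window 0 N w)] = (iidE lawpmf N (fun s => (Q s)%:R))%:E.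
Proof.
have := probability_prefix_window N [::] Q; rewrite big_nil mul1r => <-.
by rewrite (_ : [set w | window 0 (size [::]) w == [::]] = setT) ?setTI//; apply/seteqP.
Qed.

End FiniteLaw.

Section Sampling.
Variables (R : realType) (M M0 n : nat) (W : 'M[R]_(M, M0)) (th0 : 'cV[R]_M0).
Hypotheses (M_gt0 : (0 < M)%N) (n_gt0 : (0 < n)%N).
Notation p0 := (pmodel W th0).
Notation B := (wdesign W th0).
Variables (A : finType) (mu : A -> R) (cnt : A -> 'I_M -> nat) (vt : R).
Hypothesis mu_ge0 : forall a, 0 <= mu a.
Hypothesis mu_sum1 : \sum_a mu a = 1.
Hypothesis vt_gt0 : 0 < vt.
Hypothesis cnt_mean : forall r, \sum_a mu a * (cnt a r)%:R = n%:R * p0 r.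
Hypothesis cnt_cov : forall r s,
  \sum_a mu a * (((cnt a r)%:R - n%:R * p0 r) * ((cnt a s)%:R - n%:R * p0 s))
  = vt * n%:R * Sigma p0 r s.

Let p0_gt0 r : 0 < p0 r. Proof. exact: pmodel_gt0. Qed.

Let sq r := Num.sqrt (p0 r).

Let sq_gt0 r : 0 < sq r. Proof. by rewrite sqrtr_gt0. Qed.

Let sq2 r : sq r ^+ 2 = p0 r. Proof. by rewrite sqr_sqrtr// ltW. Qed.

Let n0 : n%:R != 0 :> R. Proof. by rewrite pnatr_eq0 -lt0n. Qed.

Definition obsvec (a : A) : 'cV[R]_M :=
  stdvec W th0 (fun r => (cnt a r)%:R / n%:R - p0 r).

(** The vector sqrt(p0), given as an element of the column space of [B] so that P B = 0 kills it at
    once. *)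
Definition sqrtvec : 'cV[R]_M := B *m col_mx (0 : 'cV[R]_M0) (1%:M : 'M[R]_1).

Lemma sqrtvecE r : sqrtvec r 0 = sq r.
Proof. exact: wdesign_last. Qed.

Lemma obsvecE a r : obsvec a r 0 = ((cnt a r)%:R - n%:R * p0 r) / (n%:R * sq r).
Proof. by rewrite mxE -/(sq r); field; rewrite n0 gt_eqF. Qed.

Lemma obsvec_mean r : \sum_a mu a * obsvec a r 0 = 0.
Proof.
transitivity ((\sum_a mu a * (cnt a r)%:R - n%:R * p0 r * \sum_a mu a) / (n%:R * sq r)).
  rewrite mulr_sumr -sumrB mulr_suml; apply: eq_bigr => a _.
  by rewrite obsvecE; ring.
by rewrite cnt_mean mu_sum1 mulr1 subrr mul0r.
Qed.

Lemma obsvec_cov i j :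
  \sum_a mu a * (obsvec a i 0 * obsvec a j 0) = vt / n%:R * ((i == j)%:R - sq i * sq j).
Proof.
transitivity ((\sum_a mu a * (((cnt a i)%:R - n%:R * p0 i) * ((cnt a j)%:R - n%:R * p0 j)))
   / (n%:R ^+ 2 * sq i * sq j)).
  rewrite mulr_suml; apply: eq_bigr => a _.
  by rewrite !obsvecE; field; rewrite n0 !gt_eqF.
rewrite cnt_cov /Sigma; have [->|ij] := eqVneq i j.
  by rewrite -!sq2; field; rewrite n0 !gt_eqF.
by rewrite /= mulr0n -!sq2; field; rewrite n0 !gt_eqF.
Qed.

Lemma dotv_mulE (u v : 'cV[R]_M) (Qm : 'M[R]_M) :
  dotv u (Qm *m v) = \sum_i \sum_j Qm i j * (u i 0 * v j 0).
Proof.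
apply: eq_bigr => i _; rewrite mxE mulr_sumr; apply: eq_bigr => j _; ring.
Qed.

(** The trace of Qm against the covariance vt/n (1 - s s^T), s = sqrt(p0). It is used with Qm = 1, v
    v^T and the projection. *)
Lemma obsvec_quad (Qm : 'M[R]_M) :
  \sum_a mu a * dotv (obsvec a) (Qm *m obsvec a)
  = vt / n%:R * (\tr Qm - dotv sqrtvec (Qm *m sqrtvec)).
Proof.
transitivity (\sum_i \sum_j Qm i j * \sum_a mu a * (obsvec a i 0 * obsvec a j 0)).
  under eq_bigr do rewrite dotv_mulE mulr_sumr.
  rewrite exchange_big/=; apply: eq_bigr => i _.
  under eq_bigr do rewrite mulr_sumr.
  rewrite exchange_big/=; apply: eq_bigr => j _.
  by rewrite mulr_sumr; apply: eq_bigr => a _; rewrite mulrCA.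
rewrite dotv_mulE /mxtrace -sumrB mulr_sumr; apply: eq_bigr => i _.
under eq_bigr do rewrite obsvec_cov -!sqrtvecE.
transitivity (\sum_j (vt / n%:R * (Qm i j * (i == j)%:R) - vt / n%:R * (Qm i j * (sqrtvec i 0 * sqrtvec j 0)))).
  by apply: eq_bigr => j _; ring.
rewrite sumrB -!mulr_sumr mulrBr; congr (_ * _ - _).
rewrite (bigD1 i)//= eqxx mulr1 big1 ?addr0// => j /negbTE ji.
by rewrite eq_sym ji mulr0.
Qed.

Lemma sqrtvec_norm : dotv sqrtvec sqrtvec = 1.
Proof.
rewrite -(pmodel_sum1 W M_gt0 th0); apply: eq_bigr => r _.
by rewrite !sqrtvecE -expr2 sq2.
Qed.

Lemma obsvec_dot_sqr v :
  \sum_a mu a * dotv v (obsvec a) ^+ 2 = vt / n%:R * (dotv v v - dotv v sqrtvec ^+ 2).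
Proof.
have outer w : dotv w ((v *m v^T) *m w) = dotv v w ^+ 2.
  have -> : (v *m v^T) *m w = dotv v w *: v.
    by apply/colP => i; rewrite -mulmxA mxE big_ord1 -dotvE mxE mulrC.
  by rewrite dotvZr (dotvC w).
have E a : dotv v (obsvec a) ^+ 2 = dotv (obsvec a) ((v *m v^T) *m obsvec a).
  by rewrite outer.
under eq_bigr do rewrite E.
rewrite obsvec_quad; congr (_ * (_ - _)).
  by rewrite mxtrace_mulC /mxtrace big_ord1 dotvE.
by rewrite outer.
Qed.

(** Centred: the trace of 1 - s s^T is M - 1. *)
Definition obsvar (a : A) : R := dotv (obsvec a) (obsvec a) - vt / n%:R * (M%:R - 1).

Lemma obsvar_mean : \sum_a mu a * obsvar a = 0.
Proof.
have := obsvec_quad 1%:M; rewrite mxtrace1 mul1mx sqrtvec_norm => H.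
rewrite /obsvar; under eq_bigr do rewrite mulrBr.
rewrite sumrB -mulr_suml mu_sum1 mul1r -H.
by apply/eqP; rewrite subr_eq0; apply/eqP; apply: eq_bigr => a _; rewrite mul1mx.
Qed.

Definition freq (u : seq A) (r : 'I_M) : R := (\sum_(a <- u) (cnt a r)%:R) / (n * size u)%:R.

Lemma stdvec_freq u : (0 < size u)%N ->
  stdvec W th0 (fun r => freq u r - p0 r) = (size u)%:R^-1 *: \sum_(a <- u) obsvec a.
Proof.
move=> u0; have N0 : (size u)%:R != 0 :> R by rewrite pnatr_eq0 -lt0n.
apply/colP => r; rewrite !mxE summxE -/(sq r).
transitivity ((size u)%:R^-1 * ((\sum_(a <- u) ((cnt a r)%:R - n%:R * p0 r)) / (n%:R * sq r))).
  rewrite big_split/= big_const_seq count_predT iter_addr_0 -mulr_natr /freq natrM.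
  by field; rewrite n0 N0 gt_eqF.
by rewrite mulr_suml; congr (_ * _); apply: eq_bigr => a _; rewrite obsvecE.
Qed.

Lemma chidist_freq u : (0 < size u)%N -> chidist p0 (freq u) p0
  = dotv (\sum_(a <- u) obsvec a) (\sum_(a <- u) obsvec a) / (size u)%:R ^+ 2.
Proof.
move=> u0; rewrite (chidistE W th0 M_gt0) stdvec_freq// dotvZl dotvZr.
by field; rewrite pnatr_eq0 -lt0n.
Qed.

(** Squares about the sample mean are squares about p0 minus the deviation of the mean: Pearson's
    numerator becomes an i.i.d. sum plus a bounded correction. *)
Lemma sum_chidist_freq u : (0 < size u)%N ->
  \sum_(a <- u) \sum_r ((cnt a r)%:R / n%:R - freq u r) ^+ 2 / p0 r
  = \sum_(a <- u) dotv (obsvec a) (obsvec a) - (size u)%:R * chidist p0 (freq u) p0.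
Proof.
move=> u0; have N0 : (size u)%:R != 0 :> R by rewrite pnatr_eq0 -lt0n.
pose m := stdvec W th0 (fun r => freq u r - p0 r).
have mE := stdvec_freq u0; rewrite -/m in mE.
have E a : \sum_r ((cnt a r)%:R / n%:R - freq u r) ^+ 2 / p0 r
   = dotv (obsvec a + (-1) *: m) (obsvec a + (-1) *: m).
  apply: eq_bigr => r _; rewrite !mxE -/(sq r) -[X in _ / X]sq2.
  by field; rewrite gt_eqF// n0.
under eq_bigr do rewrite E dotv_lineE.
rewrite !big_split/= [X in _ + X]big_const_seq count_predT iter_addr_0.
rewrite -[X in _ + X = _]mulr_natr (chidistE W th0 M_gt0) -/m.
have -> : \sum_(a <- u) 2 * dotv (obsvec a) m * -1 = -2 * dotv (\sum_(a <- u) obsvec a) m.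
  rewrite -mulr_suml -mulr_sumr; suff -> : \sum_(a <- u) dotv (obsvec a) m = dotv (\sum_(a <- u) obsvec a) m by ring.
  elim: (u) => [|b v IH]; last by rewrite !big_cons dotvDl IH.
  by rewrite !big_nil /dotv big1// => i _; rewrite mxE mul0r.
have -> : \sum_(a <- u) obsvec a = (size u)%:R *: m by rewrite mE scalerA mulfV// scale1r.
by rewrite dotvZl; ring.
Qed.

(** The value does not depend on N, so Markov's inequality gives tightness of N|y|^2. *)
Lemma iidE_chidist_freq N : (0 < N)%N ->
  iidE mu N (fun u => N%:R * chidist p0 (freq u) p0) = vt / n%:R * (M%:R - 1).
Proof.
move=> N0; have N0' : N%:R != 0 :> R by rewrite pnatr_eq0 -lt0n.
transitivity (iidE mu N (fun u => N%:R^-1 * \sum_r (\sum_(a <- u) obsvec a r 0) ^+ 2)).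
  apply: eq_iidE => u uN; rewrite chidist_freq ?uN// /dotv.
  under eq_bigr do rewrite summxE -expr2.
  by field.
rewrite iidEZ iidE_sum.
under eq_bigr do rewrite iidE_sum_sqr ?obsvec_mean//.
rewrite -mulr_sumr mulKf//.
have := obsvec_quad 1%:M; rewrite mxtrace1 mul1mx sqrtvec_norm => <-.
rewrite exchange_big/=; apply: eq_bigr => a _; rewrite mul1mx /dotv mulr_sumr.
by apply: eq_bigr => r _; rewrite expr2.
Qed.

End Sampling.

(** * Deterministic comparison of the test ratio with the score statistic *)

Section Pathwise.
Variables (R : realType) (M M0 n : nat) (W : 'M[R]_(M, M0)) (th0 : 'cV[R]_M0).
Hypotheses (M_gt1 : (1 < M)%N) (n_gt0 : (0 < n)%N).
Hypothesis W_rank : \rank (row_mx W (const_mx 1 : 'M[R]_(M, 1))) = M0.+1.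
Notation p0 := (pmodel W th0).
Notation B := (wdesign W th0).
Variables (A : finType) (cnt : A -> 'I_M -> nat) (vt : R).
Hypothesis vt_gt0 : 0 < vt.
Variables (Pj : 'M[R]_M) (G : 'M[R]_(M0 + 1, M)).
Hypotheses (P_sym : Pj^T = Pj) (P_idem : Pj *m Pj = Pj).
Hypotheses (PB : Pj *m B = 0) (PBG : Pj + B *m G = 1%:M).

Let M_gt0 : (0 < M)%N. Proof. exact: ltnW. Qed.
Let p0_gt0 r : 0 < p0 r. Proof. exact: pmodel_gt0. Qed.

Notation obs := (obsvec n W th0 cnt).
Notation fr := (freq R n cnt).

(* Scaled so that its covariance under the sampling law is Pj. *)
Definition scorevec (a : A) : 'cV[R]_M := Num.sqrt (n%:R / vt) *: (Pj *m obs a).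

Definition score_stat (N : nat) (u : seq A) : R :=
  dotv (\sum_(a <- u) scorevec a) (\sum_(a <- u) scorevec a) / N%:R.

Definition pearson (u : seq A) (q : 'I_M -> R) : R :=
  n%:R * \sum_(a <- u) \sum_r ((cnt a r)%:R / n%:R - fr u r) ^+ 2 / q r.

Definition deff (u : seq A) (q : 'I_M -> R) : R :=
  pearson u q / ((size u - 1)%:R * (M - 1)%:R).

Definition phitest (phi : R -> R) (u : seq A) (q : 'I_M -> R) : R :=
  2 * n%:R * (size u)%:R / phi2nd phi 1 * phidiv phi (fr u) q.

Lemma score_statE u : (0 < size u)%N ->
  score_stat (size u) u = n%:R / vt * (size u)%:R *
   dotv (Pj *m stdvec W th0 (fun r => fr u r - p0 r)) (Pj *m stdvec W th0 (fun r => fr u r - p0 r)).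
Proof.
move=> u0; have N0 : (size u)%:R != 0 :> R by rewrite pnatr_eq0 -lt0n.
rewrite /score_stat (stdvec_freq W th0 M_gt0 n_gt0 cnt u0).
have -> : \sum_(a <- u) scorevec a = Num.sqrt (n%:R / vt) *: (Pj *m \sum_(a <- u) obs a).
  by rewrite mulmx_sumr scaler_sumr.
rewrite -scalemxAr !dotvZl !dotvZr.
have s2 : Num.sqrt (n%:R / vt) ^+ 2 = n%:R / vt by rewrite sqr_sqrtr// divr_ge0// ltW.
rewrite mulrA -expr2 s2; field.
by rewrite N0 gt_eqF.
Qed.

(** Three errors of relative size e: the weights 1/q for 1/p0, the divisor N - 1 for N, and the
    fluctuation of the sum of squares. Upwards they give (1 + e)^2/(1 - e) <= 1 + 8 e. *)
Lemma deff_close (u : seq A) (q : 'I_M -> R) (e : R) : (1 < size u)%N ->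
  0 < e <= 1 / 4 -> (forall r, `|q r - p0 r| <= e * p0 r) ->
  (size u)%:R <= (1 + e) * (size u - 1)%:R ->
  `|\sum_(a <- u) obsvar n W th0 cnt vt a - (size u)%:R * chidist p0 (fr u) p0|
     <= e * (vt / n%:R * (M%:R - 1)) * (size u)%:R ->
  `|deff u q - vt| <= 8 * e * vt.
Proof.
move=> u1 /andP[e0 e4] qe Ne; have u0 : (0 < size u)%N by exact: ltnW.
set N : R := (size u)%:R in Ne *.
have n0 : 0 < n%:R :> R by rewrite ltr0n.
have N0 : 0 < N by rewrite ltr0n.
have M1 : 0 < M%:R - 1 :> R by rewrite subr_gt0 ltr1n.
pose V := \sum_(a <- u) \sum_r ((cnt a r)%:R / n%:R - fr u r) ^+ 2 / p0 r.
have VE : \sum_(a <- u) obsvar n W th0 cnt vt a - N * chidist p0 (fr u) p0 =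
   V - N * (vt / n%:R * (M%:R - 1)).
  rewrite /V (sum_chidist_freq W th0 M_gt0 n_gt0 cnt u0) -/N /obsvar sumrB.
  by rewrite [X in _ - X - _]big_const_seq count_predT iter_addr_0 -[X in _ - X - _]mulr_natr -/N; ring.
rewrite VE => HV; set c := vt / n%:R * (M%:R - 1) in HV *.
have c0 : 0 < c by rewrite mulr_gt0// divr_gt0.
have q0 r : 0 < q r.
  by have := qe r; have := p0_gt0 r; rewrite ler_norml => H /andP[H1 _]; nra.
pose U := \sum_(a <- u) \sum_r ((cnt a r)%:R / n%:R - fr u r) ^+ 2 / q r.
have UV : U * (1 - e) <= V /\ V <= U * (1 + e).
  have q_le r : (1 - e) / q r <= (p0 r)^-1 /\ (p0 r)^-1 <= (1 + e) / q r.
    have := qe r; rewrite ler_norml => /andP[H1 H2]; have pr := p0_gt0 r; have qr := q0 r.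
    split.
      by rewrite ler_pdivrMr// mulrC ler_pdivlMr//; lra.
    by rewrite ler_pdivlMr// mulrC ler_pdivrMr//; lra.
  split; rewrite /U /V mulr_suml; apply: ler_sum => a _; rewrite mulr_suml; apply: ler_sum => r _.
    have [H _] := q_le r; apply: le_trans (ler_wpM2l (sqr_ge0 _) H).
    by rewrite mulrA mulrAC.
  have [_ H] := q_le r; apply: (le_trans (ler_wpM2l (sqr_ge0 _) H)).
  by rewrite mulrA mulrAC.
have {UV}[UV1 UV2] := UV.
pose N1 : R := (size u - 1)%:R; rewrite -/N1 in Ne.
have N10 : 0 < N1 by rewrite ltr0n subn_gt0.
have NN1 : N1 <= N by rewrite ler_nat leq_subr.
have dE : deff u q = n%:R * U / (N1 * (M%:R - 1)).
  by rewrite /deff /pearson -/U -/N1 natrB.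
have vE : vt = n%:R * (c * N1) / (N1 * (M%:R - 1)).
  by rewrite /c; field; rewrite !gt_eqF.
have -> : deff u q - vt = (U - c * N1) * (n%:R / (N1 * (M%:R - 1))).
  by rewrite dE {1}vE; ring.
have k0 : 0 < n%:R / (N1 * (M%:R - 1)) by rewrite divr_gt0// mulr_gt0.
rewrite normrM (gtr0_norm k0) -ler_pdivlMr//.
have -> : 8 * e * vt / (n%:R / (N1 * (M%:R - 1))) = 8 * e * (c * N1).
  by rewrite /c; field; rewrite !gt_eqF.
move: HV; rewrite ler_norml => /andP[HV1 HV2].
move: (N : R) (N1 : R) (c : R) (U : R) (V : R) N0 N10 NN1 c0 UV1 UV2 HV1 HV2 Ne {VE k0 vE dE}.
clear -e0 e4 => N N1 c U V N0 N10 NN1 c0 UV1 UV2 HV1 HV2 Ne.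
have cN1 : 0 < c * N1 by rewrite mulr_gt0.
have cN : 0 < c * N by rewrite mulr_gt0.
have H1 : c * N <= (1 + e) * (c * N1).
  have -> : (1 + e) * (c * N1) = c * ((1 + e) * N1) by ring.
  by rewrite ler_pM2l.
have H2 : c * N1 <= c * N by rewrite ler_pM2l.
have A1 : U * (1 - e) <= (1 + e) * (c * N) by lra.
have A2 : (1 - e) * (c * N) <= U * (1 + e) by lra.
move: (c * N) (c * N1) cN cN1 H1 H2 A1 A2 => X Z X0 Z0 H1 H2 A1 A2.
rewrite ler_norml; apply/andP; split.
  have : (1 - e) * Z <= U * (1 + e) by nra.
  nra.
have : U * (1 - e) <= (1 + e) * ((1 + e) * Z) by nra.
nra.
Qed.

(** The inequality t/D <= x is read as t <= x D, so the errors of t and D enter additively and the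
    size of t is irrelevant. *)
Lemma ratio_sandwich (t D Q x h e K : R) : 0 < h -> 0 < D ->
  `|t - vt * Q| <= e * K -> `|D - vt| <= 8 * e * vt ->
  e * (8 * `|x| * vt + K) <= vt * h ->
  (t / D <= x -> Q <= x + h) /\ (Q <= x - h -> t / D <= x).
Proof.
move=> h0 D0 Ht HD He.
have Hx : `|x * D - x * vt| <= 8 * e * vt * `|x|.
  by rewrite -mulrBr normrM mulrC ler_wpM2r.
move: Ht Hx; rewrite !ler_norml => /andP[T1 T2] /andP[X1 X2].
rewrite ler_pdivrMr//; split => H.
  rewrite -(ler_pM2l vt_gt0); lra.
have : vt * Q <= vt * (x - h) by rewrite ler_pM2l.
lra.
Qed.

Lemma pathwise_sandwich phi1 phi2 (x h K : R) : admissible phi1 -> admissible phi2 ->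
  0 < h -> 0 < K -> exists2 ka : R, 0 < ka & exists N0 : nat, forall u : seq A,
  (N0 <= size u)%N -> \sum_r fr u r = 1 ->
  (size u)%:R * chidist p0 (fr u) p0 <= K ->
  `|\sum_(a <- u) obsvar n W th0 cnt vt a| <= ka * (size u)%:R ->
  [/\ forall r, 0 < fr u r, exists th, minimizes W phi2 (fr u) th &
   forall th, minimizes W phi2 (fr u) th ->
    (phitest phi1 u (pmodel W th) / deff u (pmodel W th) <= x -> score_stat (size u) u <= x + h) /\
    (score_stat (size u) u <= x - h -> phitest phi1 u (pmodel W th) / deff u (pmodel W th) <= x)].
Proof.
move=> adm1 adm2 h0 K0.
have n0 : 0 < n%:R :> R by rewrite ltr0n.
have M1 : 0 < M%:R - 1 :> R by rewrite subr_gt0 ltr1n.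
have c0 : 0 < vt / n%:R * (M%:R - 1) by rewrite mulr_gt0// divr_gt0.
set c := vt / n%:R * (M%:R - 1) in c0.
have d0 : 0 < 8 * `|x| * vt + n%:R * K.
  by rewrite ltr_wpDl ?mulr_gt0// !mulr_ge0// ltW.
(* The second entry is the smallness asked by [ratio_sandwich], with n K for its K; 1/16 keeps the
   design effect estimate at least vt/2, hence positive. *)
pose e := Num.min (1 / 16) (vt * h / (8 * `|x| * vt + n%:R * K)).
have e0 : 0 < e by rewrite lt_min !divr_gt0// mulr_gt0.
have e16 : e <= 1 / 16 by rewrite ge_min lexx.
have e4 : e <= 1 / 4 by apply: (le_trans e16); lra.
have ed : e * (8 * `|x| * vt + n%:R * K) <= vt * h.
  by rewrite -ler_pdivlMr// ge_min lexx orbT.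
clearbody e.
have [h1 h10 Hexp] := minimum_divergence_expansion M_gt0 W_rank P_sym P_idem PB PBG adm1 adm2 e0.
have ec : 0 < e * c / 2 by rewrite divr_gt0// mulr_gt0.
exists (e * c / 2) => //.
(* K/h1 brings the distance to p0 below h1; 1 + 1/e gives N <= (1 + e)(N - 1); the last entry makes
   K at most half of the fluctuation allowed by [deff_close], the other half being ka N. *)
pose L := Num.max (Num.max (K / h1) (1 + e^-1)) (K / (e * c / 2)).
exists (Num.truncn L).+2 => u uN fr1 uK uV.
have u1 : (1 < size u)%N by apply: leq_trans uN.
have u0 : (0 < size u)%N by exact: ltnW.
have LN : L <= (size u)%:R.
  apply: (@le_trans _ _ (Num.truncn L).+1%:R); first by rewrite ltW// truncnS_gt.
  by rewrite ler_nat ltnW.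
set N : R := (size u)%:R in LN uK uV *.
have N0 : 0 < N by rewrite ltr0n.
have [L1 L2 L3] : [/\ K / h1 <= N, 1 + e^-1 <= N & K / (e * c / 2) <= N].
  by split; apply: le_trans LN; rewrite !le_max lexx ?orbT.
set S := chidist p0 (fr u) p0 in uK *.
have S0 : 0 <= S by apply: chidist_ge0.
have Sh : S <= h1.
  rewrite -(ler_pM2l N0); apply: (le_trans uK).
  by rewrite -ler_pdivrMr.
have [fr0 mex Hth] := Hexp _ fr1 Sh; split => // th /Hth[Hquad Hq].
have HD : `|deff u (pmodel W th) - vt| <= 8 * e * vt.
  apply: deff_close => //; first by rewrite e0.
    rewrite natrB// -/N; move: L2; rewrite -lerBrDl => L2.
    have : 1 <= e * (N - 1) by rewrite -ler_pdivrMl// mulr1.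
    lra.
  rewrite -/N -/S -/c; apply: (le_trans (ler_normB _ _)).
  have KN : N * S <= e * c / 2 * N by apply: (le_trans uK); rewrite mulrC -ler_pdivrMr.
  by rewrite [X in _ + X]ger0_norm ?mulr_ge0 ?(ltW N0)//; lra.
have D0 : 0 < deff u (pmodel W th).
  move: HD; rewrite ler_norml => /andP[HD _].
  have Hev : 8 * e * vt <= 8 * (1 / 16) * vt by rewrite ler_pM2r// ler_pM2l.
  rewrite -(ltrD2r (- vt)); apply: lt_le_trans HD; rewrite add0r ltrN2; apply: (le_lt_trans Hev); have := vt_gt0; lra.
apply: (@ratio_sandwich _ _ _ x h e (n%:R * K)) => //.
rewrite (score_statE u0) /phitest -/N.
set Q := dotv _ _ in Hquad *.
have -> : 2 * n%:R * N / phi2nd phi1 1 * phidiv phi1 (fr u) (pmodel W th)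
   - vt * (n%:R / vt * N * Q) =
   n%:R * N * (2 / phi2nd phi1 1 * phidiv phi1 (fr u) (pmodel W th) - Q).
  have p2 : 0 < phi2nd phi1 1 by case: adm1.
  by field; rewrite !gt_eqF.
rewrite normrM ger0_norm ?mulr_ge0 ?(ltW N0)//.
apply: (@le_trans _ _ (n%:R * N * (e * S))); first by rewrite ler_wpM2l// mulr_ge0 ?(ltW N0).
have -> : n%:R * N * (e * S) = e * n%:R * (N * S) by ring.
by rewrite mulrA ler_wpM2l// mulr_ge0// ltW.
Qed.

End Pathwise.

(** * Measurability of the test event *)

Section Measurability.
Variables (R : realType) (d : measure_display) (T : measurableType d).
Variables (M M0 n : nat) (W : 'M[R]_(M, M0)).
Hypothesis M_gt0 : (0 < M)%N.
Variable th : T -> 'cV[R]_M0.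
Hypothesis mth : forall j, measurable_fun setT (fun w => th w j 0).

Lemma measurable_pmodel r : measurable_fun setT (fun w => pmodel W (th w) r).
Proof.
have mlin s : measurable_fun setT (fun w => (W *m th w) s 0).
  have -> : (fun w => (W *m th w) s 0) = (fun w => \sum_j W s j * th w j 0).
    by apply/funext => w; rewrite mxE.
  by apply: measurable_sum => j; apply: measurable_funM.
have mS : measurable_fun setT (fun w => \sum_(s < M) expR ((W *m th w) s 0)).
  by apply: measurable_sum => s; exact: measurableT_comp.
have -> : (fun w => pmodel W (th w) r) =
    (fun w => expR ((W *m th w) r 0 - ln (\sum_(s < M) expR ((W *m th w) s 0)))).
  apply/funext => w; rewrite expRD expRN lnK// posrE.
  have := pmodel_gt0 W M_gt0 (th w) r; rewrite /pmodel.
  by rewrite pmulr_rgt0 ?expR_gt0// invr_gt0.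
by apply: measurableT_comp => //; apply: measurable_funB => //; exact: measurableT_comp.
Qed.

(** On nonnegative reals the inverse is the power -1, also at 0 where both are 0 by convention. *)
Lemma measurable_invr_ge0 (f : T -> R) : (forall w, 0 <= f w) ->
  measurable_fun setT f -> measurable_fun setT (fun w => (f w)^-1).
Proof.
move=> f0 mf.
have -> : (fun w => (f w)^-1) = (fun w => powR (f w) (-1)).
  by apply/funext => w; rewrite powR_inv1.
exact: (measurableT_comp (@measurable_powR R (-1)) mf).
Qed.

Variables (Y : nat -> T -> 'I_M -> nat).
Hypothesis mY : forall l r, measurable_fun setT (fun w => (Y l w r)%:R : R).

Lemma measurable_phat N r : measurable_fun setT (fun w => phat R n Y N w r).
Proof. by apply: measurable_funM => //; apply: measurable_sum => l; exact: mY. Qed.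

Lemma measurable_deff_est N : measurable_fun setT (fun w => deff_est n W Y N w (th w)).
Proof.
apply: measurable_funM => //; apply: measurable_funM => //.
apply: measurable_sum => l; apply: measurable_sum => r; apply: measurable_funM.
  apply: measurable_funX; apply: measurable_funB; last exact: measurable_phat.
  by apply: measurable_funM => //; exact: mY.
apply: measurable_invr_ge0; last exact: measurable_pmodel.
by move=> w; exact/ltW/pmodel_gt0.
Qed.

Lemma deff_est_ge0 N w : 0 <= deff_est n W Y N w (th w).
Proof.
rewrite /deff_est /X2stat divr_ge0 ?mulr_ge0// sumr_ge0// => l _.
by rewrite sumr_ge0// => r _; rewrite divr_ge0 ?sqr_ge0// ltW// pmodel_gt0.
Qed.

Lemma phat_ge0 N w r : 0 <= phat R n Y N w r.
Proof. by rewrite divr_ge0// sumr_ge0. Qed.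

Lemma measurable_dphi phi N : admissible phi ->
  measurable_fun setT (fun w => dphi phi (phat R n Y N w) (pmodel W (th w))).
Proof.
move=> adm; apply: emeasurable_sum => r.
pose p w := phat R n Y N w r; pose q w := pmodel W (th w) r.
have q0 w : 0 < q w by exact: pmodel_gt0.
have mp : measurable_fun setT p by exact: measurable_phat.
have mq : measurable_fun setT q by exact: measurable_pmodel.
(* The dummy value 1 on empty cells keeps the argument in ]0, +oo[, the only place where phi is
   known to be continuous. *)
pose u w := (if p w == 0 then 1 else p w / q w).
have meq : measurable_fun setT (fun w => p w == 0) by apply: measurable_fun_eqr.
have mu : measurable_fun setT u.
  apply: measurable_fun_ifT => //; apply: measurable_funM => //.
  by apply: measurable_invr_ge0 => // w; exact: ltW.
have -> : (fun w => if pmodel W (th w) r == 0 then if phat R n Y N w r == 0 then 0%E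
      else ((phat R n Y N w r)%:E * phi_slope_inf phi)%E
    else if phat R n Y N w r == 0 then ((pmodel W (th w) r)%:E * phi_at0 phi)%E
    else (pmodel W (th w) r * phi (phat R n Y N w r / pmodel W (th w) r))%:E)
  = (fun w => if p w == 0 then ((q w)%:E * phi_at0 phi)%E else (q w * phi (u w))%:E).
  apply/funext => w; rewrite (gt_eqF (q0 w)) /u -/(p w) -/(q w).
  by case: ifP.
apply: measurable_fun_ifT => //.
  by apply: emeasurable_funM => //; apply/measurable_EFinP.
apply/measurable_EFinP; apply: measurable_funM => //.
apply: (@measurable_comp _ _ _ _ _ _ (`]0, +oo[%classic : set R) phi setT u) => //.
- move=> _ [w _ <-]; rewrite /= in_itv/= andbT /u; case: eqP => // /eqP pn0.
  by rewrite divr_gt0// lt_neqAle eq_sym pn0 phat_ge0.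
- apply: open_continuous_measurable_fun; first exact: interval_open.
  by move=> x; rewrite inE/= in_itv/= andbT => x0; exact: phi_continuous.
Qed.

Lemma measurable_test_event phi N (x : R) : admissible phi ->
  measurable [set w | (Tphi n phi W Y N w (th w) * ((deff_est n W Y N w (th w))^-1)%:E <= x%:E)%E].
Proof.
move=> adm; rewrite -[X in measurable X]setTI; apply: emeasurable_fun_infty_c => //.
apply: emeasurable_funM.
  by apply: emeasurable_funM => //; exact: measurable_dphi.
apply/measurable_EFinP; apply: measurable_invr_ge0; first exact: deff_est_ge0.
exact: measurable_deff_est.
Qed.

End Measurability.

Lemma wdesign_rank (R : realType) (M M0 : nat) (W : 'M[R]_(M, M0)) (th0 : 'cV[R]_M0) :
  (0 < M)%N -> \rank (wdesign W th0) = \rank (row_mx W (const_mx 1 : 'M[R]_(M, 1))).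
Proof.
move=> M0_gt0.
pose D : 'rV[R]_M := \row_i Num.sqrt (pmodel W th0 i).
have -> : wdesign W th0 = diag_mx D *m row_mx W (const_mx 1 : 'M[R]_(M, 1)).
  by apply/matrixP => i j; rewrite mul_diag_mx !mxE.
apply: eqmx_rank; apply/eqmxP/eqmxMfull.
rewrite row_full_unit unitmxE det_diag unitfE; apply/prodf_neq0 => i _.
by rewrite mxE gt_eqF// sqrtr_gt0 pmodel_gt0.
Qed.

Section ScoreMoments.
Variables (R : realType) (M M0 n k : nat) (W : 'M[R]_(M, M0)) (th0 : 'cV[R]_M0).
Hypotheses (M_gt0 : (0 < M)%N) (n_gt0 : (0 < n)%N).
Notation p0 := (pmodel W th0).
Notation B := (wdesign W th0).
Variables (A : finType) (mu : A -> R) (cnt : A -> 'I_M -> nat) (vt : R).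
Hypothesis mu_ge0 : forall a, 0 <= mu a.
Hypothesis mu_sum1 : \sum_a mu a = 1.
Hypothesis vt_gt0 : 0 < vt.
Hypothesis cnt_mean : forall r, \sum_a mu a * (cnt a r)%:R = n%:R * p0 r.
Hypothesis cnt_cov : forall r s,
  \sum_a mu a * (((cnt a r)%:R - n%:R * p0 r) * ((cnt a s)%:R - n%:R * p0 s))
  = vt * n%:R * Sigma p0 r s.
Variables (Pj : 'M[R]_M).
Hypotheses (P_sym : Pj^T = Pj) (P_idem : Pj *m Pj = Pj) (PB : Pj *m B = 0).
Hypothesis P_trace : \tr Pj = k%:R.

Notation xi := (scorevec n W th0 cnt vt Pj).

Let c2 : Num.sqrt (n%:R / vt) ^+ 2 * (vt / n%:R) = 1.
Proof.
rewrite sqr_sqrtr ?divr_ge0 ?(ltW vt_gt0)//.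
by field; rewrite pnatr_eq0 -lt0n n_gt0 gt_eqF.
Qed.

Let Ps : Pj *m sqrtvec W th0 = 0.
Proof. by rewrite mulmxA PB mul0mx. Qed.

Let dotv0r (v : 'cV[R]_M) : dotv v 0 = 0.
Proof. by apply: big1 => i _; rewrite mxE mulr0. Qed.

(** The covariance vt/n (1 - s s^T) becomes the identity on the range of [Pj]: the scaling removes
    vt/n and [Pj] kills s = sqrt(p0). With finitely many outcomes the sum of all |xi|^2 is a valid
    bound B. *)
Lemma scorevec_laplace (t : R) : 0 <= t ->
  (fun N => iidE mu N (fun u => expR (- t * score_stat n W th0 cnt vt Pj N u))) @ \oo -->
    expR (- (k%:R / 2) * ln (1 + 2 * t)).
Proof.
have obs_mean := obsvec_mean M_gt0 n_gt0 mu_sum1 cnt_mean.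
have obs_quad := obsvec_quad M_gt0 n_gt0 cnt_cov.
have obs_sqr := obsvec_dot_sqr M_gt0 n_gt0 cnt_cov.
apply: (@iid_laplace_cvg R A mu M k xi Pj (\sum_a dotv (xi a) (xi a))) => //.
- move=> i.
  transitivity (Num.sqrt (n%:R / vt) * \sum_j Pj i j * \sum_a mu a * obsvec n W th0 cnt a j 0).
    rewrite mulr_sumr; under [RHS]eq_bigr do rewrite 2!mulr_sumr.
    rewrite exchange_big/=; apply: eq_bigr => a _.
    rewrite !mxE !mulr_sumr; apply: eq_bigr => j _; ring.
  by rewrite big1 ?mulr0// => j _; rewrite obs_mean mulr0.
- by move=> a; rewrite /scorevec -scalemxAr mulmxA P_idem.
- move=> v Pv.
  have E a : dotv v (xi a) = Num.sqrt (n%:R / vt) * dotv v (obsvec n W th0 cnt a).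
    by rewrite /scorevec dotvZr -[in LHS]P_sym -dotv_mulmxl Pv.
  transitivity (Num.sqrt (n%:R / vt) ^+ 2 * \sum_a mu a * dotv v (obsvec n W th0 cnt a) ^+ 2).
    by rewrite mulr_sumr; apply: eq_bigr => a _; rewrite E exprMn mulrCA.
  rewrite obs_sqr mulrA c2 mul1r -{3}Pv dotv_mulmxl P_sym Ps dotv0r.
  by rewrite expr0n/= subr0.
- transitivity (Num.sqrt (n%:R / vt) ^+ 2 * \sum_a mu a * dotv (obsvec n W th0 cnt a) (Pj *m obsvec n W th0 cnt a)).
    rewrite mulr_sumr; apply: eq_bigr => a _.
    by rewrite /scorevec dotvZl dotvZr (dotv_proj P_sym P_idem); ring.
  by rewrite obs_quad Ps dotv0r subr0 mulrA c2 mul1r.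
- by move=> a; rewrite (bigD1 a)//= lerDl sumr_ge0// => b _; exact: dotv_ge0.
Qed.

End ScoreMoments.

Lemma indicator_or3_le (R : realType) (a b c : bool) :
  [|| a, b | c]%:R <= a%:R + b%:R + c%:R :> R.
Proof. by case: a; case: b; case: c => /=; lra. Qed.

Lemma indicator_le_and3 (R : realType) (a b c : bool) :
  a%:R <= [&& a, ~~ b & ~~ c]%:R + b%:R + c%:R :> R.
Proof. by case: a; case: b; case: c => /=; lra. Qed.

Section FrequencyTypes.
Variables (M n : nat).

(** Entries summing to n are at most n, so cluster vectors live in a finite type and [inord] in
    [encode] never meets its default. *)
Definition counts := {ffun 'I_M -> 'I_n.+1}.

Definition encode (y : 'I_M -> nat) : counts := [ffun r => inord (y r)].

Definition count_of (a : counts) (r : 'I_M) : nat := a r.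

Lemma count_ofK (y : 'I_M -> nat) : (\sum_r y r)%N = n -> count_of (encode y) = y.
Proof.
move=> yn; apply/funext => r; rewrite /count_of ffunE inordK// ltnS -yn.
by rewrite (bigD1 r)//= leq_addr.
Qed.

End FrequencyTypes.

(** The statistic may be infinite when a cell is empty, hence the extended-real product with an
    inverse. Samples without a minimiser leave [thhat] free; for large N they are all bad. *)
Theorem theorem3 (R : realType) (d : measure_display) (T : measurableType d)
  (P : probability T R) (M M0 n : nat) (W : 'M[R]_(M, M0)) (th0 : 'cV[R]_M0)
  (rho2 : R) (phi1 phi2 : R -> R)
  (Y : nat -> T -> 'I_M -> nat) (thhat : nat -> T -> 'cV[R]_M0) :
  (3 <= M)%N -> (1 <= M0)%N -> (M0 < M - 1)%N ->
  \rank (row_mx W (const_mx 1 : 'M[R]_(M, 1))) = M0.+1 ->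
  (2 <= n)%N -> 0 <= rho2 ->
  admissible phi1 -> admissible phi2 ->
  (* cluster frequency vectors: measurable, nonnegative integers summing to n *)
  (forall (l : nat) (r : 'I_M), measurable_fun setT (fun w => (Y l w r)%:R : R)) ->
  (forall (l : nat) (w : T), (\sum_(r < M) Y l w r)%N = n) ->
  (* i.i.d. *)
  mutually_independent P Y -> identically_distributed P Y ->
  (* E[Y^(l)] = n p(theta0) *)
  (forall (l : nat) (r : 'I_M),
     (\int[P]_w ((Y l w r)%:R)%:E = (n%:R * pmodel W th0 r)%:E)%E) ->
  (* Var[Y^(l)] = vartheta_n n Sigma_{p(theta0)}, vartheta_n = 1 + (n-1) rho^2 *)
  (forall (l : nat) (r s : 'I_M),
     (\int[P]_w (((Y l w r)%:R - n%:R * pmodel W th0 r) *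
                 ((Y l w s)%:R - n%:R * pmodel W th0 s))%:E
      = ((1 + (n%:R - 1) * rho2) * n%:R * Sigma (pmodel W th0) r s)%:E)%E) ->
  (* QMphiE with phi2: measurable, and a minimizer whenever one exists *)
  (forall (N : nat) (j : 'I_M0), measurable_fun setT (fun w => thhat N w j 0)) ->
  (forall (N : nat) (w : T),
     (exists th' : 'cV[R]_M0, forall th : 'cV[R]_M0,
        (dphi phi2 (phat R n Y N w) (pmodel W th') <= dphi phi2 (phat R n Y N w) (pmodel W th))%E) ->
     forall th : 'cV[R]_M0,
       (dphi phi2 (phat R n Y N w) (pmodel W (thhat N w))
        <= dphi phi2 (phat R n Y N w) (pmodel W th))%E) ->
  (* convergence in law to chi^2_{M-M0-1} (continuous limit cdf) *)
  forall x : R,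
    (fun N : nat => fine (P [set w | (Tphi n phi1 W Y N w (thhat N w) *
                                       ((deff_est n W Y N w (thhat N w))^-1)%:E
                                       <= x%:E)%E]))
      @ \oo --> chi2_cdf (M - M0 - 1) x.
Proof.
move=> M3 M01 M0M Wr n2 rho0 adm1 adm2 mY Yn Yind Yid Ymean Ycov mth Hmin x.
have M_gt1 : (1 < M)%N by exact: leq_trans M3.
have M_gt0 : (0 < M)%N by exact: ltnW.
have n_gt0 : (0 < n)%N by exact: ltnW.
have n1 : 1 <= n%:R :> R by rewrite ler1n.
pose vt : R := 1 + (n%:R - 1) * rho2.
have vt_gt0 : 0 < vt by rewrite ltr_wpDr// mulr_ge0// subr_ge0.
pose k := (M - M0 - 1)%N.
have k_gt0 : (0 < k)%N by rewrite /k subnAC subn_gt0.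
have Br : \rank (wdesign W th0) = (M0 + 1)%N by rewrite wdesign_rank// Wr addn1.
have [Pj [G [P_sym P_idem PB PBG P_tr]]] := ex_orthogonal_projection Br.
have P_trace : \tr Pj = k%:R.
  rewrite P_tr /k -subnDA natrB// addn1; apply: leq_trans M0M _; exact: leq_subr.
pose Z l w : counts M n := encode n (Y l w).
have cntZ l w : count_of (Z l w) = Y l w by apply: count_ofK; exact: Yn.
have mZ l a : measurable (Z l @^-1` [set a]).
  have -> : Z l @^-1` [set a] =
      \bigcap_(r in [set: 'I_M]) ((fun w => (Y l w r)%:R : R) @^-1` [set (a r : nat)%:R]).
    apply/seteqP; split => [w /= Zw r _|w H] /=.
      by rewrite -Zw -(cntZ l w).
    apply/ffunP => r; apply/val_inj; rewrite /= -[LHS]/(count_of (Z l w) r) cntZ.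
    by have := H r I => /= /eqP; rewrite eqr_nat => /eqP.
  apply: fin_bigcap_measurable; first exact: finite_finset.
  by move=> r _; rewrite -[X in measurable X]setTI; exact: mY.
have Z_indep (s : seq nat) (F : nat -> set (counts M n)) : uniq s ->
    P (\bigcap_(l in [set` s]) (Z l @^-1` F l)) = (\prod_(l <- s) P (Z l @^-1` F l))%E.
  exact: (Yind s (fun l => encode n @^-1` F l)).
have Z_idd l (F : set (counts M n)) : P (Z l @^-1` F) = P (Z 0%N @^-1` F).
  exact: (Yid l (encode n @^-1` F)).
pose mu := lawpmf P Z.
have mu_ge0 : forall a, 0 <= mu a by exact: lawpmf_ge0.
have mu_sum1 : \sum_a mu a = 1 by exact: lawpmf_sum1.
have cnt_mean r : \sum_a mu a * (count_of a r)%:R = n%:R * pmodel W th0 r.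
  apply: EFin_inj; rewrite -(law_integral P mZ) -(Ymean 0%N r).
  by apply: eq_integral => w _; rewrite cntZ.
have cnt_cov r s : \sum_a mu a * (((count_of a r)%:R - n%:R * pmodel W th0 r) *
    ((count_of a s)%:R - n%:R * pmodel W th0 s)) = vt * n%:R * Sigma (pmodel W th0) r s.
  apply: EFin_inj.
  rewrite -(law_integral P mZ (fun a => ((count_of a r)%:R - n%:R * pmodel W th0 r) *
    ((count_of a s)%:R - n%:R * pmodel W th0 s))) -(Ycov 0%N r s).
  by apply: eq_integral => w _; rewrite cntZ.
pose Q N (u : seq (counts M n)) : R := score_stat n W th0 (@count_of M n) vt Pj N u.
have Q_ge0 N u : 0 <= Q N u by rewrite divr_ge0 ?dotv_ge0.
have Q_laplace (t : R) : 0 <= t -> (fun N => iidE mu N (fun u => expR (- t * Q N u))) @ \oo -->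
    expR (- (k%:R / 2) * ln (1 + 2 * t)).
  exact: scorevec_laplace.
have sz N w : size (window Z 0 N w) = N by rewrite size_map size_iota.
have sum_window N w (f : counts M n -> R) : \sum_(a <- window Z 0 N w) f a = \sum_(l < N) f (Z l w).
  by rewrite big_map -{1}(subn0 N) -/(index_iota 0 N) big_mkord.
have freqE N w : freq R n (@count_of M n) (window Z 0 N w) = phat R n Y N w.
  apply/funext => r; rewrite /freq /phat sz sum_window; congr (_ / _).
  by apply: eq_bigr => l _; rewrite cntZ.
have freq1 N w : (0 < N)%N -> \sum_r phat R n Y N w r = 1.
  move=> N0; rewrite -mulr_suml exchange_big/=.
  rewrite (eq_bigr (fun=> n%:R)); last by move=> l _; rewrite -natr_sum Yn.
  by rewrite sumr_const card_ord -mulrnA divff// pnatr_eq0 -lt0n muln_gt0 n_gt0.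
have deffE N w th : deff_est n W Y N w th = deff n (@count_of M n) (window Z 0 N w) (pmodel W th).
  rewrite /deff_est /deff /X2stat /pearson sz sum_window; congr (_ * _ / _).
  by apply: eq_bigr => l _; rewrite freqE cntZ.
apply/cvgrPdist_le => e e0.
have e3 : 0 < e / 3 by rewrite divr_gt0.
have [h h0 Hcdf] := iidE_cdf_sandwich k_gt0 mu_ge0 mu_sum1 Q_ge0 Q_laplace x e3.
have M1 : 0 < M%:R - 1 :> R by rewrite subr_gt0 ltr1n.
pose sg : R := vt / n%:R * (M%:R - 1).
have sg0 : 0 < sg by rewrite mulr_gt0// divr_gt0// ltr0n.
(* N|y|^2 has mean sg for every positive N, so Markov's inequality bounds its excess over K by e/3
   uniformly in N. *)
pose K := sg / (e / 3).
have K0 : 0 < K by rewrite divr_gt0.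
have [ka ka0 [N0 Hpath]] := pathwise_sandwich M_gt1 n_gt0 Wr (@count_of M n) vt_gt0
  P_sym P_idem PB PBG x adm1 adm2 h0 K0.
pose ov (a : counts M n) := obsvar n W th0 (@count_of M n) vt a.
have ov_mean : \sum_a mu a * ov a = 0 by exact: obsvar_mean.
pose S (u : seq (counts M n)) := chidist (pmodel W th0) (freq R n (@count_of M n) u) (pmodel W th0).
pose bad1 N u := K < N%:R * S u.
pose bad2 N (u : seq (counts M n)) := ka * N%:R < `|\sum_(a <- u) ov a|.
have Hbad1 N : (0 < N)%N -> iidE mu N (fun u => (bad1 N u)%:R) <= e / 3.
  move=> Ngt0; apply: (@le_trans _ _ (iidE mu N (fun u => K^-1 * (N%:R * S u)))).
    apply: ler_iidE => // u _; rewrite /bad1; case: ltP => [H|_].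
      by rewrite ler_pdivlMl// mulr1 ltW.
    by rewrite !mulr_ge0 ?invr_ge0 ?(ltW K0)// chidist_ge0// => r; exact: pmodel_gt0.
  rewrite iidEZ (iidE_chidist_freq M_gt0 n_gt0 mu_sum1 cnt_mean cnt_cov)// -/sg /K.
  by rewrite invf_div divfK// gt_eqF.
pose Vo := \sum_a mu a * ov a ^+ 2.
have Hbad2 : \forall N \near \oo, iidE mu N (fun u => (bad2 N u)%:R) <= e / 3.
  near=> N.
  have Ngt0 : (0 < N)%N by near: N; exact: nbhs_infty_gt.
  have NR : 0 < N%:R :> R by rewrite ltr0n.
  apply: (le_trans (iidE_chebyshev mu_ge0 mu_sum1 N (mulr_gt0 ka0 NR) ov_mean)).
  have HN : Vo / (ka ^+ 2 * (e / 3)) <= N%:R by near: N; exact: nbhs_infty_ger.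
  move: HN; rewrite ler_pdivrMr ?mulr_gt0 ?exprn_gt0// => HN.
  rewrite ler_pdivrMr ?exprn_gt0 ?mulr_gt0// -/Vo.
  have -> : e / 3 * (ka * N%:R) ^+ 2 = N%:R * (N%:R * (ka ^+ 2 * (e / 3))) by ring.
  by rewrite ler_pM2l.
near=> N.
have NN0 : (N0 <= N)%N by near: N; exact: nbhs_infty_ge.
have Ngt0 : (0 < N)%N by near: N; exact: nbhs_infty_gt.
have Hb1 := Hbad1 N Ngt0.
have Hb2 : iidE mu N (fun u => (bad2 N u)%:R) <= e / 3 by near: N.
have [Hup Hlo] : iidE mu N (fun u => (Q N u <= x + h)%R%:R) <= chi2_cdf k x + e / 3 /\
   chi2_cdf k x - e / 3 <= iidE mu N (fun u => (Q N u <= x - h)%R%:R) by near: N.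
set E := [set w | _].
have mE : measurable E by exact: measurable_test_event.
(* Off the bad events all cells are positive and a minimiser exists, so divergences are real and
   [thhat] is a minimiser. Inclusions both ways then cost two thirds of e, the last third coming
   from [iidE_cdf_sandwich]. *)
have good w : ~~ bad1 N (window Z 0 N w) -> ~~ bad2 N (window Z 0 N w) ->
   (E w -> Q N (window Z 0 N w) <= x + h) /\ (Q N (window Z 0 N w) <= x - h -> E w).
  rewrite -!leNgt => b1 b2; set u := window Z 0 N w in b1 b2 *.
  have su : size u = N by exact: sz.
  have := Hpath u; rewrite su freqE => /(_ NN0 (freq1 N w Ngt0)).
  rewrite -(freqE N w) => /(_ b1 b2)[fr0 [th' Hth'] Hall].
  have dE phi th : dphi phi (phat R n Y N w) (pmodel W th) =
      (phidiv phi (freq R n (@count_of M n) u) (pmodel W th))%:E.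
    by rewrite -freqE; apply: dphiE => // r; exact: pmodel_gt0.
  have thmin : minimizes W phi2 (freq R n (@count_of M n) u) (thhat N w).
    move=> th; rewrite -lee_fin -!dE; apply: Hmin.
    by exists th' => th''; rewrite !dE lee_fin; exact: Hth'.
  have := Hall _ thmin.
  suff -> : E w = (phitest n (@count_of M n) phi1 u (pmodel W (thhat N w)) /
        deff n (@count_of M n) u (pmodel W (thhat N w)) <= x) :> Prop by [].
  by rewrite /E/= /Tphi dE deffE -!EFinM lee_fin /phitest su.
have probE (B : pred (seq (counts M n))) :
   P [set w | B (window Z 0 N w)] = (iidE mu N (fun u => (B u)%:R))%:E.
  exact: probability_window.
have mW (B : pred (seq (counts M n))) : measurable [set w | B (window Z 0 N w)].
  exact: measurable_window.
have PE : P E = (fine (P E))%:E by rewrite fineK// fin_num_measure.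
have upE : fine (P E) <= iidE mu N (fun u => (Q N u <= x + h)%R%:R) + e / 3 + e / 3.
  have HE : (P E <= P [set w | [|| (Q N (window Z 0 N w) <= x + h)%R, bad1 N (window Z 0 N w) | bad2 N (window Z 0 N w)]])%E.
    apply: le_measure; rewrite ?inE//.
      exact: (mW (fun u => [|| (Q N u <= x + h)%R, bad1 N u | bad2 N u])).
    move=> w Ew /=; have [b1|b1] := boolP (bad1 N _); first by rewrite orbT.
    have [b2|b2] := boolP (bad2 N _); first by rewrite !orbT.
    by have [/(_ Ew) -> _] := good w b1 b2.
  move: HE; rewrite (probE (fun u => [|| (Q N u <= x + h)%R, bad1 N u | bad2 N u])) PE lee_fin.
  move=> /le_trans; apply.
  apply: (@le_trans _ _ (iidE mu N (fun u => (Q N u <= x + h)%R%:R + (bad1 N u)%:R + (bad2 N u)%:R))).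
    by apply: ler_iidE => // u _; exact: indicator_or3_le.
  by rewrite !iidED; apply: lerD => //; apply: lerD.
have loE : iidE mu N (fun u => (Q N u <= x - h)%R%:R) <= fine (P E) + e / 3 + e / 3.
  have HE : (P [set w | [&& (Q N (window Z 0 N w) <= x - h)%R, ~~ bad1 N (window Z 0 N w) & ~~ bad2 N (window Z 0 N w)]] <= P E)%E.
    apply: le_measure; rewrite ?inE//.
      exact: (mW (fun u => [&& (Q N u <= x - h)%R, ~~ bad1 N u & ~~ bad2 N u])).
    by move=> w /= /and3P[Qw b1 b2]; have [_] := good w b1 b2; apply.
  move: HE; rewrite (probE (fun u => [&& (Q N u <= x - h)%R, ~~ bad1 N u & ~~ bad2 N u])) PE lee_fin => HE.
  apply: (@le_trans _ _ (iidE mu N (fun u => ([&& (Q N u <= x - h)%R, ~~ bad1 N u & ~~ bad2 N u])%:R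
     + (bad1 N u)%:R + (bad2 N u)%:R))).
    by apply: ler_iidE => // u _; exact: indicator_le_and3.
  by rewrite !iidED; apply: lerD => //; apply: lerD.
rewrite ler_norml -/k; apply/andP; split; lra.
Unshelve. all: by end_near.
Qed.
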